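(* Let $\Omega\in\mathsf{CM}_{\mathbf c}(W)$ with distinguished element $\lambda_\Omega$. If $\Omega=\{\lambda_\Omega\}$, then $\Delta(\lambda_\Omega)$ is a free module of rank $|W|$ over $E_\Omega=\mathrm{End}_{\mathsf H_{\mathbf c}}(\Delta(\lambda_\Omega))$.
   Context: The ground field is $\mathbb C$. $(W,\mathfrak h)$ is a complex reflection group, $\mathcal S$ the set of complex reflections in $W$; for $s\in\mathcal S$, $\alpha_s\in\mathfrak h$ and $\alpha_s^\vee\in\mathfrak h^*$ span $\mathrm{Im}(s-1)|_{\mathfrak h}$ and $\mathrm{Im}(s-1)|_{\mathfrak h^*}$, with $\alpha_s^\vee(\alpha_s)=2$; $\mathbf c:\mathcal S\to\mathbb C$ is conjugation invariant. $\mathsf H_{\mathbf c}$ is the quotient of $T(\mathfrak h\oplus\mathfrak h^* )\rtimes W$ by $[x,x']=[y,y']=0$ and $[y,x]=\sum_{s\in\mathcal S}\mathbf c(s)\frac{x(\alpha_s)\alpha_s^\vee(y)}{\alpha_s^\vee(\alpha_s)}s$ ($x,x'\in\mathfrak h^*$, $y,y'\in\mathfrak h$). It contains $\mathbb C[\mathfrak h]=\mathrm{Sym}(\mathfrak h^* )$ and $\mathbb C[\mathfrak h^*]=\mathrm{Sym}(\mathfrak h)$. For $\lambda\in\mathrm{Irr}(W)$, $\Delta(\lambda)=\mathsf H_{\mathbf c}\otimes_{\mathbb C[\mathfrak h^*]\rtimes W}\lambda$ with $\mathfrak h$ acting by $0$ on $\lambda$. Let $\mathsf H_{\mathbf c}^{\mathbf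 0}=\mathsf H_{\mathbf c}/\langle\mathbb C[\mathfrak h]^W_+,\mathbb C[\mathfrak h^*]^W_+\rangle$. Its simple modules are the simple heads $L(\lambda)$ of $\Delta(\lambda)/\mathbb C[\mathfrak h]^W_+\Delta(\lambda)$, $\lambda\in\mathrm{Irr}(W)$, and $\mathsf{CM}_{\mathbf c}(W)$ is the partition of $\mathrm{Irr}(W)$ according to the blocks of $\mathsf H^{\mathbf 0}_{\mathbf c}$. $\lambda_\Omega$ is the distinguished element of $\Omega$, here its only element. The ring $E_\Omega$ is known to be commutative. *)

(* Defs.v *)
From HB Require Import structures.
From mathcomp Require Import all_boot all_order all_algebra all_fingroup.
From mathcomp Require Import all_character.
From mathcomp Require Import boolp reals complex.
From mathcomp Require Import monalg mpoly.

Set Implicit Arguments.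
Unset Strict Implicit.
Unset Printing Implicit Defensive.

Import GRing.Theory.
Local Open Scope ring_scope.
Local Open Scope quotient_scope.

Inductive submod_span (A : pzRingType) (M : lmodType A) (S : M -> Prop) : M -> Prop :=
| span0 : submod_span S 0
| spanZD a s m : S s -> submod_span S m -> submod_span S (a *: s + m).

Section LModQuotient.
Variables (A : pzRingType) (M : lmodType A) (S : M -> Prop).

Lemma spanD x y : submod_span S x -> submod_span S y -> submod_span S (x + y).
Proof.
move=> Sx Sy; elim: Sx => [|a s m Ss _ IH]; first by rewrite add0r.
by rewrite -addrA; apply: spanZD.
Qed.

Lemma spanZ a x : submod_span S x -> submod_span S (a *: x).
Proof.
elim=> [|b s m Ss _ IH]; first by rewrite scaler0; exact: span0.
by rewrite scalerDr scalerA; apply: spanZD.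
Qed.

Definition span_pred : {pred M} := fun m => `[< submod_span S m >].

Lemma span_zmod_closed : zmod_closed span_pred.
Proof.
split; first exact/asboolP/span0.
move=> x y /asboolP Sx /asboolP Sy; apply/asboolP/spanD => //.
by rewrite -scaleN1r; apply: spanZ.
Qed.

HB.instance Definition _ := GRing.isZmodClosed.Build M span_pred span_zmod_closed.

(* M / (A-submodule generated by S) *)
Definition lquot : Type := Quotient.quot span_pred.

HB.instance Definition _ := GRing.Zmodule.on lquot.
HB.instance Definition _ : ZmodQuotient M (Quotient.equiv span_pred) 0 -%R +%R lquot :=
  ZmodQuotient.on lquot.

Definition lquot_scale (a : A) : lquot -> lquot := lift_op1 lquot ( *:%R a).

Lemma pi_lquot_scale a : {morph \pi_lquot : x / a *: x >-> lquot_scale a x}.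
Proof.
move=> x; rewrite /lquot_scale; unlock; apply/eqP.
rewrite -[_ == _]Quotient.idealrBE -scalerBr; apply/asboolP/spanZ/asboolP.
by rewrite -[`[< _ >]]/(_ \in span_pred) Quotient.idealrBE reprK.
Qed.

Fact lquot_scaleA a b v :
  lquot_scale a (lquot_scale b v) = lquot_scale (a * b) v.
Proof. by rewrite -[v]reprK -!pi_lquot_scale scalerA. Qed.

Fact lquot_scale1 : left_id 1 lquot_scale.
Proof. by move=> v; rewrite -[v]reprK -pi_lquot_scale scale1r. Qed.

Fact lquot_scaleDr : right_distributive lquot_scale +%R.
Proof.
move=> a u v; rewrite -[u]reprK -[v]reprK -pi_addr -!pi_lquot_scale.
by rewrite scalerDr pi_addr.
Qed.

Fact lquot_scaleDl v : {morph lquot_scale^~ v : a b / a + b}.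
Proof.
by move=> a b; rewrite -[v]reprK -!pi_lquot_scale scalerDl pi_addr.
Qed.

HB.instance Definition _ := GRing.Zmodule_isLmodule.Build A lquot
  lquot_scaleA lquot_scale1 lquot_scaleDr lquot_scaleDl.

Definition lproj : M -> lquot := \pi_lquot.

Fact lproj_is_linear : linear lproj.
Proof. by move=> a x y; rewrite /lproj pi_addr pi_lquot_scale. Qed.

HB.instance Definition _ :=
  GRing.isLinear.Build A M lquot _ lproj lproj_is_linear.

End LModQuotient.

Inductive two_sided_ideal (A : pzRingType) (S : A -> Prop) : A -> Prop :=
| ideal0 : two_sided_ideal S 0
| idealMD a s b x :
    S s -> two_sided_ideal S x -> two_sided_ideal S (a * s * b + x).

Section RingQuotient.
Variables (A : pzRingType) (S : A -> Prop).

Lemma idealD x y :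
  two_sided_ideal S x -> two_sided_ideal S y -> two_sided_ideal S (x + y).
Proof.
move=> Sx Sy; elim: Sx => [|a s b m Ss _ IH]; first by rewrite add0r.
by rewrite -addrA; apply: idealMD.
Qed.

Lemma idealMM a b x : two_sided_ideal S x -> two_sided_ideal S (a * x * b).
Proof.
elim=> [|c s d m Ss _ IH]; first by rewrite mulr0 mul0r; exact: ideal0.
by rewrite mulrDr mulrDl !mulrA -(mulrA _ d b); apply: idealMD.
Qed.

Definition ideal_pred : {pred A} := fun m => `[< two_sided_ideal S m >].

Lemma ideal_zmod_closed : zmod_closed ideal_pred.
Proof.
split; first exact/asboolP/ideal0.
move=> x y /asboolP Sx /asboolP Sy; apply/asboolP/idealD => //.
by rewrite -mulN1r -[_ * _]mulr1; apply: idealMM.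
Qed.

HB.instance Definition _ :=
  GRing.isZmodClosed.Build A ideal_pred ideal_zmod_closed.

(* A / (two-sided ideal generated by S) *)
Definition rquot : Type := Quotient.quot ideal_pred.

HB.instance Definition _ := GRing.Zmodule.on rquot.
HB.instance Definition _ : ZmodQuotient A (Quotient.equiv ideal_pred) 0 -%R +%R rquot :=
  ZmodQuotient.on rquot.

Definition rquot_one : rquot := \pi_rquot 1.
Definition rquot_mul : rquot -> rquot -> rquot := lift_op2 rquot *%R.

Lemma pi_rquot_mul : {morph \pi_rquot : x y / x * y >-> rquot_mul x y}.
Proof.
move=> x y; rewrite /rquot_mul; unlock; apply/eqP.
rewrite -[_ == _]Quotient.idealrBE; apply/asboolP.
have repr_ideal z : two_sided_ideal S (z - generic_quotient.repr (\pi_rquot z)).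
  apply/asboolP; rewrite -[`[< _ >]]/(_ \in ideal_pred).
  by rewrite Quotient.idealrBE reprK.
rewrite -[_ * _](addrNK (x * generic_quotient.repr (\pi_rquot y))) -mulrBr -addrA -mulrBl.
apply: idealD.
  by rewrite -[_ * _]mulr1; apply: idealMM.
by rewrite -[X in X * _]mul1r; apply: idealMM.
Qed.

Fact rquot_mulA : associative rquot_mul.
Proof.
move=> x y z; rewrite -[x]reprK -[y]reprK -[z]reprK.
by rewrite -!pi_rquot_mul mulrA.
Qed.

Fact rquot_mul1l : left_id rquot_one rquot_mul.
Proof. by move=> x; rewrite -[x]reprK -pi_rquot_mul mul1r. Qed.

Fact rquot_mul1r : right_id rquot_one rquot_mul.
Proof. by move=> x; rewrite -[x]reprK -pi_rquot_mul mulr1. Qed.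

Fact rquot_mulDl : left_distributive rquot_mul +%R.
Proof.
move=> x y z; rewrite -[x]reprK -[y]reprK -[z]reprK.
by rewrite -pi_addr -!pi_rquot_mul mulrDl pi_addr.
Qed.

Fact rquot_mulDr : right_distributive rquot_mul +%R.
Proof.
move=> x y z; rewrite -[x]reprK -[y]reprK -[z]reprK.
by rewrite -pi_addr -!pi_rquot_mul mulrDr pi_addr.
Qed.

HB.instance Definition _ := GRing.Zmodule_isPzRing.Build rquot
  rquot_mulA rquot_mul1l rquot_mul1r rquot_mulDl rquot_mulDr.

Definition rproj : A -> rquot := \pi_rquot.

Fact rproj_is_zmod_morphism : zmod_morphism rproj.
Proof.
move=> x y; rewrite /rproj pi_addr; congr (_ + _).
exact: (@pi_oppr _ _ _ _ _ rquot).
Qed.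

Fact rproj_is_monoid_morphism : monoid_morphism rproj.
Proof. by split=> // x y; rewrite /rproj pi_rquot_mul. Qed.

HB.instance Definition _ :=
  GRing.isZmodMorphism.Build A rquot rproj rproj_is_zmod_morphism.
HB.instance Definition _ :=
  GRing.isMonoidMorphism.Build A rquot rproj rproj_is_monoid_morphism.

End RingQuotient.

Section FreeModule.
Variables (A : pzRingType) (X : choiceType).

(* The library's module structure on {malg A[X]} needs 1 != 0 in A, which *)
(* is not available for quotient rings.                                   *)
Definition freemod : Type := {malg A[X]}.

HB.instance Definition _ := GRing.Zmodule.on freemod.

Definition freemod_scale (a : A) (g : freemod) : freemod :=
  \sum_(k <- finmap.enum_fset (monalg.msupp g)) mkmalgU k (a * monalg.mcoeff k g).

Fact freemod_scaleE a g k :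
  monalg.mcoeff k (freemod_scale a g) = a * monalg.mcoeff k g.
Proof.
rewrite {2}[g]monalg.monalgE !raddf_sum mulr_sumr /=; apply: eq_bigr => i _.
by rewrite !monalg.mcoeffU mulrnAr.
Qed.

Fact freemod_scaleA a b g :
  freemod_scale a (freemod_scale b g) = freemod_scale (a * b) g.
Proof. by apply/malgP => k; rewrite !freemod_scaleE mulrA. Qed.

Fact freemod_scale1 : left_id 1 freemod_scale.
Proof. by move=> g; apply/malgP => k; rewrite freemod_scaleE mul1r. Qed.

Fact freemod_scaleDr : right_distributive freemod_scale +%R.
Proof.
move=> a g h; apply/malgP => k.
by rewrite !(freemod_scaleE, monalg.mcoeffD) mulrDr.
Qed.

Fact freemod_scaleDl g : {morph freemod_scale^~ g : a b / a + b}.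
Proof.
move=> a b; apply/malgP => k.
by rewrite !(freemod_scaleE, monalg.mcoeffD) mulrDl.
Qed.

HB.instance Definition _ := GRing.Zmodule_isLmodule.Build A freemod
  freemod_scaleA freemod_scale1 freemod_scaleDr freemod_scaleDl.

Definition freemod_gen (x : X) : freemod := mkmalgU x 1.

End FreeModule.

Section Induction.
Variables (B A : pzRingType) (phi : B -> A) (N : lmodType B).

Inductive tensor_rel : freemod A N -> Prop :=
| tensor_relD u v :
    tensor_rel (freemod_gen A (u + v) - (freemod_gen A u + freemod_gen A v))
| tensor_relZ b u :
    tensor_rel (freemod_gen A (b *: u) - phi b *: freemod_gen A u).

(* A \otimes_B N, where A is a right B-module through the ring map phi : the *)
(* class of freemod_gen u is the tensor 1 \otimes u.                         *)
Definition induced : Type := lquot tensor_rel.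

HB.instance Definition _ := GRing.Lmodule.on induced.

End Induction.

Section EndomorphismRing.
Variables (A : pzRingType) (M : lmodType A).

Record endo := Endo { endo_fun :> M -> M; endo_linear : linear endo_fun }.

Lemma endoP (f g : endo) : f =1 g -> f = g.
Proof.
case: f g => [f lf] [g lg] /= /funext eq_fg; case: _ / eq_fg lg => lg.
by rewrite (Prop_irrelevance lf lg).
Qed.

HB.instance Definition _ := gen_eqMixin endo.
HB.instance Definition _ := gen_choiceMixin endo.

Fact endo0_linear : linear (fun _ : M => 0 : M).
Proof. by move=> a u v; rewrite scaler0 addr0. Qed.
Definition endo0 := Endo endo0_linear.

Fact endo_opp_linear (f : endo) : linear (fun m => - f m).
Proof. by move=> a u v; rewrite endo_linear opprD scalerN. Qed.
Definition endo_opp f := Endo (endo_opp_linear f).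

Fact endo_add_linear (f g : endo) : linear (fun m => f m + g m).
Proof. by move=> a u v; rewrite !endo_linear scalerDr addrACA. Qed.
Definition endo_add f g := Endo (endo_add_linear f g).

Fact endo1_linear : linear (fun m : M => m).
Proof. by []. Qed.
Definition endo1 := Endo endo1_linear.

Fact endo_mul_linear (f g : endo) : linear (fun m => f (g m)).
Proof. by move=> a u v; rewrite !endo_linear. Qed.
Definition endo_mul f g := Endo (endo_mul_linear f g).

Fact endo_additive (f : endo) u v : f (u + v) = f u + f v.
Proof. by rewrite -[u]scale1r endo_linear !scale1r. Qed.

Fact endo_addA : associative endo_add.
Proof. by move=> f g h; apply: endoP => m /=; rewrite addrA. Qed.
Fact endo_addC : commutative endo_add.
Proof. by move=> f g; apply: endoP => m /=; rewrite addrC. Qed.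
Fact endo_add0 : left_id endo0 endo_add.
Proof. by move=> f; apply: endoP => m /=; rewrite add0r. Qed.
Fact endo_addN : left_inverse endo0 endo_opp endo_add.
Proof. by move=> f; apply: endoP => m /=; rewrite addNr. Qed.

HB.instance Definition _ :=
  GRing.isZmodule.Build endo endo_addA endo_addC endo_add0 endo_addN.

Fact endo_mulA : associative endo_mul.
Proof. by move=> f g h; apply: endoP. Qed.
Fact endo_mul1l : left_id endo1 endo_mul.
Proof. by move=> f; apply: endoP. Qed.
Fact endo_mul1r : right_id endo1 endo_mul.
Proof. by move=> f; apply: endoP. Qed.
Fact endo_mulDl : left_distributive endo_mul +%R.
Proof. by move=> f g h; apply: endoP. Qed.
Fact endo_mulDr : right_distributive endo_mul +%R.
Proof. by move=> f g h; apply: endoP => m /=; rewrite endo_additive. Qed.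

HB.instance Definition _ := GRing.Zmodule_isPzRing.Build endo
  endo_mulA endo_mul1l endo_mul1r endo_mulDl endo_mulDr.

(* A copy of M, carrying the left module structure given by evaluation. *)
Definition endo_module : Type := M.

HB.instance Definition _ := GRing.Zmodule.on endo_module.

Definition endo_scale (f : endo) (m : endo_module) : endo_module := f m.

Fact endo_scaleA f g m :
  endo_scale f (endo_scale g m) = endo_scale (f * g) m.
Proof. by []. Qed.
Fact endo_scale1 : left_id 1 endo_scale.
Proof. by []. Qed.
Fact endo_scaleDr : right_distributive endo_scale +%R.
Proof. by move=> f u v; rewrite /endo_scale -endo_additive. Qed.
Fact endo_scaleDl m : {morph endo_scale^~ m : f g / f + g}.
Proof. by []. Qed.

HB.instance Definition _ := GRing.Zmodule_isLmodule.Build endo endo_module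
  endo_scaleA endo_scale1 endo_scaleDr endo_scaleDl.

End EndomorphismRing.

Definition is_basis (E : pzRingType) (M : lmodType E) (k : nat)
    (b : 'I_k -> M) :=
  forall m : M, exists! a : {ffun 'I_k -> E}, m = \sum_(i < k) a i *: b i.

Definition free_of_rank (E : pzRingType) (M : lmodType E) (k : nat) :=
  exists b : 'I_k -> M, is_basis b.

Section Head.
Variables (A : pzRingType) (M : lmodType A).

Definition submodule (N : M -> Prop) :=
  N 0 /\ forall (a : A) u v, N u -> N v -> N (a *: u + v).

Definition maximal_submodule (N : M -> Prop) :=
  [/\ submodule N, exists m, ~ N m &
      forall N' : M -> Prop, submodule N' -> (forall m, N m -> N' m) ->
        (forall m, N' m -> N m) \/ (forall m, N' m)].

Definition radical (m : M) : Prop :=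
  forall N : M -> Prop, maximal_submodule N -> N m.

Definition module_head : Type := lquot radical.

HB.instance Definition _ := GRing.Lmodule.on module_head.

End Head.

Section Blocks.
Variable A : pzRingType.

Definition central_idempotent (e : A) := e * e = e /\ forall a, a * e = e * a.

Definition block_idempotent (e : A) :=
  [/\ central_idempotent e, e != 0 &
      forall f, central_idempotent f -> f * e = f -> f = 0 \/ f = e].

End Blocks.

Record ring_action (W : finGroupType) (A : pzRingType) := RingAction {
  ract :> W -> {rmorphism A -> A};
  ract1 : forall a, ract 1%g a = a;
  ractM : forall u v a, ract (u * v)%g a = ract u (ract v a)
}.

(* f stands for the sum of the f w * w, with w * a = act w a * w. *)
Definition smash (W : finGroupType) (A : pzRingType) (act : ring_action W A) :
  Type := {ffun W -> A}.

Section Smash.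
Variables (W : finGroupType) (A : pzRingType) (act : ring_action W A).
Local Notation smash := (smash act).

HB.instance Definition _ := GRing.Zmodule.on smash.

Definition smash_one : smash := [ffun w => (w == 1%g)%:R].
Definition smash_mul (f g : smash) : smash :=
  [ffun w => \sum_u f u * act u (g (u^-1 * w)%g)].

Fact smash_mulA : associative smash_mul.
Proof.
move=> f g h; apply/ffunP => w; rewrite !ffunE.
under eq_bigr => u _ do rewrite ffunE rmorph_sum mulr_sumr.
under [RHS]eq_bigr => u _ do rewrite ffunE mulr_suml.
rewrite [RHS]exchange_big /=; apply: eq_bigr => u _.
rewrite [RHS](reindex_inj (mulgI u)) /=; apply: eq_bigr => v _.
by rewrite rmorphM -ractM mulrA mulKg invMg mulgA.
Qed.

Fact smash_mul1l : left_id smash_one smash_mul.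
Proof.
move=> f; apply/ffunP => w; rewrite ffunE (bigD1 1%g) //= big1 ?addr0.
  by rewrite ffunE eqxx mul1r ract1 invg1 mul1g.
by move=> u /negPf nu; rewrite ffunE nu mul0r.
Qed.

Fact smash_mul1r : right_id smash_one smash_mul.
Proof.
move=> f; apply/ffunP => w; rewrite ffunE (bigD1 w) //= big1 ?addr0.
  by rewrite ffunE mulVg eqxx rmorph1 mulr1.
move=> u nu; rewrite ffunE -eq_mulVg1 (negPf nu).
by rewrite rmorph0 mulr0.
Qed.

Fact smash_mulDl : left_distributive smash_mul +%R.
Proof.
move=> f g h; apply/ffunP => w; rewrite !ffunE -big_split /=.
by apply: eq_bigr => u _; rewrite ffunE mulrDl.
Qed.

Fact smash_mulDr : right_distributive smash_mul +%R.
Proof.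
move=> f g h; apply/ffunP => w; rewrite !ffunE -big_split /=.
by apply: eq_bigr => u _; rewrite ffunE rmorphD mulrDr.
Qed.

HB.instance Definition _ := GRing.Zmodule_isPzRing.Build smash
  smash_mulA smash_mul1l smash_mul1r smash_mulDl smash_mulDr.

Definition smash_tens (a : A) (w : W) : smash := [ffun u => a *+ (u == w)].

End Smash.

Definition words (I : choiceType) : monomType := {fmonom I}.

(* The tensor algebra of the free K-module with basis I. *)
Notation freealg K I := {malg K[words I]}.

Section FreeAlgebra.
Variables (K : comNzRingType) (I : choiceType).

Definition letter (i : I) : freealg K I := mkmalgU (fmu i : words I) 1.

Variable u : I -> freealg K I.

Definition word_prod (m : words I) : (freealg K I) := \prod_(i <- (m : fmonom I)) u i.

Fact word_prod_mmorphism : mmorphism word_prod.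
Proof.
split=> [m1 m2|]; rewrite /word_prod ?fm1 ?big_nil //.
by rewrite fmM big_cat.
Qed.

HB.instance Definition _ :=
  monalg.isMultiplicative.Build (words I) (freealg K I) word_prod
    word_prod_mmorphism.

(* The algebra endomorphism sending each letter i to u i. *)
Definition letter_subst (g : (freealg K I)) : (freealg K I) :=
  monalg.mmap (@malgC (words I) K) word_prod g.

Fact malgC_comm (c : K) (g : (freealg K I)) : GRing.comm (malgC c : (freealg K I)) g.
Proof.
rewrite /GRing.comm [LHS]mul_malgC [RHS]malgM_def malgZ_def fgmulgU.
by apply: eq_bigr => k _; rewrite monalg.mulm1 mulrC.
Qed.

Fact letter_subst_zmod_morphism : zmod_morphism letter_subst.
Proof. by move=> g h; rewrite /letter_subst raddfB. Qed.

HB.instance Definition _ := GRing.isZmodMorphism.Build (freealg K I) (freealg K I)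
  letter_subst letter_subst_zmod_morphism.

Fact letter_subst_monoid_morphism : monoid_morphism letter_subst.
Proof.
have comm_malgC (g : (freealg K I)) (m m' : words I) :
    GRing.comm (malgC (monalg.mcoeff m g) : (freealg K I)) (word_prod m').
  exact: malgC_comm.
have [mM m1] := monalg.commr_mmap_is_multiplicative comm_malgC.
by split.
Qed.

HB.instance Definition _ := GRing.isMonoidMorphism.Build (freealg K I) (freealg K I)
  letter_subst letter_subst_monoid_morphism.

Lemma letter_substU c m :
  letter_subst (mkmalgU m c) = malgC c * word_prod m.
Proof. by rewrite /letter_subst monalg.mmapU. Qed.

Lemma letter_substC c : letter_subst (malgC c) = malgC c.
Proof. exact: monalg.mmapC. Qed.

Lemma letter_substZ c g : letter_subst (c *: g) = c *: letter_subst g.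
Proof. by rewrite /letter_subst monalg.mmapZ [LHS]mul_malgC. Qed.

Lemma letter_subst_letter i : letter_subst (letter i) = u i.
Proof. by rewrite letter_substU /word_prod fmU big_seq1 mul1r. Qed.

End FreeAlgebra.

Local Opaque letter_subst.

Lemma word_prod_letter (K : comNzRingType) (I : choiceType) (m : words I) :
  word_prod (@letter K I) m = mkmalgU m 1.
Proof.
have -> : m = FMonom (m : fmonom I) by rewrite fmK.
rewrite /word_prod; elim: (m : seq I) => [|i s IH] /=.
  by rewrite big_nil -fmoneE.
rewrite big_cons IH [LHS]malgM_def fgmulUU mulr1.
by rewrite [monalg.mul _ _]fmmulE fmuE.
Qed.

Lemma letter_subst_id (K : comNzRingType) (I : choiceType) (g : freealg K I) :
  letter_subst (@letter K I) g = g.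
Proof.
rewrite {1}[g]monalg.monalgE raddf_sum [RHS]monalg.monalgE.
apply: eq_bigr => m _; rewrite [LHS]letter_substU word_prod_letter.
by rewrite [LHS]malgM_def fgmulUU mulr1 [monalg.mul _ _]monalg.mul1m.
Qed.

Lemma letter_subst_comp (K : comNzRingType) (I : choiceType)
    (u v : I -> freealg K I) (g : freealg K I) :
  letter_subst u (letter_subst v g) =
  letter_subst (fun i => letter_subst u (v i)) g.
Proof.
set uv := fun i => _; rewrite [g]monalg.monalgE.
rewrite [letter_subst v _]rmorph_sum [LHS]rmorph_sum [RHS]rmorph_sum /=.
apply: eq_bigr => m _.
by rewrite !letter_substU rmorphM rmorph_prod /= letter_substC.
Qed.

Lemma eq_letter_subst (K : comNzRingType) (I : choiceType)
    (u v : I -> freealg K I) : u =1 v -> letter_subst u =1 letter_subst v.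
Proof. by move=> /funext ->. Qed.

Section Reflections.
Variables (R : realType) (W : finGroupType) (n : nat).
Variable rho : mx_representation R[i] [set: W] n.

(* W acts on h = 'cV_n by v |-> rho w *m v and on its dual h^* = 'rV_n by *)
(* x |-> x *m rho w^-1, the pairing being the product x *m v.             *)

Definition reflections : {set W} := [set s | \rank (rho s - 1%:M) == 1%N].

Definition complex_reflection_group : Prop :=
  mx_faithful rho /\ <<reflections>>%g = [set: W].

Definition pairing (x : 'rV[R[i]]_n) (v : 'cV[R[i]]_n) : R[i] := (x *m v) 0 0.

Definition reflection_roots (alpha : W -> 'cV[R[i]]_n)
    (alphav : W -> 'rV[R[i]]_n) : Prop :=
  forall s, s \in reflections ->
    [/\ ((alpha s)^T :=: (rho s - 1%:M)^T)%MS,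
        (alphav s :=: rho s^-1%g - 1%:M)%MS &
        pairing (alphav s) (alpha s) = 2].

Definition conjugation_invariant (c : W -> R[i]) : Prop :=
  forall w s, s \in reflections -> c (s ^ w)%g = c s.

End Reflections.

Section Actions.
Variables (R : realType) (W : finGroupType) (n : nat).
Variable rho : mx_representation R[i] [set: W] n.
Local Notation C := R[i].

(* T(h (+) h^* ): inl i is the i-th basis vector of h and inr i the i-th *)
(* vector of the dual basis of h^*.                                      *)
Local Notation tensor_alg := (freealg C ('I_n + 'I_n)%type).

Definition tensor_h (v : 'cV[C]_n) : tensor_alg :=
  \sum_i v i 0 *: letter C (inl i).
Definition tensor_hd (x : 'rV[C]_n) : tensor_alg :=
  \sum_i x 0 i *: letter C (inr i).

Definition letter_act (w : W) (l : 'I_n + 'I_n) : tensor_alg :=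
  match l with
  | inl i => tensor_h (rho w *m delta_mx i 0)
  | inr i => tensor_hd (delta_mx 0 i *m rho w^-1%g)
  end.

Lemma letter_act_h w v :
  letter_subst (letter_act w) (tensor_h v) = tensor_h (rho w *m v).
Proof.
rewrite raddf_sum /=.
under eq_bigr => i _ do rewrite letter_substZ letter_subst_letter scaler_sumr.
rewrite exchange_big; apply: eq_bigr => j _ /=.
rewrite mxE scaler_suml; apply: eq_bigr => i _.
by rewrite -colE mxE scalerA mulrC.
Qed.

Lemma letter_act_hd w x :
  letter_subst (letter_act w) (tensor_hd x) = tensor_hd (x *m rho w^-1%g).
Proof.
rewrite raddf_sum /=.
under eq_bigr => i _ do rewrite letter_substZ letter_subst_letter scaler_sumr.
rewrite exchange_big; apply: eq_bigr => j _ /=.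
rewrite mxE scaler_suml; apply: eq_bigr => i _.
by rewrite -rowE mxE scalerA.
Qed.

Fact tensor_act1 a : letter_subst (letter_act 1%g) a = a.
Proof.
rewrite -[RHS]letter_subst_id; apply: eq_letter_subst => -[] i /=.
  rewrite repr_mx1 mul1mx /tensor_h (bigD1 i) //= big1 ?addr0.
    by rewrite mxE !eqxx scale1r.
  by move=> j /negPf nj; rewrite mxE nj scale0r.
rewrite invg1 repr_mx1 mulmx1 /tensor_hd (bigD1 i) //= big1 ?addr0.
  by rewrite mxE !eqxx scale1r.
by move=> j /negPf nj; rewrite mxE nj scale0r.
Qed.

Fact tensor_actM u v a :
  letter_subst (letter_act (u * v)%g) a =
  letter_subst (letter_act u) (letter_subst (letter_act v) a).
Proof.
rewrite [RHS]letter_subst_comp; apply: eq_letter_subst => -[] i /=.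
  rewrite [RHS]letter_act_h; congr (tensor_h _).
  by rewrite repr_mxM ?in_setT // mulmxA.
rewrite [RHS]letter_act_hd; congr (tensor_hd _).
by rewrite invMg repr_mxM ?in_setT // mulmxA.
Qed.

Definition tensor_action : ring_action W tensor_alg :=
  RingAction (ract := fun w => letter_subst (letter_act w))
    tensor_act1 tensor_actM.

Local Notation polyalg := (mpoly.mpoly n C).

(* C[h^*] = Sym(h): 'X_i is the i-th basis vector of h. *)
Definition sym_h (v : 'cV[C]_n) : polyalg := \sum_i v i 0 *: 'X_i.
Definition sym_h_act (w : W) (p : polyalg) : polyalg :=
  p \mPo [tuple sym_h (rho w *m delta_mx i 0) | i < n].

(* C[h] = Sym(h^* ): 'X_i is the i-th vector of the dual basis of h^*. *)
Definition sym_hd (x : 'rV[C]_n) : polyalg := \sum_i x 0 i *: 'X_i.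
Definition sym_hd_act (w : W) (p : polyalg) : polyalg :=
  p \mPo [tuple sym_hd (delta_mx 0 i *m rho w^-1%g) | i < n].

HB.instance Definition _ w := GRing.RMorphism.copy (sym_h_act w)
  (comp_mpoly [tuple sym_h (rho w *m delta_mx i 0) | i < n]).

Lemma sym_h_actX w i :
  sym_h_act w 'X_i = sym_h (rho w *m delta_mx i 0).
Proof. by rewrite /sym_h_act comp_mpolyXU -tnth_nth tnth_mktuple. Qed.

Lemma sym_h_act_h w v : sym_h_act w (sym_h v) = sym_h (rho w *m v).
Proof.
rewrite /sym_h /sym_h_act raddf_sum /=.
under eq_bigr => i _ do
  rewrite comp_mpolyZ comp_mpolyXU -tnth_nth tnth_mktuple scaler_sumr.
rewrite exchange_big; apply: eq_bigr => j _ /=.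
rewrite mxE scaler_suml; apply: eq_bigr => i _.
by rewrite -colE mxE scalerA mulrC.
Qed.

Lemma polyalg_rmorphP (S : comNzRingType) (f g : {rmorphism polyalg -> S}) :
  (forall c, f c%:MP = g c%:MP) -> (forall i, f 'X_i = g 'X_i) -> f =1 g.
Proof.
move=> eqC eqX p; rewrite [p]mpolyE !rmorph_sum; apply: eq_bigr => m _.
rewrite -mul_mpolyC !rmorphM /= eqC mpolyXE_id !rmorph_prod /=.
by congr (_ * _); apply: eq_bigr => i _; rewrite !rmorphXn /= eqX.
Qed.

Fact sym_h_act1 p : sym_h_act 1%g p = p.
Proof.
apply: (polyalg_rmorphP (f := sym_h_act 1%g) (g := idfun)) => [c|i] /=.
  exact: comp_mpolyC.
rewrite sym_h_actX repr_mx1 mul1mx /sym_h (bigD1 i) //= big1 ?addr0.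
  by rewrite mxE !eqxx scale1r.
by move=> j /negPf nj; rewrite mxE nj scale0r.
Qed.

Fact sym_h_actM u v p :
  sym_h_act (u * v)%g p = sym_h_act u (sym_h_act v p).
Proof.
apply: (polyalg_rmorphP (f := sym_h_act (u * v)%g)
  (g := sym_h_act u \o sym_h_act v)) => [c|i] /=.
  by rewrite /sym_h_act !comp_mpolyC.
by rewrite !sym_h_actX sym_h_act_h mulmxA -repr_mxM ?in_setT.
Qed.

Definition sym_h_action : ring_action W polyalg :=
  RingAction (ract := sym_h_act) sym_h_act1 sym_h_actM.

Lemma sym_h_act_coef0 w p : (sym_h_act w p)@_0%MM = p@_0%MM.
Proof.
apply: (polyalg_rmorphP (f := mpoly.mcoeff 0%MM \o sym_h_act w)
  (g := mpoly.mcoeff 0%MM)) => [c|i] /=.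
  by rewrite /sym_h_act comp_mpolyC.
rewrite sym_h_actX [RHS]mcoeffX mnm1_eq0 /sym_h raddf_sum big1 // => j _.
by rewrite [LHS]mcoeffZ mcoeffX mnm1_eq0 mulr0.
Qed.

End Actions.

(* The column space of tau as a module over C[h^*] >< W on which h acts by 0. *)
Definition inflation (R : realType) (W : finGroupType) (n d : nat)
    (rho : mx_representation R[i] [set: W] n)
    (tau : mx_representation R[i] [set: W] d) : Type := 'cV[R[i]]_d.

Section LowestWeight.
Variables (R : realType) (W : finGroupType) (n : nat).
Variable rho : mx_representation R[i] [set: W] n.
Variables (d : nat) (tau : mx_representation R[i] [set: W] d).
Local Notation C := R[i].

(* C[h^*] >< W *)
Definition sym_smash : Type := smash (sym_h_action rho).

HB.instance Definition _ := GRing.PzRing.on sym_smash.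

Local Notation inflation := (inflation rho tau).

HB.instance Definition _ := GRing.Zmodule.on inflation.

Definition inflation_scale (b : sym_smash) (v : inflation) : inflation :=
  \sum_w (b w)@_0%MM *: (tau w *m v).

Fact inflation_scaleA a b v :
  inflation_scale a (inflation_scale b v) = inflation_scale (a * b) v.
Proof.
rewrite /inflation_scale.
transitivity (\sum_w \sum_u ((a u)@_0%MM * (b (u^-1 * w)%g)@_0%MM)
   *: (tau w *m v : 'cV[C]_d)); last first.
  apply: eq_bigr => w _; rewrite -scaler_suml ffunE; congr (_ *: _).
  rewrite [RHS](raddf_sum (mpoly.mcoeff 0%MM)); apply: eq_bigr => u _ /=.
  by rewrite rmorphM /= sym_h_act_coef0.
rewrite exchange_big; apply: eq_bigr => u _ /=.
rewrite mulmx_sumr scaler_sumr [RHS](reindex_inj (mulgI u)) /=.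
apply: eq_bigr => w _; rewrite -scalemxAr scalerA mulKg mulmxA.
by rewrite repr_mxM ?in_setT.
Qed.

Fact inflation_scale1 : left_id 1 inflation_scale.
Proof.
move=> v; rewrite /inflation_scale (bigD1 1%g) //= big1 ?addr0.
  by rewrite ffunE eqxx rmorph1 scale1r repr_mx1 mul1mx.
by move=> w /negPf nw; rewrite ffunE nw rmorph0 scale0r.
Qed.

Fact inflation_scaleDr : right_distributive inflation_scale +%R.
Proof.
move=> b u v; rewrite /inflation_scale -big_split /=; apply: eq_bigr => w _.
by rewrite mulmxDr scalerDr.
Qed.

Fact inflation_scaleDl v : {morph inflation_scale^~ v : a b / a + b}.
Proof.
move=> a b; rewrite /inflation_scale -big_split /=; apply: eq_bigr => w _.
by rewrite ffunE raddfD scalerDl.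
Qed.

HB.instance Definition _ := GRing.Zmodule_isLmodule.Build sym_smash inflation
  inflation_scaleA inflation_scale1 inflation_scaleDr inflation_scaleDl.

End LowestWeight.

Section Cherednik.
Variables (R : realType) (W : finGroupType) (n : nat).
Variable rho : mx_representation R[i] [set: W] n.
Variables (alpha : W -> 'cV[R[i]]_n) (alphav : W -> 'rV[R[i]]_n).
Variable c : W -> R[i].
Local Notation C := R[i].
Local Notation polyalg := (mpoly.mpoly n C).
Local Notation tensor_smash := (smash (tensor_action rho)).
Local Notation vec y := (smash_tens (tensor_action rho) (tensor_h y) 1%g).
Local Notation covec x := (smash_tens (tensor_action rho) (tensor_hd x) 1%g).

Inductive cherednik_rel : tensor_smash -> Prop :=
| cherednik_xx x x' : cherednik_rel (covec x * covec x' - covec x' * covec x)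
| cherednik_yy y y' : cherednik_rel (vec y * vec y' - vec y' * vec y)
| cherednik_yx y x :
    cherednik_rel (vec y * covec x - covec x * vec y
      - \sum_(s in reflections rho)
          smash_tens (tensor_action rho)
            (c s * (pairing x (alpha s) * pairing (alphav s) y
                    / pairing (alphav s) (alpha s)))%:A s).

Definition cherednik : Type := rquot cherednik_rel.

HB.instance Definition _ := GRing.PzRing.on cherednik.

Definition cherednik_proj : tensor_smash -> cherednik :=
  @rproj _ cherednik_rel.

Definition cherednik_const (a : C) : cherednik :=
  cherednik_proj (smash_tens (tensor_action rho) a%:A 1%g).
Definition cherednik_h (y : 'cV[C]_n) : cherednik := cherednik_proj (vec y).
Definition cherednik_hd (x : 'rV[C]_n) : cherednik := cherednik_proj (covec x).
Definition cherednik_W (w : W) : cherednik :=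
  cherednik_proj (smash_tens (tensor_action rho) 1 w).

(* The maps C[h^*] -> H, C[h] -> H and C[h^*] >< W -> H. *)
Definition cherednik_sym_h (p : polyalg) : cherednik :=
  \sum_(m <- msupp p)
    (cherednik_const p@_m * \prod_(i < n) cherednik_h (delta_mx i 0) ^+ m i).
Definition cherednik_sym_hd (p : polyalg) : cherednik :=
  \sum_(m <- msupp p)
    (cherednik_const p@_m * \prod_(i < n) cherednik_hd (delta_mx 0 i) ^+ m i).
Definition cherednik_sym_smash (b : sym_smash rho) : cherednik :=
  \sum_w cherednik_sym_h (b w) * cherednik_W w.

(* C[h^*]^W_+ and C[h]^W_+ *)
Definition invariant_sym_h (p : polyalg) : Prop :=
  (forall w, sym_h_act rho w p = p) /\ p@_0%MM = 0.
Definition invariant_sym_hd (p : polyalg) : Prop :=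
  (forall w, sym_hd_act rho w p = p) /\ p@_0%MM = 0.

Inductive restricted_rel : cherednik -> Prop :=
| restricted_hd p : invariant_sym_hd p -> restricted_rel (cherednik_sym_hd p)
| restricted_h p : invariant_sym_h p -> restricted_rel (cherednik_sym_h p).

Definition restricted : Type := rquot restricted_rel.

HB.instance Definition _ := GRing.PzRing.on restricted.

Definition restricted_proj : cherednik -> restricted := @rproj _ restricted_rel.

Definition Irr : irrType C [set: W] := DecSocleType (regular_repr C [set: W]).

Section Verma.
Variable lambda : Irr.

Definition verma : Type :=
  induced cherednik_sym_smash (inflation rho (irr_repr lambda)).

HB.instance Definition _ := GRing.Lmodule.on verma.

Inductive baby_rel : verma -> Prop :=
| baby_relM p v : invariant_sym_hd p -> baby_rel (cherednik_sym_hd p *: v).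

(* Delta(lambda) / C[h]^W_+ Delta(lambda) *)
Definition baby_verma : Type := lquot baby_rel.

HB.instance Definition _ := GRing.Lmodule.on baby_verma.

Definition simple_head : Type := module_head baby_verma.

HB.instance Definition _ := GRing.Lmodule.on simple_head.

(* The ideal defining restricted kills L(lambda), so that e acts on L(lambda) *)
(* through any of its lifts; L(lambda) belongs to the block of e when this    *)
(* action is the identity.                                                    *)
Definition in_block (e : restricted) : Prop :=
  forall (a : cherednik) (m : simple_head), restricted_proj a = e -> a *: m = m.

End Verma.

Definition same_block (lambda mu : Irr) : Prop :=
  exists e : restricted,
    [/\ block_idempotent e, in_block lambda e & in_block mu e].

Definition CM_partition : {set {set Irr}} :=
  equivalence_partition (fun lambda mu => `[< same_block lambda mu >])
    [set: Irr].

End Cherednik.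

(* Main.v *)
From HB Require Import structures.
Require Import Defs.
From mathcomp Require Import all_boot all_order all_algebra all_fingroup.
From mathcomp Require Import all_character.
From mathcomp Require Import boolp reals complex.
From mathcomp Require Import monalg mpoly.
From mathcomp Require Import ring finmap.
From mathcomp Require classical_sets.

(** The Verma module Delta(lambda) is realised on M = C[h] (x) lambda, where h
    acts by Dunkl operators; its endomorphisms are the C[h]-linear maps that
    commute with W and with the Dunkl operators. Let I = C[h]^W_+ M, and let J
    be the radical of M, that is, the set of vectors all of whose iterated
    Dunkl derivatives vanish at the origin; L(lambda) = M / J. Let e be the
    averaging idempotent of C[W].

    The block hypothesis enters through one statement, [star]: if a submodule
    N contains I and misses u, then N can be enlarged, still missing u, until
    the submodule that u generates modulo N is isomorphic to L(lambda).
    Indeed, take N maximal among the submodules that miss u. As Dunkl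
    operators lower degrees, h kills some nonzero vectors of the submodule
    generated by u modulo N. These contain an irreducible representation mu of
    W, which gives a nonzero map from Delta(mu) to M / N ([block_embedding]).
    The block idempotent of lambda acts on M / I as the identity
    ([block_lift]), so mu lies in the block and mu = lambda; maximality of N
    then identifies the image of that map with L(lambda) and with the
    submodule generated by u ([cyclic_subquotient_of]). Consequently e kills a
    nonzero submodule of a quotient of M / I only if it kills L(lambda). And e
    does not kill L(lambda): otherwise, by [star] again, it would map M into
    I, but an invariant vector of least order does not lie in I
    ([inv_not_span]).

    So there is a homogeneous W-invariant vector v outside J; it generates M.
    For each invariant u there is an endomorphism that maps v to u
    ([endo_exists]). To see this, multiply the Dunkl operators by an invariant
    common denominator delta: they become Z_y minus a combination of group
    elements, with Z_y a C[h]-linear map. Interpolation on a free orbit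
    separates the elements of W and shows that the Z_y commute
    ([linear_part_comm]). Every u in M therefore satisfies delta^k u = A v
    with A in the commutative bicommutant of the Z_y ([symbol_reach]), and the
    average of A over W, divided by delta^k, is the endomorphism sought. It
    follows that the ring E of endomorphisms is commutative ([endo_comm]).

    By Schur's lemma an endomorphism is a scalar up to an endomorphism with
    image in J, and [star] shows that J is spanned by the images of the latter
    ([rad_in_span]). Take monomial vectors that form a basis of M modulo J.
    They span M over E, by induction on the degree ([endo_span]). They are
    independent: in a relation with coefficients phi_i, apply e h for h in the
    algebra, rewrite e h b_i as beta_i v and compare the components of least
    degree of the vectors phi_i v; this gives constants a_i, not all zero,
    such that e h kills the sum of the a_i b_i modulo J for every h, and that
    sum lies in J since e does not kill L(lambda) ([endo_independent]).

    For the rank, let f be a linear form with trivial stabiliser. The vectors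
    f^i v with i < |W| are independent over E, and a nonzero polynomial
    multiple of each basis vector is an E-combination of them. Over a
    commutative ring a homogeneous linear system with more unknowns than
    equations has a nonzero solution ([mccoy]), which gives both inequalities
    between the rank and |W|. *)

Set Implicit Arguments.
Unset Strict Implicit.
Unset Printing Implicit Defensive.

Import GRing.Theory Num.Theory.
Local Open Scope ring_scope.

(** * Homogeneous components, divided differences and the action of W on polynomials *)

(** The divided difference (p - sigma p) / ell, and 0 when the quotient does not
    exist.  This definition and many of those below are sealed, so that no
    unification ever computes with polynomials. *)
HB.lock Definition ddiff (K : fieldType) (n : nat)
    (sigma : mpoly.mpoly n K -> mpoly.mpoly n K) (ell p : mpoly.mpoly n K) :
    mpoly.mpoly n K :=
  if pselect (exists q, ell * q = p - sigma p) is left h then projT1 (cid h)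
  else 0.

HB.lock Definition hcomp (n : nat) (K : fieldType) (k : nat)
    (p : mpoly.mpoly n K) := pihomog mdeg k p.

HB.lock Definition pact (R : realType) (W : finGroupType) (n : nat)
    (rho : mx_representation R[i] [set: W] n) (w : W)
    (p : mpoly.mpoly n R[i]) :=
  sym_hd_act rho w p.

Section Polynomials.
Variables (K : fieldType) (n : nat).
Local Notation P := (mpoly.mpoly n K).

(** Induction on a polynomial along sums and multiplications by one variable:
    this form suits maps known only on constants and through a Leibniz rule. *)
Lemma mpoly_ring_ind (Q : P -> Prop) :
  (forall c, Q c%:MP) -> (forall p q, Q p -> Q q -> Q (p + q)) ->
  (forall i p, Q p -> Q ('X_i * p)) -> forall p, Q p.
Proof.
move=> QC QD QX p; rewrite [p]mpolyE; elim/big_ind: _ => //; first exact: (QC 0).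
move=> m _; rewrite -mul_mpolyC mpolyXE_id.
elim/big_rec: _ => [|i q _]; first by rewrite mulr1; apply: QC.
rewrite mulrCA; elim: (m i) => [|k IH Qq]; first by rewrite expr0 mul1r.
by rewrite exprS -mulrA; apply/QX/IH.
Qed.

Fact hcomp_is_linear k : linear (@hcomp n K k).
Proof. by move=> a p q; rewrite hcomp.unlock linearP. Qed.
HB.instance Definition _ k :=
  GRing.isLinear.Build K P P _ (@hcomp n K k) (@hcomp_is_linear k).

Lemma homogX i : ('X_i : P) \is 1.-homog for mdeg.
Proof. by rewrite dhomogX; apply/eqP/mdeg1. Qed.

Lemma homogC (c : K) : (c%:MP : P) \is 0.-homog for mdeg.
Proof. by rewrite -[c%:MP]mulr1 mul_mpolyC rpredZ ?dhomog1. Qed.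

(** Multiplication by a linear form shifts the grading, so it matches the
    components of p with those of the product one by one. *)
Lemma hcomp_linM (l p : P) k :
  l \is 1.-homog for mdeg -> hcomp k.+1 (l * p) = l * hcomp k p.
Proof.
rewrite hcomp.unlock => hl.
have [N leN] : exists N, (mmeasure mdeg p <= N)%N by exists (mmeasure mdeg p).
rewrite {1}(pihomog_partitionE leN) mulr_sumr raddf_sum /=.
have homM d : l * pihomog mdeg d p \is d.+1.-homog for mdeg.
  by rewrite -add1n; apply: dhomogM => //; apply: pihomogP.
case: (ltnP k N) => [ltk|leNk].
  rewrite (bigD1 (Ordinal ltk)) //= pihomog_dE // big1 ?addr0 // => d nd.
  by rewrite (pihomog_ne0 (d := d.+1)) // eqSS.
rewrite big1 => [|d _]; last first.
  by rewrite (pihomog_ne0 (d := d.+1)) // eqSS neq_ltn (leq_trans (ltn_ord d)).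
suff -> : pihomog mdeg k p = 0 by rewrite mulr0.
rewrite pihomogE big1_seq // => m /andP[/eqP dm].
by move/mmeasure_mnm_lt/leq_trans/(_ leN); rewrite dm ltnNge leNk.
Qed.

Lemma hcompC k (c : K) : hcomp k (c%:MP : P) = if k == 0%N then c%:MP else 0.
Proof.
rewrite hcomp.unlock; case: eqP => [->|/eqP nk]; first by rewrite pihomog_dE ?homogC.
by rewrite (pihomog_ne0 (d := 0%N)) ?homogC // eq_sym.
Qed.

Lemma hcomp0_linM (l p : P) : l \is 1.-homog for mdeg -> hcomp 0 (l * p) = 0.
Proof.
rewrite hcomp.unlock => hl.
have [N leN] : exists N, (mmeasure mdeg p <= N)%N by exists (mmeasure mdeg p).
rewrite (pihomog_partitionE leN) mulr_sumr raddf_sum /= big1 // => d _.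
by rewrite (pihomog_ne0 (d := d.+1)) // -add1n dhomogM ?pihomogP.
Qed.

Lemma hcompX k i (p : P) :
  hcomp k ('X_i * p) = if k is k'.+1 then 'X_i * hcomp k' p else 0.
Proof. by case: k => [|k]; rewrite ?hcomp0_linM ?hcomp_linM ?homogX. Qed.

Lemma hcomp0E (p : P) : hcomp 0 p = (p@_0%MM)%:MP.
Proof.
elim/mpoly_ring_ind: p => [c|p q IHp IHq|i p IH].
- by rewrite hcompC mpolyCK.
- by rewrite linearD /= IHp IHq mcoeffD mpolyCD.
- by rewrite hcompX rmorphM /= mcoeffX mnm1_eq0 mul0r.
Qed.

Lemma hcomp_sum (p : P) : exists N, forall M, (N <= M)%N ->
  p = \sum_(k < M) hcomp k p /\ forall k, (N <= k)%N -> hcomp k p = 0.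
Proof.
exists (mmeasure mdeg p) => M leM; split.
  rewrite {1}(pihomog_partitionE leM); apply: eq_bigr => k _.
  by rewrite hcomp.unlock.
move=> k lek; rewrite hcomp.unlock pihomogE big1_seq // => m /andP[/eqP dm].
by move/mmeasure_mnm_lt/leq_trans/(_ lek); rewrite dm ltnn.
Qed.

Lemma hcomp_hcomp k l (p : P) : hcomp k (hcomp l p) = if k == l then hcomp l p else 0.
Proof.
rewrite hcomp.unlock; case: eqP => [->|/eqP nk].
  by rewrite pihomog_dE ?pihomogP.
by rewrite (pihomog_ne0 (d := l)) ?pihomogP // eq_sym.
Qed.

Section DividedDifference.
Variables (sigma : {rmorphism P -> P}) (ell : P) (a : 'I_n -> K).
Hypothesis sigmaC : forall c, sigma c%:MP = c%:MP.
Hypothesis sigmaX : forall i, 'X_i - sigma 'X_i = ell * (a i)%:MP.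
Local Notation dd := (ddiff sigma ell).

(** The quotient exists because the twisted Leibniz rule builds it for a product
    from those of the factors, and it exists for the variables. *)
Lemma ddiffE p : ell * dd p = p - sigma p.
Proof.
rewrite ddiff.unlock; case: pselect => [h|[]]; first by case: cid.
elim/mpoly_ring_ind: p => [c|p q [u eu] [v ev]|i p [u eu]].
- by exists 0; rewrite sigmaC subrr mulr0.
- by exists (u + v); rewrite rmorphD mulrDr eu ev opprD addrACA.
- exists ('X_i * u + (a i)%:MP * sigma p).
  rewrite rmorphM mulrDr mulrCA eu mulrA -sigmaX mulrBl mulrBr.
  by rewrite addrA subrK.
Qed.

Hypothesis ell_neq0 : ell != 0.

Lemma ddiff_eq p q : ell * q = p - sigma p -> dd p = q.
Proof. by rewrite -ddiffE => /(mulfI ell_neq0). Qed.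

Lemma ddiffD p q : dd (p + q) = dd p + dd q.
Proof. by apply: ddiff_eq; rewrite mulrDr !ddiffE rmorphD opprD addrACA. Qed.

Lemma ddiffC c : dd c%:MP = 0.
Proof. by apply: ddiff_eq; rewrite sigmaC subrr mulr0. Qed.

Lemma ddiffM p q : dd (p * q) = p * dd q + dd p * sigma q.
Proof.
apply: ddiff_eq; rewrite mulrDr mulrCA ddiffE mulrA ddiffE rmorphM.
by rewrite mulrBr mulrBl addrA subrK.
Qed.

Lemma ddiff_fixed p : sigma p = p -> dd p = 0.
Proof. by move=> sp; apply: ddiff_eq; rewrite sp subrr mulr0. Qed.

Hypothesis sigma_hcomp : forall k p, hcomp k (sigma p) = sigma (hcomp k p).
Hypothesis ell_homog : ell \is 1.-homog for mdeg.

(** Cancelling ell of degree 1 shows that a divided difference lowers degrees by 1. *)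
Lemma hcomp_ddiff k p : hcomp k (dd p) = dd (hcomp k.+1 p).
Proof.
apply/esym/ddiff_eq.
by rewrite -hcomp_linM // ddiffE linearB /= sigma_hcomp.
Qed.

End DividedDifference.

End Polynomials.

Section PolynomialAction.
Variables (R : realType) (W : finGroupType) (n : nat).
Variable rho : mx_representation R[i] [set: W] n.
Local Notation C := R[i].
Local Notation P := (mpoly.mpoly n C).

Fact pact_is_zmod_morphism w : zmod_morphism (pact rho w).
Proof. by move=> p q; rewrite pact.unlock [LHS]raddfB. Qed.
Fact pact_is_monoid_morphism w : monoid_morphism (pact rho w).
Proof.
rewrite pact.unlock; split; first exact: (rmorph1 (comp_mpoly _)).
by move=> p q; apply: (rmorphM (comp_mpoly _)).
Qed.
HB.instance Definition _ w :=
  GRing.isZmodMorphism.Build P P (pact rho w) (@pact_is_zmod_morphism w).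
HB.instance Definition _ w :=
  GRing.isMonoidMorphism.Build P P (pact rho w) (@pact_is_monoid_morphism w).

Fact sym_hd_is_linear : linear (@sym_hd R n).
Proof.
move=> k x y; rewrite /sym_hd scaler_sumr -big_split; apply: eq_bigr => i _ /=.
by rewrite !mxE scalerDl scalerA.
Qed.
HB.instance Definition _ :=
  GRing.isLinear.Build C 'rV[C]_n P _ (@sym_hd R n) sym_hd_is_linear.

Lemma sym_hd_delta i : sym_hd (delta_mx 0 i) = 'X_i :> P.
Proof.
rewrite /sym_hd (bigD1 i) //= mxE !eqxx scale1r big1 ?addr0 // => j nj.
by rewrite mxE (negPf nj) scale0r.
Qed.

Lemma pactC w c : pact rho w c%:MP = c%:MP.
Proof. by rewrite pact.unlock; apply: comp_mpolyC. Qed.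

Lemma pactX w i : pact rho w 'X_i = sym_hd (delta_mx 0 i *m rho w^-1%g).
Proof. by rewrite pact.unlock /sym_hd_act comp_mpolyXU -tnth_nth tnth_mktuple. Qed.

Lemma pact_hd w x : pact rho w (sym_hd x) = sym_hd (x *m rho w^-1%g).
Proof.
rewrite [in LHS]/sym_hd raddf_sum /=.
transitivity (\sum_i x 0 i *: pact rho w 'X_i).
  by apply: eq_bigr => i _; rewrite -mul_mpolyC rmorphM /= pactC mul_mpolyC.
rewrite {2}[x]row_sum_delta mulmx_suml linear_sum; apply: eq_bigr => i _.
by rewrite pactX -scalemxAl linearZ.
Qed.

Lemma pact1 p : pact rho 1%g p = p.
Proof.
elim/mpoly_ring_ind: p => [c|p q IHp IHq|i p IH].
- exact: pactC.
- by rewrite rmorphD /= IHp IHq.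
- by rewrite rmorphM /= IH pactX invg1 repr_mx1 mulmx1 sym_hd_delta.
Qed.

Lemma pactM u v p : pact rho (u * v)%g p = pact rho u (pact rho v p).
Proof.
elim/mpoly_ring_ind: p => [c|p q IHp IHq|i p IH].
- by rewrite !pactC.
- by rewrite !rmorphD /= IHp IHq.
- by rewrite !rmorphM /= IH !pactX pact_hd invMg repr_mxM ?in_setT // mulmxA.
Qed.

Lemma pactK w : cancel (pact rho w) (pact rho w^-1%g).
Proof. by move=> p; rewrite -pactM mulVg pact1. Qed.

Lemma pactKV w : cancel (pact rho w^-1%g) (pact rho w).
Proof. by move=> p; rewrite -pactM mulgV pact1. Qed.

Lemma pact_eq0 w p : (pact rho w p == 0) = (p == 0).
Proof. by rewrite -[in LHS](raddf0 (pact rho w)) (can_eq (pactK w)). Qed.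

Lemma sym_hd_homog x : (sym_hd x : P) \is 1.-homog for mdeg.
Proof. by rewrite rpred_sum // => i _; apply/rpredZ/homogX. Qed.

Lemma sym_hd_eq0 x : ((sym_hd x : P) == 0) = (x == 0).
Proof.
apply/eqP/eqP => [x0|->]; last by rewrite raddf0.
apply/rowP => i; rewrite mxE.
have <- : (sym_hd x)@_U_(i) = x 0 i.
  rewrite raddf_sum /= (bigD1 i) //= mcoeffZ mcoeffX eqxx mulr1 big1 ?addr0 // => j nj.
  rewrite mcoeffZ mcoeffX; case: eqP => [/mnmP/(_ j)|]; last by rewrite mulr0.
  by rewrite !mnm1E eqxx eq_sym (negPf nj).
by rewrite x0 mcoeff0.
Qed.

Lemma hcomp_pact w k p : hcomp k (pact rho w p) = pact rho w (hcomp k p).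
Proof.
elim/mpoly_ring_ind: p k => [c k|p q IHp IHq k|i p IH k].
- by rewrite pactC hcompC; case: ifP; rewrite ?pactC ?raddf0.
- by rewrite !raddfD /= (IHp k) (IHq k).
- rewrite rmorphM /= hcompX pactX; case: k => [|k].
    by rewrite hcomp0_linM ?sym_hd_homog // raddf0.
  by rewrite hcomp_linM ?sym_hd_homog // rmorphM /= pactX (IH k).
Qed.

Lemma pact_coef0 w p : (pact rho w p)@_0%MM = p@_0%MM.
Proof. by apply: (can_inj (@mpolyCK n C)); rewrite -!hcomp0E hcomp_pact hcomp0E pactC. Qed.

End PolynomialAction.

(** * Reflections *)

(** The vector a_s for which 1 - s^-1 is the rank one matrix a_s alphav_s, whatever
    the normalisation of the root. *)
HB.lock Definition coroot (R : realType) (W : finGroupType) (n : nat)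
    (rho : mx_representation R[i] [set: W] n) (alphav : W -> 'rV[R[i]]_n) (s : W) :
    'cV[R[i]]_n :=
  (1%:M - rho s^-1%g) *m pinvmx (alphav s).

(** With this normalisation the coefficient of s in the commutation relation is
    kappa s times <x - s x, y>. *)
HB.lock Definition kappa (R : realType) (W : finGroupType) (n : nat)
    (rho : mx_representation R[i] [set: W] n) (c : W -> R[i]) (s : W) : R[i] :=
  c s / \tr (1%:M - rho s^-1%g).

Section Reflections.
Variables (R : realType) (W : finGroupType) (n : nat).
Variable rho : mx_representation R[i] [set: W] n.
Variables (alpha : W -> 'cV[R[i]]_n) (alphav : W -> 'rV[R[i]]_n).
Hypothesis roots : reflection_roots rho alpha alphav.
Variable c : W -> R[i].
Hypothesis c_inv : conjugation_invariant rho c.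
Local Notation C := R[i].
Local Notation S := (reflections rho).

Lemma rhoM u v : rho (u * v)%g = rho u *m rho v.
Proof. by rewrite repr_mxM ?in_setT. Qed.

Lemma rhoV w : rho w *m rho w^-1%g = 1%:M.
Proof. by rewrite -rhoM mulgV repr_mx1. Qed.

Lemma rhoVK w : rho w^-1%g *m rho w = 1%:M.
Proof. by rewrite -rhoM mulVg repr_mx1. Qed.

Lemma corootE s : s \in S -> 1%:M - rho s^-1%g = coroot rho alphav s *m alphav s.
Proof.
move=> /roots[_ eq_v _]; rewrite coroot.unlock mulmxKpV //.
by rewrite eq_v -opprB eqmx_opp.
Qed.

Lemma alphav_neq0 s : s \in S -> alphav s != 0.
Proof.
move=> /roots[_ _ av2]; apply: contra_eq_neq av2 => ->.
by rewrite /pairing mul0mx mxE eq_sym pnatr_eq0.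
Qed.

Lemma reflections1 : 1%g \notin S.
Proof. by rewrite inE repr_mx1 subrr mxrank0. Qed.

Lemma conj_sub1 w s :
  rho (w * s * w^-1)%g - 1%:M = rho w *m (rho s - 1%:M) *m rho w^-1%g.
Proof. by rewrite mulmxBr mulmxBl mulmx1 rhoV !rhoM. Qed.

Lemma rho_full w : row_full (rho w).
Proof. by rewrite row_full_unit repr_mx_unit ?in_setT. Qed.

Lemma rho_free w : row_free (rho w).
Proof. by rewrite row_free_unit repr_mx_unit ?in_setT. Qed.

Lemma reflectionsJ w s : ((w * s * w^-1)%g \in S) = (s \in S).
Proof.
by rewrite !inE conj_sub1 mxrankMfree ?rho_free // eqmxMfull ?rho_full.
Qed.

Lemma reflectionsV s : (s^-1%g \in S) = (s \in S).
Proof.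
rewrite !inE.
have -> : rho s^-1%g - 1%:M = - (rho s^-1%g *m (rho s - 1%:M)).
  by rewrite mulmxBr rhoVK mulmx1 opprB.
by rewrite eqmx_opp eqmxMfull ?rho_full.
Qed.

(** The trace in the denominator is a class function, so kappa inherits the
    invariance of c. *)
Lemma kappaJ w s : s \in S -> kappa rho c (w * s * w^-1)%g = kappa rho c s.
Proof.
move=> Ss; rewrite kappa.unlock.
have -> : c (w * s * w^-1)%g = c s.
  by rewrite -(c_inv w^-1%g Ss) conjgE invgK mulgA.
congr (_ / _); rewrite !linearB /=; congr (_ - _).
have -> : ((w * s * w^-1)^-1 = w * s^-1 * w^-1)%g by rewrite !invMg invgK mulgA.
by rewrite rhoM mxtrace_mulC -rhoM !mulgA mulVg mul1g.
Qed.

(** Both sides are proportional to x(alpha_s) alphav_s(y), as 1 - s^-1 has rank one;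
    comparing traces fixes the factor.  The right-hand side is free of the choice
    of roots, which makes the equivariance under W evident. *)
Lemma relation_coefE s (x : 'rV[C]_n) y : s \in S ->
  c s * (pairing x (alpha s) * pairing (alphav s) y
         / pairing (alphav s) (alpha s)) =
  kappa rho c s * (x *m (1%:M - rho s^-1%g) *m y) 0 0.
Proof.
move=> Ss; have [eq_a eq_v av2] := roots Ss.
have [t at_] : exists t, coroot rho alphav s = t *: alpha s.
  have /submxP[D eD] : ((coroot rho alphav s)^T <= (alpha s)^T)%MS.
    rewrite eq_a; have -> : (coroot rho alphav s) = (rho s - 1%:M) *m (rho s^-1%g *m pinvmx (alphav s)).
      rewrite coroot.unlock [RHS]mulmxA; congr (_ *m _).
      by rewrite mulmxBl rhoV mul1mx.
    by rewrite trmx_mul submxMl.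
  exists (D 0 0); apply: trmx_inj; rewrite eD linearZ /= -mul_scalar_mx.
  by rewrite -mx11_scalar.
have tr : \tr (1%:M - rho s^-1%g) = t * 2.
  rewrite corootE // mxtrace_mulC /mxtrace big_ord1 at_ -scalemxAr mxE.
  by rewrite -[in RHS]av2.
have t0 : t != 0.
  apply/eqP => t0; move: (Ss); rewrite -reflectionsV inE.
  have -> : rho s^-1%g - 1%:M = 0.
    by rewrite -opprB corootE // at_ t0 scale0r mul0mx oppr0.
  by rewrite mxrank0.
rewrite kappa.unlock tr av2 corootE // at_ -scalemxAl -scalemxAr -scalemxAl [X in _ = _ * X]mxE.
have -> : (x *m (alpha s *m alphav s) *m y) 0 0 =
          (x *m alpha s) 0 0 * (alphav s *m y) 0 0.
  by rewrite !mulmxA -(mulmxA (x *m _)) [LHS]mxE big_ord1.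
rewrite /pairing; field.
by rewrite t0.
Qed.

Lemma alphavV s : s \in S -> exists t, alphav s^-1%g = t *: alphav s.
Proof.
move=> Ss; have [_ e1 _] := roots Ss; rewrite -reflectionsV in Ss.
have [_ e2 _] := roots Ss; apply/sub_rVP; rewrite e2 e1 invgK.
have -> : rho s - 1%:M = - (rho s *m (rho s^-1%g - 1%:M)).
  by rewrite mulmxBr rhoV mulmx1 opprB.
by rewrite eqmx_opp submxMl.
Qed.

End Reflections.

(** * Dunkl operators *)

(** C[h] (x) C^d as the column space of polynomials, with sealed operations so that
    vectors are compared only through their coordinates. *)
Definition polmod (K : fieldType) (n d : nat) : Type := 'cV[mpoly.mpoly n K]_d.

HB.lock Definition polmod_add (K : fieldType) (n d : nat)
  (x y : polmod K n d) : polmod K n d := (x : 'cV_d) + y.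
HB.lock Definition polmod_opp (K : fieldType) (n d : nat)
  (x : polmod K n d) : polmod K n d := - (x : 'cV_d).
HB.lock Definition polmod_zero (K : fieldType) (n d : nat) : polmod K n d :=
  (0 : 'cV_d).
HB.lock Definition polmod_scale (K : fieldType) (n d : nat)
  (p : mpoly.mpoly n K) (x : polmod K n d) : polmod K n d := p *: (x : 'cV_d).
HB.lock Definition polmod_of (K : fieldType) (n d : nat)
  (f : 'I_d -> mpoly.mpoly n K) : polmod K n d := \col_j f j.
HB.lock Definition co (K : fieldType) (n d : nat) (m : polmod K n d) (j : 'I_d) :
  mpoly.mpoly n K := (m : 'cV_d) j 0.

Section PolynomialVectors.
Variables (K : fieldType) (n d : nat).
Local Notation P := (mpoly.mpoly n K).
Local Notation M := (polmod K n d).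

HB.instance Definition _ := Choice.on M.

Fact polmod_addA : associative (@polmod_add K n d).
Proof. by move=> x y z; rewrite polmod_add.unlock addrA. Qed.
Fact polmod_addC : commutative (@polmod_add K n d).
Proof. by move=> x y; rewrite polmod_add.unlock addrC. Qed.
Fact polmod_add0 : left_id (@polmod_zero K n d) (@polmod_add K n d).
Proof. by move=> x; rewrite polmod_add.unlock polmod_zero.unlock add0r. Qed.
Fact polmod_addN :
  left_inverse (@polmod_zero K n d) (@polmod_opp K n d) (@polmod_add K n d).
Proof.
by move=> x; rewrite polmod_add.unlock polmod_zero.unlock polmod_opp.unlock addNr.
Qed.
HB.instance Definition _ :=
  GRing.isZmodule.Build M polmod_addA polmod_addC polmod_add0 polmod_addN.

Fact polmod_scaleA p q m :
  polmod_scale p (polmod_scale q m) = polmod_scale (p * q) m :> M.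
Proof. by rewrite polmod_scale.unlock scalerA. Qed.
Fact polmod_scale1 : left_id 1 (@polmod_scale K n d).
Proof. by move=> m; rewrite polmod_scale.unlock scale1r. Qed.
Fact polmod_scaleDr : right_distributive (@polmod_scale K n d) +%R.
Proof.
move=> p u v; rewrite polmod_scale.unlock.
by rewrite /GRing.add /= polmod_add.unlock scalerDr.
Qed.
Fact polmod_scaleDl (m : M) : {morph (@polmod_scale K n d)^~ m : p q / p + q}.
Proof.
move=> p q; rewrite polmod_scale.unlock.
by rewrite [RHS]/GRing.add /= polmod_add.unlock scalerDl.
Qed.
HB.instance Definition _ := GRing.Zmodule_isLmodule.Build P M
  polmod_scaleA polmod_scale1 polmod_scaleDr polmod_scaleDl.

Lemma coP (m m' : M) : (forall j, co m j = co m' j) -> m = m'.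
Proof.
by rewrite co.unlock => e; apply/matrixP => i j; rewrite ord1; apply: e.
Qed.

Lemma co_of f j : co (polmod_of f : M) j = f j.
Proof. by rewrite co.unlock polmod_of.unlock mxE. Qed.

Lemma coD (m m' : M) j : co (m + m') j = co m j + co m' j.
Proof. by rewrite co.unlock /GRing.add /= polmod_add.unlock mxE. Qed.

Lemma coZ p (m : M) j : co (p *: m) j = p * co m j.
Proof. by rewrite co.unlock /GRing.scale /= polmod_scale.unlock mxE. Qed.

Lemma co0 j : co (0 : M) j = 0.
Proof. by rewrite -(scale0r (0 : M)) coZ mul0r. Qed.

Lemma co_sum I (r : seq I) (Q : pred I) (F : I -> M) j :
  co (\sum_(i <- r | Q i) F i) j = \sum_(i <- r | Q i) co (F i) j.
Proof. by apply: (big_morph (fun m => co m j)) => [u v|]; rewrite ?coD ?co0. Qed.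

Lemma polmod_torsion p (m : M) : p *: m = 0 -> p != 0 -> m = 0.
Proof.
move=> pm0 p0; apply: coP => j; rewrite co0.
have /eqP : co (p *: m) j = 0 by rewrite pm0 co0.
by rewrite coZ mulf_eq0 (negPf p0) => /eqP.
Qed.

Definition cst (v : 'cV[K]_d) : M := polmod_of (fun j => (v j 0)%:MP).

Lemma co_cst v j : co (cst v) j = (v j 0)%:MP.
Proof. exact: co_of. Qed.

Lemma cstD u v : cst (u + v) = cst u + cst v.
Proof. by apply: coP => j; rewrite coD !co_cst mxE mpolyCD. Qed.
Lemma cstZ a v : cst (a *: v) = a%:MP *: cst v.
Proof. by apply: coP => j; rewrite coZ !co_cst mxE mpolyCM. Qed.
Lemma cst0 : cst 0 = 0.
Proof. by rewrite -(scale0r 0) cstZ mpolyC0 scale0r. Qed.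
Lemma cst_inj : injective cst.
Proof.
move=> u v e; apply/colP => j; apply: (can_inj (@mpolyCK n K)).
by rewrite -!co_cst e.
Qed.
Lemma cst_sum I (r : seq I) (Q : pred I) F :
  cst (\sum_(i <- r | Q i) F i) = \sum_(i <- r | Q i) cst (F i).
Proof. by apply: (big_morph cst) => [u v|]; rewrite ?cstD ?cst0. Qed.

Lemma polmod_basis m : m = \sum_j co m j *: cst (delta_mx j 0).
Proof.
apply: coP => j; rewrite co_sum (bigD1 j) //= big1 ?addr0 => [|k nk].
  by rewrite coZ co_cst mxE !eqxx mpolyC1 mulr1.
by rewrite coZ co_cst mxE eq_sym (negPf nk) mpolyC0 mulr0.
Qed.

(** M is generated by its constants under the variables; a relation between
    operators can be checked on constants once it is compatible with the variables. *)
Lemma cst_ind (Q : M -> Prop) :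
  (forall v, Q (cst v)) -> (forall m m', Q m -> Q m' -> Q (m + m')) ->
  (forall i m, Q m -> Q ('X_i *: m)) -> forall m, Q m.
Proof.
move=> Qc QD QX m; rewrite (polmod_basis m).
elim/big_ind: _ => //; first by have := Qc 0; rewrite cst0.
move=> j _; elim/mpoly_ring_ind: (co m j) => [a|p q Qp Qq|i p Qp].
- by rewrite -cstZ.
- by rewrite scalerDl; apply: QD.
- by rewrite -scalerA; apply: QX.
Qed.

Definition comap (f : P -> P) (m : M) : M := polmod_of (fun j => f (co m j)).

Lemma co_comap f m j : co (comap f m) j = f (co m j).
Proof. exact: co_of. Qed.

Definition vcomp k := comap (hcomp k).

Lemma vcompD k m m' : vcomp k (m + m') = vcomp k m + vcomp k m'.
Proof. by apply: coP => j; rewrite coD !co_comap coD linearD. Qed.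
Lemma vcompZC k a m : vcomp k (a%:MP *: m) = a%:MP *: vcomp k m.
Proof.
by apply: coP => j; rewrite coZ !co_comap coZ !mul_mpolyC linearZ.
Qed.
Lemma vcomp0 k : vcomp k 0 = 0.
Proof. by rewrite -{1}(scale0r 0) -mpolyC0 vcompZC mpolyC0 scale0r. Qed.
Lemma vcomp_sum k I (r : seq I) (Q : pred I) F :
  vcomp k (\sum_(i <- r | Q i) F i) = \sum_(i <- r | Q i) vcomp k (F i).
Proof. by apply: (big_morph (vcomp k)) => [u v|]; rewrite ?vcompD ?vcomp0. Qed.

Lemma vcompX k i m : vcomp k ('X_i *: m) =
  if k is k'.+1 then 'X_i *: vcomp k' m else 0.
Proof.
apply: coP => j; rewrite co_comap coZ hcompX.
by case: k => [|k]; rewrite ?co0 // coZ co_comap.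
Qed.

Lemma vcomp_cst k v : vcomp k (cst v) = if k == 0%N then cst v else 0.
Proof.
by apply: coP => j; rewrite co_comap co_cst hcompC; case: ifP; rewrite ?co_cst ?co0.
Qed.

Lemma vcomp_vcomp k l m : vcomp k (vcomp l m) = if k == l then vcomp l m else 0.
Proof.
by apply: coP => j; rewrite !co_comap hcomp_hcomp; case: ifP; rewrite ?co_comap ?co0.
Qed.

Lemma vcomp_bound m : exists N, forall N', (N <= N')%N ->
  m = \sum_(k < N') vcomp k m /\ forall k, (N <= k)%N -> vcomp k m = 0.
Proof.
pose N j := projT1 (cid (hcomp_sum (co m j))); exists (\max_j N j) => N' le.
have ltN j M' : (\max_j N j <= M')%N -> (N j <= M')%N.
  by apply: leq_trans; apply: leq_bigmax.
split.
  apply: coP => j; rewrite co_sum.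
  have [e _] := projT2 (cid (hcomp_sum (co m j))) N' (ltN _ _ le).
  by rewrite [LHS]e; apply: eq_bigr => k _; rewrite co_comap.
move=> k lek; apply: coP => j; rewrite co_comap co0.
have [_ ->] // := projT2 (cid (hcomp_sum (co m j))) N' (ltN _ _ le).
exact: ltN.
Qed.

Definition ev0 (m : M) : 'cV[K]_d := \col_j (co m j)@_0%MM.

Lemma vcomp0E m : vcomp 0 m = cst (ev0 m).
Proof. by apply: coP => j; rewrite co_comap co_cst hcomp0E mxE. Qed.

Lemma ev0D m m' : ev0 (m + m') = ev0 m + ev0 m'.
Proof. by apply: cst_inj; rewrite cstD -!vcomp0E vcompD. Qed.
Lemma ev0ZC a m : ev0 (a%:MP *: m) = a *: ev0 m.
Proof. by apply: cst_inj; rewrite cstZ -!vcomp0E vcompZC. Qed.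
Lemma ev0X i m : ev0 ('X_i *: m) = 0.
Proof. by apply: cst_inj; rewrite cst0 -!vcomp0E vcompX. Qed.
Lemma ev0_cst v : ev0 (cst v) = v.
Proof. by apply: cst_inj; rewrite -vcomp0E vcomp_cst. Qed.

End PolynomialVectors.
Arguments cst {K} n {d}.

HB.lock Definition tact (R : realType) (W : finGroupType) (n d : nat)
    (tau : mx_representation R[i] [set: W] d) (w : W) (m : polmod R[i] n d) :
    polmod R[i] n d :=
  polmod_of (fun j => \sum_l (tau w j l)%:MP * co m l).

HB.lock Definition wact (R : realType) (W : finGroupType) (n : nat)
    (rho : mx_representation R[i] [set: W] n) (d : nat)
    (tau : mx_representation R[i] [set: W] d) (w : W) (m : polmod R[i] n d) :
    polmod R[i] n d :=
  tact tau w (comap (pact rho w) m).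

(** The Dunkl operator of y on C[h] (x) tau.  There is no derivative term, since
    the parameter t of the Cherednik algebra is 0. *)
HB.lock Definition dop (R : realType) (W : finGroupType) (n : nat)
    (rho : mx_representation R[i] [set: W] n)
    (alphav : W -> 'rV[R[i]]_n) (c : W -> R[i]) (d : nat)
    (tau : mx_representation R[i] [set: W] d) (y : 'cV[R[i]]_n)
    (m : polmod R[i] n d) : polmod R[i] n d :=
  \sum_(s in reflections rho)
    (kappa rho c s * (alphav s *m y) 0 0)%:MP *:
      tact tau s (comap (ddiff (pact rho s) (sym_hd (alphav s))) m).

Lemma mulmx_conjK (K : fieldType) (n k l : nat) (x : 'M[K]_(k, n)) (A A' Q : 'M[K]_n)
    (y : 'M[K]_(n, l)) : A' *m A = 1%:M ->
  x *m A' *m (A *m Q *m A') *m (A *m y) = x *m Q *m y.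
Proof.
move=> A'A; rewrite !mulmxA -(mulmxA x) A'A mulmx1.
by rewrite -(mulmxA (x *m Q)) A'A mulmx1.
Qed.

Section Dunkl.
Variables (R : realType) (W : finGroupType) (n : nat).
Variable rho : mx_representation R[i] [set: W] n.
Variables (alpha : W -> 'cV[R[i]]_n) (alphav : W -> 'rV[R[i]]_n).
Hypothesis roots : reflection_roots rho alpha alphav.
Variable c : W -> R[i].
Hypothesis c_inv : conjugation_invariant rho c.
Variables (d : nat) (tau : mx_representation R[i] [set: W] d).
Local Notation C := R[i].
Local Notation S := (reflections rho).
Local Notation P := (mpoly.mpoly n C).
Local Notation M := (polmod R[i] n d).
Local Notation wa := (wact rho tau).
Local Notation D := (dop rho alphav c tau).
Local Notation cst := (@cst R[i] n d).
Local Notation dd s := (ddiff (pact rho s) (sym_hd (alphav s))).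
Local Notation ta := (@tact _ _ n _ tau).

Lemma tactD w m m' : ta w (m + m') = ta w m + ta w m'.
Proof.
rewrite tact.unlock; apply: coP => j; rewrite coD !co_of -big_split /=.
by apply: eq_bigr => l _; rewrite coD mulrDr.
Qed.

Lemma tactZ w p m : ta w (p *: m) = p *: ta w m.
Proof.
rewrite tact.unlock; apply: coP => j; rewrite coZ !co_of mulr_sumr.
by apply: eq_bigr => l _; rewrite coZ mulrCA.
Qed.

Lemma tact_cst w v : ta w (cst v) = cst (tau w *m v).
Proof.
rewrite tact.unlock; apply: coP => j; rewrite co_cst co_of mxE raddf_sum.
by apply: eq_bigr => l _; rewrite co_cst /= mpolyCM.
Qed.

Lemma wact_cst w v : wa w (cst v) = cst (tau w *m v).
Proof.
rewrite wact.unlock -tact_cst; congr (tact _ _ _); apply: coP => j.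
by rewrite co_comap co_cst pactC.
Qed.

Lemma wactZ w p m : wa w (p *: m) = pact rho w p *: wa w m.
Proof.
rewrite wact.unlock -tactZ; congr (tact _ _ _); apply: coP => j.
by rewrite co_comap !coZ co_comap rmorphM.
Qed.

Lemma wactD w m m' : wa w (m + m') = wa w m + wa w m'.
Proof.
rewrite wact.unlock -tactD; congr (tact _ _ _); apply: coP => j.
by rewrite co_comap !coD !co_comap rmorphD.
Qed.

Lemma wact0 w : wa w 0 = 0.
Proof. by rewrite -(cst0 _ n d) wact_cst mulmx0. Qed.

Lemma wact_sum w I (r : seq I) (Q : pred I) F :
  wa w (\sum_(i <- r | Q i) F i) = \sum_(i <- r | Q i) wa w (F i).
Proof. by apply: (big_morph (wa w)) => [u v|]; rewrite ?wactD ?wact0. Qed.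

Lemma wactX w i m :
  wa w ('X_i *: m) = sym_hd (delta_mx 0 i *m rho w^-1%g) *: wa w m.
Proof. by rewrite wactZ pactX. Qed.

Lemma wact1 m : wa 1%g m = m.
Proof.
elim/cst_ind: m => [x|m m' IH IH'|i m IH].
- by rewrite wact_cst repr_mx1 mul1mx.
- by rewrite wactD IH IH'.
- by rewrite wactZ pact1 IH.
Qed.

Lemma wactM u v m : wa (u * v)%g m = wa u (wa v m).
Proof.
elim/cst_ind: m => [x|m m' IH IH'|i m IH].
- by rewrite !wact_cst repr_mxM ?in_setT // mulmxA.
- by rewrite !wactD IH IH'.
- by rewrite !wactZ pactM IH.
Qed.

Lemma wactK w : cancel (wa w) (wa w^-1%g).
Proof. by move=> p; rewrite -wactM mulVg wact1. Qed.

Lemma wactKV w : cancel (wa w^-1%g) (wa w).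
Proof. by move=> p; rewrite -wactM mulgV wact1. Qed.

Lemma vcomp_tact k w m : vcomp k (ta w m) = ta w (vcomp k m).
Proof.
elim/cst_ind: m k => [x k|m m' IH IH' k|i m IH [|k]].
- by rewrite tact_cst !vcomp_cst; case: ifP; rewrite ?tact_cst // -(cst0 _ n d) tact_cst mulmx0.
- by rewrite !(tactD, vcompD) IH IH'.
- by rewrite tactZ !vcompX -(cst0 _ n d) tact_cst mulmx0.
- by rewrite tactZ !vcompX tactZ IH.
Qed.

Lemma vcomp_wact k w m : vcomp k (wa w m) = wa w (vcomp k m).
Proof.
rewrite wact.unlock vcomp_tact; congr (tact _ _ _); apply: coP => j.
by rewrite !co_comap hcomp_pact.
Qed.

Lemma sym_hdX_sub s i : s \in S ->
  'X_i - pact rho s 'X_i = sym_hd (alphav s) * (coroot rho alphav s i 0)%:MP :> P.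
Proof.
move=> Ss; rewrite pactX -sym_hd_delta -linearB /= -{1}[delta_mx 0 i]mulmx1 -mulmxBr.
rewrite (corootE roots Ss) mulmxA mulrC mul_mpolyC -linearZ /=; congr sym_hd.
rewrite -rowE -mul_scalar_mx; congr (_ *m _); apply/rowP => j.
by rewrite ord1 !mxE.
Qed.

Section OneReflection.
Variables (s : W) (Ss : s \in S).
Let sC := pactC rho s.
Let sX i := sym_hdX_sub i Ss.
Let ell0 : sym_hd (alphav s) != 0 :> P.
Proof. by rewrite sym_hd_eq0 (alphav_neq0 roots Ss). Qed.

Lemma ddD p q : dd s (p + q) = dd s p + dd s q.
Proof. exact: (ddiffD sC sX ell0). Qed.
Lemma dd_cst a : dd s a%:MP = 0. Proof. exact: (ddiffC sC sX ell0). Qed.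
Lemma dd_hd x : dd s (sym_hd x) = ((x *m coroot rho alphav s) 0 0)%:MP.
Proof.
apply: (ddiff_eq sC sX ell0); rewrite mulrC mul_mpolyC -linearZ /= pact_hd -linearB /=.
congr sym_hd; rewrite -{2}[x]mulmx1 -mulmxBr (corootE roots Ss) mulmxA.
by rewrite -mul_scalar_mx -mx11_scalar.
Qed.
Lemma ddM p q : dd s (p * q) = p * dd s q + dd s p * pact rho s q.
Proof. exact: (ddiffM sC sX ell0). Qed.
Lemma dd_fixed p : pact rho s p = p -> dd s p = 0.
Proof. exact: (ddiff_fixed sC sX ell0). Qed.
Lemma hcomp_dd k p : hcomp k (dd s p) = dd s (hcomp k.+1 p).
Proof. exact: (hcomp_ddiff sC sX ell0 (hcomp_pact rho s) (sym_hd_homog _)). Qed.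
Lemma ddE p : sym_hd (alphav s) * dd s p = p - pact rho s p.
Proof. exact: (ddiffE sC sX). Qed.

Lemma comap_ddD (m m' : M) : comap (dd s) (m + m') = comap (dd s) m + comap (dd s) m'.
Proof. by apply: coP => j; rewrite coD !co_comap coD; apply: ddD. Qed.

Lemma comap_ddM p (m : M) :
  comap (dd s) (p *: m) = p *: comap (dd s) m + dd s p *: comap (pact rho s) m.
Proof.
by apply: coP => j; rewrite coD !coZ !co_comap coZ; apply: ddM.
Qed.
End OneReflection.

Lemma dopD y m m' : D y (m + m') = D y m + D y m'.
Proof.
rewrite dop.unlock -big_split; apply: eq_bigr => s Ss /=.
by rewrite comap_ddD // tactD scalerDr.
Qed.

Lemma dop_cst y v : D y (cst v) = 0.
Proof.
rewrite dop.unlock big1 // => s Ss.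
have -> : comap (dd s) (cst v) = cst 0.
  by apply: coP => j; rewrite co_comap !co_cst dd_cst // mxE mpolyC0.
by rewrite tact_cst mulmx0 cst0 scaler0.
Qed.

Lemma dop0 y : D y 0 = 0.
Proof. by rewrite -(cst0 _ n d) dop_cst cst0. Qed.

Lemma dop_sum y I (r : seq I) (Q : pred I) F :
  D y (\sum_(i <- r | Q i) F i) = \sum_(i <- r | Q i) D y (F i).
Proof. by apply: (big_morph (D y)) => [u v|]; rewrite ?dopD ?dop0. Qed.

Lemma dopM y p m : D y (p *: m) = p *: D y m +
  \sum_(s in S) (kappa rho c s * (alphav s *m y) 0 0)%:MP *: (dd s p *: wa s m).
Proof.
rewrite dop.unlock scaler_sumr -big_split; apply: eq_bigr => s Ss /=.
rewrite [p *: (_ *: _)]scalerA [p * _]mulrC -scalerA -scalerDr; congr (_ *: _).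
by rewrite wact.unlock -!tactZ -tactD comap_ddM.
Qed.

Definition refl_form s (x : 'rV[C]_n) (y : 'cV[C]_n) : C :=
  kappa rho c s * (x *m (1%:M - rho s^-1%g) *m y) 0 0.

Lemma dop_hd y x m : D y (sym_hd x *: m) = sym_hd x *: D y m +
  \sum_(s in S) (refl_form s x y)%:MP *: wa s m.
Proof.
rewrite dopM; congr (_ + _); apply: eq_bigr => s Ss; rewrite dd_hd // scalerA -mpolyCM.
rewrite /refl_form (corootE roots Ss) !mulmxA -[in RHS](mulmxA (x *m coroot _ _ _)).
congr (_%:MP *: _); rewrite -mulrA; congr (_ * _).
by rewrite [RHS]mxE big_ord1 mulrC.
Qed.

Lemma dopX y i m : D y ('X_i *: m) = 'X_i *: D y m +
  \sum_(s in S) (refl_form s (delta_mx 0 i) y)%:MP *: wa s m.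
Proof. by rewrite -sym_hd_delta dop_hd. Qed.

(** Divided differences of an invariant vanish, so Dunkl operators are linear over
    the invariants. *)
Lemma dop_fixed y p m : (forall w, pact rho w p = p) -> D y (p *: m) = p *: D y m.
Proof.
move=> fp; rewrite dopM big1 ?addr0 // => s Ss.
by rewrite dd_fixed // scale0r scaler0.
Qed.

Lemma dopZC y a m : D y (a%:MP *: m) = a%:MP *: D y m.
Proof. by apply: dop_fixed => w; rewrite pactC. Qed.

Lemma dop_linear a y z m : D (a *: y + z) m = a%:MP *: D y m + D z m.
Proof.
rewrite dop.unlock scaler_sumr -big_split; apply: eq_bigr => s _ /=.
rewrite scalerA -scalerDl mulmxDr -scalemxAr; congr (_ *: _).
by rewrite -mpolyCM -mpolyCD mulrCA -mulrDr !mxE.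
Qed.

Lemma dop_scale a y m : D (a *: y) m = a%:MP *: D y m.
Proof.
rewrite dop.unlock scaler_sumr; apply: eq_bigr => s _ /=.
by rewrite scalerA -scalemxAr mxE mulrCA mpolyCM.
Qed.

Lemma vcomp_dop k y m : vcomp k (D y m) = D y (vcomp k.+1 m).
Proof.
rewrite dop.unlock vcomp_sum; apply: eq_bigr => s Ss.
rewrite vcompZC vcomp_tact; congr (_ *: tact _ _ _).
by apply: coP => j; rewrite !co_comap hcomp_dd.
Qed.

(** Conjugation by w permutes the reflections, and each summand depends on the
    reflection alone: kappa is a class function and refl_form does not see the
    scaling of the roots. *)
Lemma wact_dop w y m : wa w (D y m) = D (rho w *m y) (wa w m).
Proof.
elim/cst_ind: m => [x|m m' IH IH'|i m IH].
- by rewrite wact_cst !dop_cst wact0.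
- by rewrite !(dopD, wactD) IH IH'.
rewrite dopX wactD !wactX IH dop_hd wact_sum; congr (_ + _).
rewrite [RHS](reindex_inj (conjg_inj w^-1%g)) /=; apply: eq_big => [s|s Ss].
  by rewrite conjgE invgK mulgA reflectionsJ.
rewrite conjgE invgK mulgA wactZ pactC -!wactM mulgVK; congr (_%:MP *: _).
rewrite /refl_form kappaJ //; congr (_ * _).
have -> : ((w * s * w^-1)^-1 = w * s^-1 * w^-1)%g by rewrite !invMg invgK mulgA.
have -> : 1%:M - rho (w * s^-1 * w^-1)%g = rho w *m (1%:M - rho s^-1%g) *m rho w^-1%g.
  by rewrite mulmxBr mulmxBl mulmx1 rhoV !rhoM.
by rewrite (mulmx_conjK _ _ _ (rhoVK rho w)).
Qed.

(** By induction on the degree: the commutator kills constants, and passing a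
    variable across it leaves, for each reflection s, an expression in
    <x - s x, y> <x', z> that is symmetric in y and z because 1 - s has rank one. *)
Lemma dopC y z m : D y (D z m) = D z (D y m).
Proof.
elim/cst_ind: m => [x|m m' IH IH'|i m IH].
- by rewrite !dop_cst !dop0.
- by rewrite !dopD IH IH'.
have expand y' z' : D y' (D z' ('X_i *: m)) = 'X_i *: D y' (D z' m) +
    (\sum_(s in S) (refl_form s (delta_mx 0 i) y')%:MP *: wa s (D z' m) +
     \sum_(s in S) (refl_form s (delta_mx 0 i) z')%:MP *: D y' (wa s m)).
  rewrite [D z' _]dopX dopD dopX dop_sum -addrA; congr (_ + (_ + _)).
  by apply: eq_bigr => s _; rewrite dopZC.
rewrite !expand IH; congr (_ + _); rewrite -!big_split; apply: eq_bigr => s Ss /=.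
set x : 'rV_n := delta_mx 0 i.
have form y' : refl_form s x y' =
    kappa rho c s * (x *m coroot rho alphav s) 0 0 * (alphav s *m y') 0 0.
  rewrite /refl_form (corootE roots Ss) !mulmxA -(mulmxA (x *m coroot _ _ _)).
  by rewrite -mulrA; congr (_ * _); rewrite [LHS]mxE big_ord1.
have move y' : wa s (D y' m) =
    D y' (wa s m) + ((alphav s *m y') 0 0)%:MP *: D (rho s *m coroot rho alphav s) (wa s m).
  rewrite wact_dop addrC -dop_linear; congr (D _ _).
  have -> : (alphav s *m y') 0 0 *: (rho s *m coroot rho alphav s) =
      rho s *m (coroot rho alphav s *m (alphav s *m y')).
    by rewrite {2}[alphav s *m y']mx11_scalar mul_mx_scalar scalemxAr.
  rewrite (mulmxA (coroot _ _ _)) -(corootE roots Ss) mulmxBl mul1mx mulmxBr.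
  by rewrite (mulmxA (rho s)) rhoV mul1mx subrK.
rewrite !move !form !scalerDr !scalerA -!mpolyCM.
rewrite addrAC [RHS]addrAC [X in X + _ = _]addrC; congr (_ + _%:MP *: _).
by rewrite mulrAC.
Qed.

End Dunkl.

Local Open Scope fset_scope.
Local Open Scope quotient_scope.
Local Open Scope ring_scope.

(** * The polynomial representation of the Cherednik algebra *)

Section Presentation.
Variables (R : realType) (W : finGroupType) (n : nat).
Variable rho : mx_representation R[i] [set: W] n.
Variables (alpha : W -> 'cV[R[i]]_n) (alphav : W -> 'rV[R[i]]_n).
Variable c : W -> R[i].
Local Notation C := R[i].
Local Notation H := (cherednik rho alpha alphav c).
Local Notation proj := (@cherednik_proj R W n rho alpha alphav c).
Local Notation fa := (freealg C ('I_n + 'I_n)%type).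

Lemma smash_tensE (A : pzRingType) (act : ring_action W A) (f : smash act) :
  f = \sum_w smash_tens act (f w) w.
Proof.
apply/ffunP => u; rewrite sum_ffunE (bigD1 u) //= big1 ?addr0 => [|w nw].
  by rewrite ffunE eqxx mulr1n.
by rewrite ffunE eq_sym (negPf nw) mulr0n.
Qed.

Lemma smash_tensM (A : pzRingType) (act : ring_action W A) a b u v :
  smash_tens act a u * smash_tens act b v = smash_tens act (a * act u b) (u * v)%g.
Proof.
apply/ffunP => w; rewrite !ffunE (bigD1 u) //= big1 ?addr0 => [|t nt].
  rewrite !ffunE eqxx mulr1n rmorphMn /= mulrnAr; congr (_ *+ _).
  by rewrite -(inj_eq (mulgI u)) mulKVg.
by rewrite ffunE (negPf nt) mulr0n mul0r.
Qed.

Lemma smash_tensD (A : pzRingType) (act : ring_action W A) a b u :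
  smash_tens act (a + b) u = smash_tens act a u + smash_tens act b u.
Proof. by apply/ffunP => w; rewrite !ffunE mulrnDl. Qed.

Lemma smash_tens0 (A : pzRingType) (act : ring_action W A) u :
  smash_tens act 0 u = 0.
Proof. by apply/ffunP => w; rewrite !ffunE mul0rn. Qed.

Lemma smash_tens1 (A : pzRingType) (act : ring_action W A) :
  smash_tens act 1 1%g = 1.
Proof. by apply/ffunP => w; rewrite !ffunE. Qed.

Lemma smash_tens1M (A : pzRingType) (act : ring_action W A) a b u :
  smash_tens act a 1%g * smash_tens act b u = smash_tens act (a * b) u.
Proof. by rewrite smash_tensM ract1 mul1g. Qed.

Lemma freealg_ind (Q : fa -> Prop) :
  Q 0 -> (forall a b, Q a -> Q b -> Q (a + b)) -> Q 1 ->
  (forall k a, Q a -> Q (malgC k * a)) ->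
  (forall l a, Q a -> Q (letter C l * a)) -> forall a, Q a.
Proof.
move=> Q0 QD Q1 QC QL a; rewrite [a]monalg.monalgE.
elim/big_ind: _ => // k _.
have -> : mkmalgU k (monalg.mcoeff k a) = malgC (monalg.mcoeff k a) * word_prod (@letter C _) k.
  by rewrite word_prod_letter [RHS]malgM_def fgmulUU mulr1 monalg.mul1m.
apply: QC; rewrite /word_prod; elim: (k : seq _) => [|l s IH].
  by rewrite big_nil.
by rewrite big_cons; apply: QL.
Qed.

Lemma tensor_h_delta i : tensor_h (delta_mx i 0) = letter C (inl i) :> fa.
Proof.
rewrite /tensor_h (bigD1 i) //= mxE !eqxx scale1r big1 ?addr0 // => j nj.
by rewrite mxE (negPf nj) scale0r.
Qed.

Lemma tensor_hd_delta i : tensor_hd (delta_mx 0 i) = letter C (inr i) :> fa.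
Proof.
rewrite /tensor_hd (bigD1 i) //= mxE !eqxx scale1r big1 ?addr0 // => j nj.
by rewrite mxE (negPf nj) scale0r.
Qed.

Lemma proj_surj a : exists f, a = proj f.
Proof. by exists (generic_quotient.repr a); rewrite /cherednik_proj /rproj reprK. Qed.

Fact projM f g : proj (f * g) = proj f * proj g.
Proof. exact: (rmorphM (@rproj _ _)). Qed.
Fact projD f g : proj (f + g) = proj f + proj g.
Proof. exact: (rmorphD (@rproj _ _)). Qed.

Fact proj0 : proj 0 = 0.
Proof. exact: (raddf0 (@rproj _ _)). Qed.

Lemma cherednik_ind (Q : H -> Prop) :
  (forall a b, Q a -> Q b -> Q (a + b)) -> Q 1 ->
  (forall k a, Q a -> Q (cherednik_const rho alpha alphav c k * a)) ->
  (forall i a, Q a -> Q (cherednik_h rho alpha alphav c (delta_mx i 0) * a)) ->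
  (forall i a, Q a -> Q (cherednik_hd rho alpha alphav c (delta_mx 0 i) * a)) ->
  (forall w a, Q a -> Q (cherednik_W rho alpha alphav c w * a)) ->
  forall a, Q a.
Proof.
move=> QD Q1 Qk Qh Qhd QW a; have [f ->] := proj_surj a.
have Q0 : Q 0.
  have := Qk 0 _ Q1; rewrite /cherednik_const scale0r smash_tens0.
  by rewrite proj0 mul0r.
rewrite (smash_tensE f); elim/big_ind: _ => [|x y Qx Qy|w _].
- by rewrite proj0.
- by rewrite projD; apply: QD.
elim/freealg_ind: (f w) => [|x y Qx Qy||k x Qx|[i|i] x Qx].
- by rewrite smash_tens0 proj0.
- by rewrite smash_tensD projD; apply: QD.
- by have := QW w 1 Q1; rewrite mulr1.
- rewrite -smash_tens1M projM.
  have -> : malgC k = k%:A :> fa by rewrite -mul_malgC mulr1.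
  exact: Qk.
- by rewrite -smash_tens1M projM -tensor_h_delta; apply: Qh.
- by rewrite -smash_tens1M projM -tensor_hd_delta; apply: Qhd.
Qed.

End Presentation.

HB.lock Definition tensor_sub (R : realType) (W : finGroupType) (n : nat)
    (rho : mx_representation R[i] [set: W] n) (w : W)
    (g : freealg R[i] ('I_n + 'I_n)%type) : freealg R[i] ('I_n + 'I_n)%type :=
  letter_subst (letter_act rho w) g.

Section TensorOperators.
Variables (R : realType) (W : finGroupType) (n : nat).
Variable rho : mx_representation R[i] [set: W] n.
Variables (alpha : W -> 'cV[R[i]]_n) (alphav : W -> 'rV[R[i]]_n).
Hypothesis roots : reflection_roots rho alpha alphav.
Variable c : W -> R[i].
Hypothesis c_inv : conjugation_invariant rho c.
Variables (d : nat) (tau : mx_representation R[i] [set: W] d).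
Local Notation C := R[i].
Local Notation H := (cherednik rho alpha alphav c).
Local Notation proj := (@cherednik_proj R W n rho alpha alphav c).
Local Notation tens := (smash_tens (tensor_action rho)).
Local Notation fa := (freealg C ('I_n + 'I_n)%type).
Local Notation M := (polmod R[i] n d).
Local Notation wa := (wact rho tau).
Local Notation D := (dop rho alphav c tau).

Local Notation tensor_sub := (tensor_sub rho).

Lemma tensor_sub0 w : tensor_sub w 0 = 0.
Proof. by rewrite tensor_sub.unlock raddf0. Qed.
Lemma tensor_subD w g h : tensor_sub w (g + h) = tensor_sub w g + tensor_sub w h.
Proof. by rewrite tensor_sub.unlock; apply: raddfD. Qed.
Lemma tensor_subM w g h : tensor_sub w (g * h) = tensor_sub w g * tensor_sub w h.
Proof. by rewrite tensor_sub.unlock; apply: rmorphM. Qed.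
Lemma tensor_sub1 w : tensor_sub w 1 = 1.
Proof. by rewrite tensor_sub.unlock; apply: rmorph1. Qed.
Lemma tensor_subC w a : tensor_sub w (malgC a) = malgC a.
Proof. by rewrite tensor_sub.unlock; apply: letter_substC. Qed.
Lemma tensor_sub_letter w l : tensor_sub w (letter C l) = letter_act rho w l.
Proof. by rewrite tensor_sub.unlock; apply: letter_subst_letter. Qed.

Definition letter_op (l : 'I_n + 'I_n) (m : M) : M :=
  match l with inl i => D (delta_mx i 0) m | inr i => 'X_i *: m end.

Definition word_op (k : words ('I_n + 'I_n)%type) (m : M) : M :=
  foldr letter_op m (k : seq _).

Definition free_op (g : fa) (m : M) : M :=
  \sum_(k <- enum_fset (monalg.msupp g))
     (monalg.mcoeff k g)%:MP *: word_op k m.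

Lemma letter_opD l m m' : letter_op l (m + m') = letter_op l m + letter_op l m'.
Proof. by case: l => i /=; rewrite ?(dopD roots) ?scalerDr. Qed.

Lemma letter_opZ l a m : letter_op l (a%:MP *: m) = a%:MP *: letter_op l m.
Proof.
case: l => i /=; first exact: (dopZC roots).
by rewrite !scalerA mulrC.
Qed.

Lemma word_opD k m m' : word_op k (m + m') = word_op k m + word_op k m'.
Proof.
rewrite /word_op; elim: (k : seq _) => //= l s ->; exact: letter_opD.
Qed.

Lemma word_opZ k a m : word_op k (a%:MP *: m) = a%:MP *: word_op k m.
Proof.
rewrite /word_op; elim: (k : seq _) => //= l s ->; exact: letter_opZ.
Qed.

Lemma free_opwE g m (A : {fset words ('I_n + 'I_n)%type}) :
  (monalg.msupp g `<=` A)%fset ->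
  free_op g m = \sum_(k <- enum_fset A) (monalg.mcoeff k g)%:MP *: word_op k m.
Proof.
move=> sub; rewrite /free_op; apply: big_fset_incl => // k _.
by move/monalg.mcoeff_outdom => ->; rewrite mpolyC0 scale0r.
Qed.

Lemma free_opDl g h m : free_op (g + h) m = free_op g m + free_op h m.
Proof.
pose A := (monalg.msupp g `|` monalg.msupp h `|` monalg.msupp (g + h))%fset.
have sg : (monalg.msupp g `<=` A)%fset by rewrite /A -fsetUA fsubsetUl.
have sh : (monalg.msupp h `<=` A)%fset.
  by apply: fsubset_trans (fsubsetUl _ _); apply: fsubsetUr.
have sgh : (monalg.msupp (g + h) `<=` A)%fset by apply: fsubsetUr.
rewrite (free_opwE _ sg) (free_opwE _ sh) (free_opwE _ sgh).
rewrite -big_split; apply: eq_bigr => k _ /=.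
by rewrite monalg.mcoeffD mpolyCD scalerDl.
Qed.

Lemma free_op_mono a k m : free_op (mkmalgU k a) m = a%:MP *: word_op k m.
Proof.
rewrite (@free_opwE _ _ [fset k]%fset) ?monalg.msuppU_le //.
by rewrite big_seq_fset1 monalg.mcoeffUU.
Qed.

Lemma free_op0 m : free_op 0 m = 0.
Proof. by rewrite /free_op monalg.msupp0 big_nil. Qed.

Lemma free_op_suml I (r : seq I) (Q : pred I) F m :
  free_op (\sum_(i <- r | Q i) F i) m = \sum_(i <- r | Q i) free_op (F i) m.
Proof. by apply: (big_morph (free_op^~ m)) => [u v|]; rewrite ?free_opDl ?free_op0. Qed.

Lemma free_opDr g m m' : free_op g (m + m') = free_op g m + free_op g m'.
Proof.
by rewrite /free_op -big_split; apply: eq_bigr => k _; rewrite word_opD scalerDr.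
Qed.

Lemma free_opZr g a m : free_op g (a%:MP *: m) = a%:MP *: free_op g m.
Proof.
rewrite /free_op scaler_sumr; apply: eq_bigr => k _.
by rewrite word_opZ !scalerA mulrC.
Qed.

Lemma free_op0r g : free_op g 0 = 0.
Proof. by rewrite -(scale0r 0) -mpolyC0 free_opZr mpolyC0 !scale0r. Qed.

Lemma free_op_sumr g I (r : seq I) (Q : pred I) F :
  free_op g (\sum_(i <- r | Q i) F i) = \sum_(i <- r | Q i) free_op g (F i).
Proof. by apply: (big_morph (free_op g)) => [u v|]; rewrite ?free_opDr ?free_op0r. Qed.

Lemma free_opM g h m : free_op (g * h) m = free_op g (free_op h m).
Proof.
rewrite [g]monalg.monalgE [h]monalg.monalgE mulr_suml !free_op_suml.
apply: eq_bigr => k _; rewrite mulr_sumr free_op_suml free_op_sumr.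
apply: eq_bigr => l _; rewrite [_ * _]malgM_def fgmulUU !free_op_mono word_opZ scalerA.
rewrite mpolyCM; congr (_ *: _).
by rewrite /word_op fmM foldr_cat.
Qed.

Lemma free_op_letter l m : free_op (letter C l) m = letter_op l m.
Proof. by rewrite free_op_mono mpolyC1 scale1r /word_op fmU. Qed.

Lemma free_opC a m : free_op (malgC a) m = a%:MP *: m.
Proof. by rewrite free_op_mono /word_op fm1. Qed.

Lemma free_op1 m : free_op 1 m = m.
Proof. by rewrite [1](_ : _ = malgC 1) // free_opC mpolyC1 scale1r. Qed.

Lemma free_opZl a g m : free_op (a *: g) m = a%:MP *: free_op g m.
Proof. by rewrite -mul_malgC free_opM free_opC. Qed.

Lemma free_op_h v m : free_op (tensor_h v) m = D v m.
Proof.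
rewrite /tensor_h free_op_suml {2}[v](_ : _ = \sum_i v i 0 *: delta_mx i 0).
  transitivity (\sum_i D (v i 0 *: delta_mx i 0) m).
    by apply: eq_bigr => i _; rewrite free_opZl free_op_letter dop_scale.
  apply: esym; apply: (big_morph (D^~ m)) => [x y|].
    by rewrite -[x]scale1r dop_linear mpolyC1 !scale1r.
  by rewrite -(scale0r 0) dop_scale mpolyC0 scale0r.
apply/colP => j; rewrite summxE (bigD1 j) //= !mxE !eqxx mulr1 big1 ?addr0 // => k nk.
by rewrite !mxE eq_sym (negPf nk) mulr0.
Qed.

Lemma free_op_hd x m : free_op (tensor_hd x) m = sym_hd x *: m.
Proof.
rewrite /tensor_hd free_op_suml /sym_hd scaler_suml; apply: eq_bigr => i _.
by rewrite free_opZl free_op_letter -mul_mpolyC scalerA.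
Qed.

Lemma wact_free_op w g m :
  wa w (free_op g m) = free_op (tensor_sub w g) (wa w m).
Proof.
elim/freealg_ind: g => [|g h IHg IHh||k g IH|l g IH].
- by rewrite tensor_sub0 !free_op0 wact0.
- by rewrite tensor_subD !free_opDl wactD IHg IHh.
- by rewrite tensor_sub1 !free_op1.
- rewrite tensor_subM tensor_subC [RHS]free_opM [RHS]free_opC -IH.
  rewrite -[k%:MP](pactC rho w) -wactZ; congr (wa w _).
  by rewrite [LHS]free_opM [LHS]free_opC.
- rewrite tensor_subM tensor_sub_letter [RHS]free_opM -IH.
  transitivity (wa w (letter_op l (free_op g m))).
    by congr (wa w _); rewrite [LHS]free_opM [LHS]free_op_letter.
  case: l => i /=; first by rewrite [RHS]free_op_h (wact_dop roots c_inv).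
  by rewrite [RHS]free_op_hd wactX.
Qed.

Definition smash_op (f : smash (tensor_action rho)) (m : M) : M :=
  \sum_w free_op (f w) (wa w m).

Lemma smash_opDl f g m : smash_op (f + g) m = smash_op f m + smash_op g m.
Proof.
by rewrite /smash_op -big_split; apply: eq_bigr => w _; rewrite ffunE free_opDl.
Qed.

Lemma smash_opDr f m m' : smash_op f (m + m') = smash_op f m + smash_op f m'.
Proof.
by rewrite /smash_op -big_split; apply: eq_bigr => w _; rewrite wactD free_opDr.
Qed.

Lemma smash_op_tens g w m : smash_op (tens g w) m = free_op g (wa w m).
Proof.
rewrite /smash_op (bigD1 w) //= ffunE eqxx mulr1n big1 ?addr0 // => u nu.
by rewrite ffunE (negPf nu) mulr0n free_op0.
Qed.

Lemma smash_opM f g m : smash_op (f * g) m = smash_op f (smash_op g m).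
Proof.
rewrite /smash_op.
transitivity (\sum_w \sum_u free_op (f u * tensor_action rho u (g (u^-1 * w)%g)) (wa w m)).
  by apply: eq_bigr => w _; rewrite ffunE free_op_suml.
rewrite exchange_big; apply: eq_bigr => u _ /=.
rewrite wact_sum free_op_sumr (reindex_inj (mulgI u)) /=; apply: eq_bigr => w _.
by rewrite mulKg free_opM wactM wact_free_op tensor_sub.unlock.
Qed.

Lemma smash_op0 m : smash_op 0 m = 0.
Proof. by rewrite /smash_op big1 // => w _; rewrite ffunE free_op0. Qed.

Lemma smash_op1 m : smash_op 1 m = m.
Proof. by rewrite -smash_tens1 smash_op_tens free_op1 wact1. Qed.

Lemma smash_opN f m : smash_op (- f) m = - smash_op f m.
Proof. by apply/eqP; rewrite -addr_eq0 -smash_opDl addNr smash_op0. Qed.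

Lemma smash_op0r f : smash_op f 0 = 0.
Proof. by rewrite /smash_op big1 // => w _; rewrite wact0 free_op0r. Qed.

Lemma smash_op_suml I (r : seq I) (Q : pred I) F m :
  smash_op (\sum_(i <- r | Q i) F i) m = \sum_(i <- r | Q i) smash_op (F i) m.
Proof. by apply: (big_morph (smash_op^~ m)) => [u v|]; rewrite ?smash_opDl ?smash_op0. Qed.

Lemma smash_opB f g m : smash_op (f - g) m = smash_op f m - smash_op g m.
Proof. by rewrite [LHS]smash_opDl [X in _ + X]smash_opN. Qed.

Lemma smash_op_vec y m : smash_op (tens (tensor_h y) 1%g) m = D y m.
Proof. by rewrite [LHS]smash_op_tens wact1; apply: free_op_h. Qed.

Lemma smash_op_covec x m : smash_op (tens (tensor_hd x) 1%g) m = sym_hd x *: m.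
Proof. by rewrite [LHS]smash_op_tens wact1; apply: free_op_hd. Qed.

(** The relation that involves the parameters is the Leibniz rule for a linear form;
    the one between two vectors of h is the commutativity of the Dunkl operators. *)
Lemma smash_op_rel f m : cherednik_rel alpha alphav c f -> smash_op f m = 0.
Proof.
case=> [x x'|y y'|y x].
- transitivity (sym_hd x *: (sym_hd x' *: m) - sym_hd x' *: (sym_hd x *: m)).
    rewrite [LHS]smash_opB; congr (_ - _); rewrite [LHS]smash_opM;
      rewrite [LHS]smash_op_covec; congr (_ *: _); exact: smash_op_covec.
  by rewrite !scalerA mulrC subrr.
- transitivity (D y (D y' m) - D y' (D y m)).
    rewrite [LHS]smash_opB; congr (_ - _); rewrite [LHS]smash_opM;
      rewrite [LHS]smash_op_vec; congr (D _ _); exact: smash_op_vec.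
  by rewrite (dopC roots c_inv) subrr.
transitivity (D y (sym_hd x *: m) - sym_hd x *: D y m -
  \sum_(s in reflections rho) (refl_form rho c s x y)%:MP *: wa s m); last first.
  by rewrite (dop_hd roots) addrAC addrK subrr.
rewrite [LHS]smash_opB; congr (_ - _); last first.
  rewrite [LHS]smash_op_suml; apply: eq_bigr => s Ss.
  rewrite [LHS]smash_op_tens [LHS]free_opZl free_op1.
  by rewrite (relation_coefE roots c x y Ss).
rewrite [LHS]smash_opB; congr (_ - _); rewrite [LHS]smash_opM.
  by rewrite [LHS]smash_op_vec; congr (D _ _); apply: smash_op_covec.
by rewrite [LHS]smash_op_covec; congr (_ *: _); apply: smash_op_vec.
Qed.

Lemma smash_op_ideal f m :
  two_sided_ideal (cherednik_rel alpha alphav c) f -> smash_op f m = 0.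
Proof.
elim=> [|a s b x rel _ IH]; first exact: smash_op0.
rewrite [LHS]smash_opDl IH addr0.
rewrite [LHS]smash_opM [LHS]smash_opM.
by rewrite [X in smash_op a X]smash_op_rel // smash_op0r.
Qed.

Definition cherednik_op (a : H) (m : M) : M := smash_op (generic_quotient.repr a) m.

Lemma cherednik_op_proj f m : cherednik_op (proj f) m = smash_op f m.
Proof.
apply/eqP; rewrite -subr_eq0 -smash_opB; apply/eqP/smash_op_ideal.
apply/asboolP; suff : generic_quotient.repr (proj f) - f \in
    ideal_pred (cherednik_rel alpha alphav c) by [].
by rewrite Quotient.idealrBE reprK.
Qed.

Lemma cherednik_opM a b m :
  cherednik_op (a * b) m = cherednik_op a (cherednik_op b m).
Proof.
have [f ->] := proj_surj a; have [g ->] := proj_surj b.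
rewrite -projM [LHS]cherednik_op_proj [RHS]cherednik_op_proj [LHS]smash_opM.
by congr (smash_op _ _); rewrite cherednik_op_proj.
Qed.

Lemma cherednik_opDl m : {morph cherednik_op^~ m : a b / a + b}.
Proof.
move=> a b; have [f ->] := proj_surj a; have [g ->] := proj_surj b.
rewrite -projD [LHS]cherednik_op_proj [LHS]smash_opDl.
by congr (_ + _); rewrite cherednik_op_proj.
Qed.

Lemma cherednik_opDr : right_distributive cherednik_op +%R.
Proof. by move=> a m m'; apply: smash_opDr. Qed.

Lemma cherednik_op1 : left_id 1 cherednik_op.
Proof. by move=> m; rewrite (cherednik_op_proj 1) smash_op1. Qed.

Lemma cherednik_opA a b m :
  cherednik_op a (cherednik_op b m) = cherednik_op (a * b) m.
Proof. by rewrite cherednik_opM. Qed.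

End TensorOperators.

(* Doc *)
(** A copy of C[h] (x) tau that carries the action of the Cherednik algebra; the
    proofs roots and c_inv are parameters because the action exists thanks to them. *)
Definition dunkl (R : realType) (W : finGroupType) (n : nat)
    (rho : mx_representation R[i] [set: W] n)
    (alpha : W -> 'cV[R[i]]_n) (alphav : W -> 'rV[R[i]]_n)
    (roots : reflection_roots rho alpha alphav)
    (c : W -> R[i]) (c_inv : conjugation_invariant rho c)
    (d : nat) (tau : mx_representation R[i] [set: W] d) : Type :=
  polmod R[i] n d.

Section DunklModule.
Variables (R : realType) (W : finGroupType) (n : nat).
Variable rho : mx_representation R[i] [set: W] n.
Variables (alpha : W -> 'cV[R[i]]_n) (alphav : W -> 'rV[R[i]]_n).
Variable roots : reflection_roots rho alpha alphav.
Variable c : W -> R[i].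
Variable c_inv : conjugation_invariant rho c.
Variables (d : nat) (tau : mx_representation R[i] [set: W] d).
Local Notation H := (cherednik rho alpha alphav c).
Local Notation M := (dunkl roots c_inv tau).

HB.instance Definition _ := GRing.Zmodule.on M.
HB.instance Definition _ := GRing.Zmodule_isLmodule.Build H M
  (@cherednik_opA R W n rho alpha alphav roots c c_inv d tau)
  (@cherednik_op1 R W n rho alpha alphav roots c c_inv d tau)
  (@cherednik_opDr R W n rho alpha alphav roots c d tau)
  (@cherednik_opDl R W n rho alpha alphav roots c c_inv d tau).

Lemma dunkl_const k (m : M) :
  cherednik_const rho alpha alphav c k *: m = (k%:MP *: (m : polmod _ _ _)) :> polmod _ _ _.
Proof.
rewrite /cherednik_const [LHS]cherednik_op_proj // smash_op_tens wact1.
by rewrite (free_opZl roots) free_op1.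
Qed.

Lemma dunkl_h y (m : M) :
  cherednik_h rho alpha alphav c y *: m = dop rho alphav c tau y (m : polmod _ _ _) :> polmod _ _ _.
Proof. by rewrite /cherednik_h [LHS]cherednik_op_proj // (smash_op_vec roots). Qed.

Lemma dunkl_hd x (m : M) :
  cherednik_hd rho alpha alphav c x *: m = (sym_hd x *: (m : polmod _ _ _)) :> polmod _ _ _.
Proof. by rewrite /cherednik_hd [LHS]cherednik_op_proj // (smash_op_covec roots). Qed.

Lemma dunkl_W w (m : M) :
  cherednik_W rho alpha alphav c w *: m = wact rho tau w m :> polmod _ _ _.
Proof. by rewrite /cherednik_W [LHS]cherednik_op_proj // smash_op_tens free_op1. Qed.

End DunklModule.

(** * Relations and evaluation of polynomials in the Cherednik algebra *)

Section CommutingEvaluation.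
Variables (K : fieldType) (n : nat) (A : pzRingType).
Variables (k : K -> A) (z : 'I_n -> A).
Hypothesis kD : {morph k : a b / a + b}.
Hypothesis kM : {morph k : a b / a * b}.
Hypothesis k1 : k 1 = 1.
Hypothesis kz : forall a i, k a * z i = z i * k a.
Hypothesis zz : forall i j, z i * z j = z j * z i.
Local Notation P := (mpoly.mpoly n K).

Definition mono_eval (m : 'X_{1..n}) : A := \prod_(i < n) z i ^+ m i.
(** The shape of the maps from Sym(h) and Sym(h^* ) to the Cherednik algebra, for
    scalars k a and pairwise commuting values z i in a noncommutative ring. *)
Definition comm_eval (p : P) : A := \sum_(m <- msupp p) (k p@_m * mono_eval m).

Let k0 : k 0 = 0.
Proof. by apply: (addrI (k 0)); rewrite -kD !addr0. Qed.

Lemma comm_evalwE N p : (msize p <= N)%N ->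
  comm_eval p = \sum_(m : 'X_{1..n < N}) k p@_m * mono_eval m.
Proof.
move=> le_pN; rewrite /comm_eval.
set I : subFinType _ := 'X_{1..n < N}.
rewrite (ssrcomplements.big_mksub I) ?msupp_uniq //=; first last.
  by move=> x /msize_mdeg_lt /leq_trans; apply.
rewrite big_rmcond //= => m /memN_msupp_eq0 ->; by rewrite k0 mul0r.
Qed.

Lemma comm_evalD p q : comm_eval (p + q) = comm_eval p + comm_eval q.
Proof.
pose N := maxn (msize (p + q)) (maxn (msize p) (msize q)).
rewrite !(@comm_evalwE N) ?leq_max ?leqnn ?orbT // -big_split.
by apply: eq_bigr => m _; rewrite mcoeffD kD mulrDl.
Qed.

Lemma mono_evalX i m : mono_eval (U_(i) + m)%MM = z i * mono_eval m.
Proof.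
rewrite /mono_eval /index_enum -enumT.
have : i \in enum 'I_n by rewrite mem_enum.
elim: (enum 'I_n) (enum_uniq 'I_n) => //= j r IH /andP[nj ur].
rewrite inE !big_cons => /orP[/eqP ij|ir].
  rewrite -ij mnmDE mnm1E eqxx exprS -mulrA; congr (_ * (_ * _)).
  rewrite !big_seq; apply: eq_bigr => l lr; rewrite mnmDE mnm1E.
  by case: eqP => // il; move: nj; rewrite -ij il lr.
rewrite IH // mnmDE mnm1E; case: eqP => [ij|_].
  by move: nj; rewrite -ij ir.
rewrite add0n !mulrA; congr (_ * _).
by elim: (m j) => [|e IHe]; rewrite ?expr0 ?mul1r ?mulr1 // exprS -mulrA IHe !mulrA zz.
Qed.

Lemma comm_evalX i p : comm_eval ('X_i * p) = z i * comm_eval p.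
Proof.
rewrite /comm_eval mulrC (perm_big _ (msuppMX p _)) big_map mulr_sumr.
by apply: eq_bigr => m _; rewrite mcoeffMX mono_evalX !mulrA kz.
Qed.

Lemma comm_evalC a : comm_eval a%:MP = k a.
Proof.
have m0 : mono_eval 0%MM = 1.
  by rewrite /mono_eval big1 // => i _; rewrite mnm0E expr0.
rewrite /comm_eval; have [->|a0] := eqVneq a 0.
  by rewrite mpolyC0 msupp0 big_nil k0.
by rewrite msuppC (negPf a0) big_seq1 mcoeffC eqxx mulr1 m0 mulr1.
Qed.

Lemma comm_evalM p q : comm_eval (p * q) = comm_eval p * comm_eval q.
Proof.
elim/mpoly_ring_ind: p q => [a q|p p' IH IH' q|i p IH q].
- rewrite comm_evalC; elim/mpoly_ring_ind: q => [b|q q' IHq IHq'|i q IHq].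
  + by rewrite -mpolyCM !comm_evalC kM.
  + by rewrite mulrDr !comm_evalD IHq IHq' mulrDr.
  + by rewrite mulrCA !comm_evalX IHq !mulrA kz.
- by rewrite mulrDl !comm_evalD mulrDl IH IH'.
- by rewrite -mulrA !comm_evalX IH mulrA.
Qed.

End CommutingEvaluation.

Section CherednikRelations.
Variables (R : realType) (W : finGroupType) (n : nat).
Variable rho : mx_representation R[i] [set: W] n.
Variables (alpha : W -> 'cV[R[i]]_n) (alphav : W -> 'rV[R[i]]_n).
Hypothesis roots : reflection_roots rho alpha alphav.
Variable c : W -> R[i].
Local Notation C := R[i].
Local Notation H := (cherednik rho alpha alphav c).
Local Notation proj := (@cherednik_proj R W n rho alpha alphav c).
Local Notation tens := (smash_tens (tensor_action rho)).
Local Notation fa := (freealg C ('I_n + 'I_n)%type).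
Local Notation ck := (cherednik_const rho alpha alphav c).
Local Notation ch := (cherednik_h rho alpha alphav c).
Local Notation chd := (cherednik_hd rho alpha alphav c).
Local Notation cW := (cherednik_W rho alpha alphav c).

Lemma proj_rel f : cherednik_rel alpha alphav c f -> proj f = 0.
Proof.
move=> rel; rewrite -(proj0 rho alpha alphav c).
have : f - 0 \in ideal_pred (cherednik_rel alpha alphav c).
  apply/asboolP; rewrite subr0 -[f]addr0 -[X in X + _]mul1r -[X in X + _]mulr1.
  by apply: idealMD => //; apply: ideal0.
by rewrite Quotient.idealrBE => /eqP.
Qed.

Lemma ckD : {morph ck : a b / a + b}.
Proof. by move=> a b; rewrite /ck -projD -smash_tensD scalerDl. Qed.

Lemma algZ_comm (a : C) (g : fa) : a%:A * g = g * a%:A.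
Proof. by rewrite -(mul_malgC a 1) mulr1; apply: malgC_comm. Qed.

Lemma ckM : {morph ck : a b / a * b}.
Proof.
move=> a b; rewrite /ck -projM smash_tens1M; congr (proj (tens _ _)).
by rewrite -[RHS]scalerAl mul1r [RHS]scalerA.
Qed.

Lemma ck1 : ck 1 = 1.
Proof. by rewrite /ck scale1r smash_tens1. Qed.

Lemma letter_act_alg w (a : C) : tensor_action rho w a%:A = a%:A.
Proof. by rewrite -(mul_malgC a 1) mulr1; apply: letter_substC. Qed.

Lemma ck_mul a (g : fa) w : ck a * proj (tens g w) = proj (tens (a *: g) w).
Proof.
rewrite /ck -projM smash_tens1M; congr (proj (tens _ _)).
by rewrite -[LHS]scalerAl mul1r.
Qed.

Lemma ck_central a (h : H) : ck a * h = h * ck a.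
Proof.
have [f ->] := proj_surj h; rewrite (smash_tensE f).
elim/big_ind: _ => [|x y IHx IHy|w _].
- by rewrite proj0 mulr0 mul0r.
- by rewrite projD mulrDr IHx IHy mulrDl.
rewrite [LHS]ck_mul /ck -projM [X in proj X = _]/(tens _ _).
transitivity (proj (tens (f w * tensor_action rho w a%:A) (w * 1)%g)).
  rewrite letter_act_alg mulg1; congr (proj (tens _ _)).
  by rewrite -algZ_comm -[RHS]scalerAl mul1r.
by congr proj; rewrite [RHS]smash_tensM.
Qed.

Fact tensor_hd_linear a x y : tensor_hd (a *: x + y) = a *: tensor_hd x + tensor_hd y :> fa.
Proof.
rewrite /tensor_hd scaler_sumr -big_split; apply: eq_bigr => i _ /=.
by rewrite !mxE scalerDl scalerA.
Qed.
Fact tensor_h_linear a x y : tensor_h (a *: x + y) = a *: tensor_h x + tensor_h y :> fa.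
Proof.
rewrite /tensor_h scaler_sumr -big_split; apply: eq_bigr => i _ /=.
by rewrite !mxE scalerDl scalerA.
Qed.

Lemma chd_linear a x y : chd (a *: x + y) = ck a * chd x + chd y.
Proof. by rewrite /chd tensor_hd_linear smash_tensD projD -ck_mul. Qed.
Lemma ch_linear a x y : ch (a *: x + y) = ck a * ch x + ch y.
Proof. by rewrite /ch tensor_h_linear smash_tensD projD -ck_mul. Qed.

Lemma chd0 : chd 0 = 0.
Proof. by have := chd_linear 1 0 0; rewrite scale1r addr0 ck1 mul1r -{1}[chd 0]addr0 => /addrI. Qed.
Lemma ch0 : ch 0 = 0.
Proof. by have := ch_linear 1 0 0; rewrite scale1r addr0 ck1 mul1r -{1}[ch 0]addr0 => /addrI. Qed.
Lemma ck0 : ck 0 = 0.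
Proof. by have := ckD 0 0; rewrite addr0 -{1}[ck 0]addr0 => /addrI. Qed.

Lemma chdE x : chd x = \sum_i ck (x 0 i) * chd (delta_mx 0 i).
Proof.
rewrite {1}[x]row_sum_delta.
elim/big_rec2: _ => [|i u v _ <-]; first exact: chd0.
exact: chd_linear.
Qed.
Lemma chE x : ch x = \sum_i ck (x i 0) * ch (delta_mx i 0).
Proof.
rewrite {1}(_ : x = \sum_i x i 0 *: delta_mx i 0).
  elim/big_rec2: _ => [|i u v _ <-]; first exact: ch0.
  exact: ch_linear.
apply/colP => j; rewrite summxE (bigD1 j) //= !mxE !eqxx mulr1 big1 ?addr0 // => k nk.
by rewrite !mxE eq_sym (negPf nk) mulr0.
Qed.

Fact projB f g : proj (f - g) = proj f - proj g.
Proof. exact: (raddfB (@rproj _ _)). Qed.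

Lemma chd_comm x y : chd x * chd y = chd y * chd x.
Proof.
rewrite /chd -[LHS]projM -[RHS]projM; apply: subr0_eq; rewrite -[LHS]projB.
by apply: proj_rel; apply: cherednik_xx.
Qed.

Lemma ch_comm x y : ch x * ch y = ch y * ch x.
Proof.
rewrite /ch -[LHS]projM -[RHS]projM; apply: subr0_eq; rewrite -[LHS]projB.
by apply: proj_rel; apply: cherednik_yy.
Qed.

Lemma ch_chd y x : ch y * chd x = chd x * ch y +
  \sum_(s in reflections rho) ck (refl_form rho c s x y) * cW s.
Proof.
apply/eqP; rewrite addrC -subr_eq; apply/eqP.
rewrite /ch /chd -[X in X - _ = _]projM -[X in _ - X = _]projM -[LHS]projB.
transitivity (proj (\sum_(s in reflections rho) tens (c s * (pairing x (alpha s) * pairing (alphav s) y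
                    / pairing (alphav s) (alpha s)))%:A s)).
  apply: subr0_eq; rewrite -[LHS]projB.
  by apply: proj_rel; apply: cherednik_yx.
rewrite [LHS](big_morph proj (@projD _ _ _ rho alpha alphav c) (proj0 rho alpha alphav c)).
apply: eq_bigr => s Ss; rewrite (relation_coefE roots c x y Ss).
exact: esym (ck_mul _ _ _).
Qed.

Lemma cWM u v : cW (u * v)%g = cW u * cW v.
Proof.
rewrite /cW -[RHS]projM; congr proj; rewrite [RHS]smash_tensM.
by rewrite [X in _ * X]rmorph1 mulr1.
Qed.

Lemma cW1 : cW 1%g = 1.
Proof. by rewrite /cW smash_tens1. Qed.

Lemma cW_chd w x : cW w * chd x = chd (x *m rho w^-1%g) * cW w.
Proof.
rewrite /cW /chd; transitivity (proj (tens (tensor_hd (x *m rho w^-1%g)) w)).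
  rewrite -[LHS]projM; apply: (congr1 proj); rewrite [LHS]smash_tensM mulg1.
  apply: (congr1 (tens^~ w)); rewrite [LHS]mul1r; exact: letter_act_hd.
rewrite -[RHS]projM; apply: (congr1 proj); rewrite [RHS]smash_tens1M.
by apply: (congr1 (tens^~ w)); rewrite [RHS]mulr1.
Qed.

Lemma cW_ch w x : cW w * ch x = ch (rho w *m x) * cW w.
Proof.
rewrite /cW /ch; transitivity (proj (tens (tensor_h (rho w *m x)) w)).
  rewrite -[LHS]projM; apply: (congr1 proj); rewrite [LHS]smash_tensM mulg1.
  apply: (congr1 (tens^~ w)); rewrite [LHS]mul1r; exact: letter_act_h.
rewrite -[RHS]projM; apply: (congr1 proj); rewrite [RHS]smash_tens1M.
by apply: (congr1 (tens^~ w)); rewrite [RHS]mulr1.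
Qed.

Local Notation shd := (cherednik_sym_hd rho alpha alphav c).
Local Notation sh := (cherednik_sym_h rho alpha alphav c).

Let zd (i : 'I_n) := chd (delta_mx 0 i).
Let zdC i j : zd i * zd j = zd j * zd i.
Proof. exact: chd_comm. Qed.
Let kzd a i : ck a * zd i = zd i * ck a.
Proof. exact: ck_central. Qed.

Lemma shdE p : shd p = comm_eval ck zd p. Proof. by []. Qed.
Lemma shdD p q : shd (p + q) = shd p + shd q.
Proof. rewrite !shdE; exact: (comm_evalD _ ckD). Qed.
Lemma shdX i p : shd ('X_i * p) = chd (delta_mx 0 i) * shd p.
Proof. rewrite !shdE; exact: (comm_evalX kzd zdC). Qed.
Lemma shdC a : shd a%:MP = ck a.
Proof. by rewrite shdE (comm_evalC _ ckD). Qed.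

Let z (i : 'I_n) := ch (delta_mx i 0).
Let zC i j : z i * z j = z j * z i.
Proof. exact: ch_comm. Qed.
Let kz a i : ck a * z i = z i * ck a.
Proof. exact: ck_central. Qed.

Lemma shE p : sh p = comm_eval ck z p. Proof. by []. Qed.
Lemma shD p q : sh (p + q) = sh p + sh q.
Proof. rewrite !shE; exact: (comm_evalD _ ckD). Qed.
Lemma shX i p : sh ('X_i * p) = ch (delta_mx i 0) * sh p.
Proof. rewrite !shE; exact: (comm_evalX kz zC). Qed.
Lemma shC a : sh a%:MP = ck a.
Proof. by rewrite shE (comm_evalC _ ckD). Qed.

End CherednikRelations.

(** * The universal property of the polynomial representation *)

Section UniversalProperty.
Variables (R : realType) (W : finGroupType) (n : nat).
Variable rho : mx_representation R[i] [set: W] n.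
Variables (alpha : W -> 'cV[R[i]]_n) (alphav : W -> 'rV[R[i]]_n).
Hypothesis roots : reflection_roots rho alpha alphav.
Variable c : W -> R[i].
Variables (d : nat) (tau : mx_representation R[i] [set: W] d).
Local Notation C := R[i].
Local Notation V := (polmod C n d).
Local Notation cst := (@cst C n d).
Local Notation wa := (wact rho tau).
Local Notation D := (dop rho alphav c tau).

Variables (A : pzRingType) (k : C -> A) (h : 'cV[C]_n -> A) (hd : 'rV[C]_n -> A).
Variable g : W -> A.
Hypothesis kD : {morph k : a b / a + b}.
Hypothesis kM : {morph k : a b / a * b}.
Hypothesis k_central : forall a z, k a * z = z * k a.
Hypothesis hE : forall y, h y = \sum_i k (y i 0) * h (delta_mx i 0).
Hypothesis hdE : forall x, hd x = \sum_i k (x 0 i) * hd (delta_mx 0 i).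
Hypothesis hd_comm : forall x x', hd x * hd x' = hd x' * hd x.
Hypothesis h_hd : forall y x, h y * hd x = hd x * h y +
  \sum_(s in reflections rho) k (refl_form rho c s x y) * g s.
Hypothesis g_hd : forall w x, g w * hd x = hd (x *m rho w^-1%g) * g w.
Let z i := hd (delta_mx 0 i).

Variables (X : lmodType A) (t : 'I_d -> X).
Hypothesis t_h : forall i j, h (delta_mx i 0) *: t j = 0.
Hypothesis t_W : forall w j, g w *: t j = \sum_l k (tau w l j) *: t l.

(** The only candidate for a map of modules that sends the j-th constant vector
    to t j: a polynomial coefficient acts through its evaluation. *)
Definition polmod_lift (m : V) : X := \sum_j comm_eval k z (co m j) *: t j.
Local Notation psi := polmod_lift.

Let zC i j : z i * z j = z j * z i. Proof. exact: hd_comm. Qed.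
Let kz a i : k a * z i = z i * k a. Proof. exact: k_central. Qed.
Let k0 : k 0 = 0.
Proof. by apply: (addrI (k 0)); rewrite -kD !addr0. Qed.

Lemma polmod_liftD m m' : psi (m + m') = psi m + psi m'.
Proof.
rewrite /psi -big_split; apply: eq_bigr => j _ /=.
by rewrite coD (comm_evalD _ kD) scalerDl.
Qed.

Lemma polmod_lift_cst v : psi (cst v) = \sum_j k (v j 0) *: t j.
Proof. by apply: eq_bigr => j _; rewrite co_cst (comm_evalC _ kD). Qed.

Lemma polmod_lift0 : psi 0 = 0.
Proof. by rewrite -(cst0 _ n d) polmod_lift_cst big1 // => j _; rewrite mxE k0 scale0r. Qed.

Lemma polmod_lift_sum I (r : seq I) (Q : pred I) F :
  psi (\sum_(i <- r | Q i) F i) = \sum_(i <- r | Q i) psi (F i).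
Proof. by apply: (big_morph psi) => [u v|]; rewrite ?polmod_liftD ?polmod_lift0. Qed.

Lemma polmod_liftZ p m : psi (p *: m) = comm_eval k z p *: psi m.
Proof.
rewrite /psi scaler_sumr; apply: eq_bigr => j _.
by rewrite coZ (comm_evalM kD kM kz zC) scalerA.
Qed.

Lemma polmod_liftC a m : psi (a%:MP *: m) = k a *: psi m.
Proof. by rewrite polmod_liftZ (comm_evalC _ kD). Qed.

Lemma polmod_liftX i m : psi ('X_i *: m) = z i *: psi m.
Proof.
by rewrite /psi scaler_sumr; apply: eq_bigr => j _; rewrite coZ (comm_evalX kz zC) scalerA.
Qed.

Lemma polmod_lift_hd x m : psi (sym_hd x *: m) = hd x *: psi m.
Proof.
rewrite hdE /sym_hd !scaler_suml polmod_lift_sum; apply: eq_bigr => i _.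
by rewrite -mul_mpolyC -[RHS]scalerA -polmod_liftX -polmod_liftC scalerA.
Qed.

Lemma polmod_lift_wact w m : psi (wa w m) = g w *: psi m.
Proof.
elim/cst_ind: m => [v|m m' IH IH'|i m IH].
- rewrite wact_cst !polmod_lift_cst scaler_sumr.
  transitivity (\sum_j \sum_l k (v l 0) *: (k (tau w j l) *: t j)).
    apply: eq_bigr => j _; rewrite mxE (big_morph k kD k0) scaler_suml.
    by apply: eq_bigr => l _; rewrite scalerA -kM mulrC.
  rewrite exchange_big; apply: eq_bigr => l _ /=.
  by rewrite -scaler_sumr -t_W !scalerA k_central.
- by rewrite wactD !polmod_liftD IH IH' scalerDr.
- by rewrite wactX polmod_lift_hd IH polmod_liftX !scalerA g_hd.
Qed.

(** The commutation relation in the algebra and the Leibniz rule of the Dunkl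
    operators are the same recursion, which starts at 0 since h kills the t j. *)
Lemma polmod_lift_dop y m : psi (D y m) = h y *: psi m.
Proof.
elim/cst_ind: m => [v|m m' IH IH'|i m IH].
- rewrite (dop_cst roots) polmod_lift0 polmod_lift_cst scaler_sumr big1 // => j _.
  rewrite scalerA -k_central -scalerA hE scaler_suml big1 ?scaler0 // => l _.
  by rewrite -scalerA t_h scaler0.
- by rewrite (dopD roots) !polmod_liftD IH IH' scalerDr.
rewrite (dopX roots) polmod_liftD !polmod_liftX IH.
rewrite (scalerA (h y)) h_hd scalerDl; congr (_ + _); first by rewrite scalerA.
rewrite polmod_lift_sum scaler_suml; apply: eq_bigr => s _.
by rewrite polmod_liftC polmod_lift_wact scalerA.
Qed.

End UniversalProperty.

Section DunklLift.
Variables (R : realType) (W : finGroupType) (n : nat).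
Variable rho : mx_representation R[i] [set: W] n.
Variables (alpha : W -> 'cV[R[i]]_n) (alphav : W -> 'rV[R[i]]_n).
Hypothesis roots : reflection_roots rho alpha alphav.
Variable c : W -> R[i].
Hypothesis c_inv : conjugation_invariant rho c.
Variables (d : nat) (tau : mx_representation R[i] [set: W] d).
Local Notation C := R[i].
Local Notation H := (cherednik rho alpha alphav c).
Local Notation M := (dunkl roots c_inv tau).
Local Notation V := (polmod C n d).
Local Notation ck := (cherednik_const rho alpha alphav c).
Local Notation ch := (cherednik_h rho alpha alphav c).
Local Notation chd := (cherednik_hd rho alpha alphav c).
Local Notation cW := (cherednik_W rho alpha alphav c).

Lemma equivariant_linear (X : lmodType H) (f : M -> X) :
  (forall m m', f (m + m') = f m + f m') ->
  (forall a (m : V), f (a%:MP *: m) = ck a *: f m) ->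
  (forall i (m : V), f ('X_i *: m) = chd (delta_mx 0 i) *: f m) ->
  (forall i (m : V), f (dop rho alphav c tau (delta_mx i 0) m) = ch (delta_mx i 0) *: f m) ->
  (forall w (m : V), f (wact rho tau w m) = cW w *: f m) -> linear f.
Proof.
move=> fD fC fX fH fW a m m'; rewrite fD; congr (_ + _).
elim/cherednik_ind: a m {m'} => [a b IHa IHb m||k a IH m|i a IH m|i a IH m|w a IH m].
- by rewrite scalerDl fD IHa IHb scalerDl.
- by move=> m; rewrite !scale1r.
- by rewrite -[k in RHS]/k -[RHS]scalerA -IH -fC -dunkl_const scalerA.
- by rewrite -[RHS]scalerA -IH -fH -dunkl_h scalerA.
- by rewrite -[RHS]scalerA -IH -fX -sym_hd_delta -dunkl_hd scalerA.
- by rewrite -[RHS]scalerA -IH -fW -dunkl_W scalerA.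
Qed.

Variables (X : lmodType H) (t : 'I_d -> X).
Hypothesis t_h : forall i j, ch (delta_mx i 0) *: t j = 0.
Hypothesis t_W : forall w j, cW w *: t j = \sum_l ck (tau w l j) *: t l.

Definition dunkl_lift : M -> X := polmod_lift ck chd t.

Lemma dunkl_lift_linear : linear dunkl_lift.
Proof.
have kD := @ckD _ _ _ rho alpha alphav c; have kM := @ckM _ _ _ rho alpha alphav c.
have kC := @ck_central _ _ _ rho alpha alphav c.
have hE := @chE _ _ _ rho alpha alphav c; have hdE := @chdE _ _ _ rho alpha alphav c.
have hdC := @chd_comm _ _ _ rho alpha alphav c.
have h_hd := ch_chd roots c.
have g_hd := @cW_chd _ _ _ rho alpha alphav c.
apply: equivariant_linear.
- exact: (polmod_liftD _ kD).
- exact: (polmod_liftC kD kM kC hdC).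
- exact: (polmod_liftX kC hdC).
- move=> i; exact: (polmod_lift_dop roots kD kM kC hE hdE hdC h_hd g_hd t_h t_W).
- exact: (polmod_lift_wact kD kM kC hdE hdC g_hd t_W).
Qed.

(** C[h] (x) tau has the universal property of a Verma module: a copy of tau killed
    by h in a module X extends to a map of modules. *)
Lemma dunkl_lift_exists : exists F : {linear M -> X},
  forall v, F (cst n v) = \sum_j ck (v j 0) *: t j.
Proof.
pose F := HB.pack_for {linear M -> X} dunkl_lift
  (GRing.isLinear.Build H M X _ _ dunkl_lift_linear).
exists F => v; exact: (polmod_lift_cst _ (@ckD _ _ _ rho alpha alphav c)).
Qed.

End DunklLift.

(** * Quotients, induced modules and the Verma module *)

Section LModQuotientTheory.
Variables (A : pzRingType) (M : lmodType A) (S : M -> Prop).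

Lemma lproj_eq0 m : lproj S m = 0 <-> submod_span S m.
Proof.
have e : (m - 0 \in span_pred S) = (lproj S m == lproj S 0).
  exact: Quotient.idealrBE.
rewrite subr0 [lproj S 0]linear0 in e; split => [m0|Sm].
  by apply/asboolP; rewrite -[asbool _]/(m \in span_pred S) e m0.
by apply/eqP; rewrite -e; apply/asboolP.
Qed.

Lemma lproj_surj q : exists m, q = lproj S m.
Proof. by exists (generic_quotient.repr q); rewrite /lproj reprK. Qed.

Lemma submod_span_sub (N : M -> Prop) : submodule N -> (forall m, S m -> N m) ->
  forall m, submod_span S m -> N m.
Proof. by move=> [N0 NZ] SN m; elim=> // a s m' Ss _ IH; apply: NZ => //; apply: SN. Qed.

Lemma submod_spanS m : S m -> submod_span S m.
Proof. by move=> Sm; rewrite -[m]addr0 -[m]scale1r; apply: spanZD => //; apply: span0. Qed.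

Variables (X : lmodType A) (f : {linear M -> X}).
Hypothesis f0 : forall m, S m -> f m = 0.

Definition lquot_lift (q : lquot S) : X := f (generic_quotient.repr q).

Lemma lquot_lift_proj m : lquot_lift (lproj S m) = f m.
Proof.
apply/eqP; rewrite -subr_eq0 -linearB /=; apply/eqP.
suff : submod_span S (generic_quotient.repr (lproj S m) - m).
  by apply: (submod_span_sub (N := fun m => f m = 0)) => //; split=> [|a u v fu fv]; rewrite ?linear0 // linearP fu fv scaler0 addr0.
by apply/lproj_eq0; rewrite linearB /= {1}/lproj reprK subrr.
Qed.

Lemma lquot_lift_linear : linear lquot_lift.
Proof.
move=> a u v; have [m ->] := lproj_surj u; have [m' ->] := lproj_surj v.
by rewrite -linearP !lquot_lift_proj linearP.
Qed.

End LModQuotientTheory.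

Section InducedTheory.
Variables (B A : pzRingType) (phi : B -> A) (N : lmodType B).
Local Notation V := (induced phi N).

Definition induced_gen (u : N) : V := lproj (tensor_rel phi (N := N)) (freemod_gen A u).

Lemma induced_genD u v : induced_gen (u + v) = induced_gen u + induced_gen v.
Proof.
apply: subr0_eq; rewrite /induced_gen -linearD -linearB /=.
by apply/lproj_eq0/submod_spanS; apply: tensor_relD.
Qed.

Lemma induced_genZ b u : induced_gen (b *: u) = phi b *: induced_gen u.
Proof.
apply: subr0_eq; rewrite /induced_gen -linearZ -linearB /=.
by apply/lproj_eq0/submod_spanS; apply: tensor_relZ.
Qed.

Lemma induced_gen0 : induced_gen 0 = 0.
Proof. by apply: (addrI (induced_gen 0)); rewrite -induced_genD !addr0. Qed.

Lemma freemodE (g : freemod A N) :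
  g = \sum_(u <- enum_fset (monalg.msupp g)) monalg.mcoeff u g *: freemod_gen A u.
Proof.
rewrite {1}[g]monalg.monalgE; apply: eq_bigr => u _.
apply/malgP => v; rewrite freemod_scaleE /freemod_gen !monalg.mcoeffU.
by rewrite mulrnAr mulr1.
Qed.

Lemma induced_ext (X : lmodType A) (f g : {linear V -> X}) :
  (forall u, f (induced_gen u) = g (induced_gen u)) -> f =1 g.
Proof.
move=> e v; have [m ->] := lproj_surj v; rewrite [m]freemodE !linear_sum.
by apply: eq_bigr => u _; rewrite !linearZ; congr (_ *: _); apply: e.
Qed.

Variables (X : lmodType A) (f : N -> X).
Hypothesis fD : forall u v, f (u + v) = f u + f v.
Hypothesis fZ : forall b u, f (b *: u) = phi b *: f u.

Definition freemod_lift (g : freemod A N) : X :=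
  \sum_(u <- enum_fset (monalg.msupp g)) monalg.mcoeff u g *: f u.

Lemma freemod_liftwE (g : freemod A N) (S : {fset N}) : (monalg.msupp g `<=` S)%fset ->
  freemod_lift g = \sum_(u <- enum_fset S) monalg.mcoeff u g *: f u.
Proof.
move=> sub; apply: big_fset_incl => // u _.
by move/monalg.mcoeff_outdom => ->; rewrite scale0r.
Qed.

Lemma freemod_lift_linear : linear freemod_lift.
Proof.
move=> a g h.
pose S := (monalg.msupp g `|` monalg.msupp h `|` monalg.msupp (a *: g + h)%R)%fset.
have sg : (monalg.msupp g `<=` S)%fset by rewrite /S -fsetUA fsubsetUl.
have sh : (monalg.msupp h `<=` S)%fset.
  by apply: fsubset_trans (fsubsetUl _ _); apply: fsubsetUr.
have sgh : (monalg.msupp (a *: g + h)%R `<=` S)%fset by apply: fsubsetUr.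
rewrite (freemod_liftwE sg) (freemod_liftwE sh) (freemod_liftwE sgh).
rewrite scaler_sumr -big_split; apply: eq_bigr => u _ /=.
by rewrite monalg.mcoeffD freemod_scaleE scalerDl scalerA.
Qed.
HB.instance Definition _ := GRing.isLinear.Build A (freemod A N) X _ freemod_lift
  freemod_lift_linear.

Lemma freemod_lift_gen u : freemod_lift (freemod_gen A u) = f u.
Proof.
rewrite (@freemod_liftwE _ [fset u]%fset) ?monalg.msuppU_le //.
by rewrite big_seq_fset1 monalg.mcoeffUU scale1r.
Qed.

(** The universal property of an induced module. *)
Lemma induced_lift_exists : exists F : {linear V -> X}, forall u, F (induced_gen u) = f u.
Proof.
have f0 m : tensor_rel phi m -> freemod_lift m = 0.
  case=> [u v|b u].
    by rewrite linearB linearD /= !freemod_lift_gen fD subrr.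
  by rewrite linearB linearZ /= !freemod_lift_gen fZ subrr.
have lin := lquot_lift_linear f0.
pose F := HB.pack_for {linear V -> X} (lquot_lift (S := tensor_rel phi (N := N)) freemod_lift)
  (GRing.isLinear.Build A V X _ _ lin).
exists F => u; exact: (etrans (lquot_lift_proj f0 _) (freemod_lift_gen u)).
Qed.

End InducedTheory.

(** A predicate on abstract modules; its instances at concrete modules are not
    unfolded when it is used. *)
Definition isomorphic_modules (A : pzRingType) (X Y : lmodType A) :=
  exists (F : {linear X -> Y}) (G : {linear Y -> X}), cancel F G /\ cancel G F.

Lemma mutually_inverse (A : pzRingType) (X Y : lmodType A) (I : Type) (x : I -> X)
    (y : I -> Y) (F : {linear X -> Y}) (G : {linear Y -> X}) :
  (forall f g : {linear X -> X}, (forall i, f (x i) = g (x i)) -> f =1 g) ->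
  (forall f g : {linear Y -> Y}, (forall i, f (y i) = g (y i)) -> f =1 g) ->
  (forall i, F (x i) = y i) -> (forall i, G (y i) = x i) -> isomorphic_modules X Y.
Proof.
move=> extX extY Fx Gy; exists F, G; split.
  by apply: (extX (G \o F) idfun) => i /=; rewrite Fx Gy.
by apply: (extY (F \o G) idfun) => i /=; rewrite Gy Fx.
Qed.

Section VermaModel.
Variables (R : realType) (W : finGroupType) (n : nat).
Variable rho : mx_representation R[i] [set: W] n.
Variables (alpha : W -> 'cV[R[i]]_n) (alphav : W -> 'rV[R[i]]_n).
Hypothesis roots : reflection_roots rho alpha alphav.
Variable c : W -> R[i].
Hypothesis c_inv : conjugation_invariant rho c.
Variables (d : nat) (tau : mx_representation R[i] [set: W] d).
Local Notation C := R[i].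
Local Notation H := (cherednik rho alpha alphav c).
Local Notation M := (dunkl roots c_inv tau).
Local Notation phi := (@cherednik_sym_smash R W n rho alpha alphav c).
Local Notation N := (inflation rho tau).
Local Notation V := (induced phi N).
Local Notation ck := (cherednik_const rho alpha alphav c).
Local Notation ch := (cherednik_h rho alpha alphav c).
Local Notation chd := (cherednik_hd rho alpha alphav c).
Local Notation cW := (cherednik_W rho alpha alphav c).
Local Notation sh := (cherednik_sym_h rho alpha alphav c).
Local Notation tens := (smash_tens (sym_h_action rho)).
Local Notation gen := (induced_gen phi (N := N)).

Lemma sym_smash_tens p w : phi (tens p w) = sh p * cW w.
Proof.
rewrite /cherednik_sym_smash (bigD1 w) //= ffunE eqxx mulr1n big1 ?addr0 // => u nu.
by rewrite ffunE (negPf nu) mulr0n -mpolyC0 shC ck0 mul0r.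
Qed.

Lemma inflation_tens p w (v : 'cV[C]_d) :
  (tens p w : sym_smash rho) *: (v : N) = p@_0%MM *: (tau w *m v) :> 'cV[C]_d.
Proof.
rewrite [LHS]/(inflation_scale _ _) /inflation_scale (bigD1 w) //=.
rewrite ffunE eqxx mulr1n big1 ?addr0 // => u nu.
by rewrite ffunE (negPf nu) mulr0n mcoeff0 scale0r.
Qed.

Lemma gen_const k (v : 'cV[C]_d) : ck k *: gen v = gen (k *: v).
Proof.
have := induced_genZ phi (tens k%:MP 1%g : sym_smash rho) (v : N).
by rewrite sym_smash_tens cW1 mulr1 shC inflation_tens mpolyCK repr_mx1 mul1mx => <-.
Qed.

Lemma gen_W w (v : 'cV[C]_d) : cW w *: gen v = gen (tau w *m v).
Proof.
have := induced_genZ phi (tens 1%:MP w : sym_smash rho) (v : N).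
by rewrite sym_smash_tens shC ck1 mul1r inflation_tens mpolyCK scale1r => <-.
Qed.

Lemma gen_h i (v : 'cV[C]_d) : ch (delta_mx i 0) *: gen v = 0.
Proof.
have := induced_genZ phi (tens 'X_i 1%g : sym_smash rho) (v : N).
rewrite sym_smash_tens cW1 mulr1 -['X_i]mulr1 shX -mpolyC1 shC ck1 mulr1 => <-.
by rewrite inflation_tens mpolyC1 mulr1 mcoeffX mnm1_eq0 scale0r induced_gen0.
Qed.

Lemma gen_sum I (r : seq I) (Q : pred I) (F : I -> 'cV[C]_d) :
  gen (\sum_(i <- r | Q i) F i) = \sum_(i <- r | Q i) gen (F i).
Proof.
by apply: (big_morph gen) => [u v|]; [apply: induced_genD|apply: induced_gen0].
Qed.

Definition verma_gen j : V := gen (delta_mx j 0 : 'cV[C]_d).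

Lemma verma_gen_h i j : ch (delta_mx i 0) *: verma_gen j = 0.
Proof. exact: gen_h. Qed.

Lemma cV_sum_delta (v : 'cV[C]_d) : v = \sum_j v j 0 *: delta_mx j 0.
Proof.
apply/colP => j; rewrite summxE (bigD1 j) //= !mxE !eqxx mulr1 big1 ?addr0 // => k nk.
by rewrite !mxE eq_sym (negPf nk) mulr0.
Qed.

Lemma verma_gen_W w j : cW w *: verma_gen j = \sum_l ck (tau w l j) *: verma_gen l.
Proof.
rewrite [LHS]gen_W -colE [col j _]cV_sum_delta gen_sum; apply: eq_bigr => l _.
by rewrite mxE gen_const.
Qed.

Lemma dunkl_sym_h p v : sh p *: (cst n v : M) = (p@_0%MM)%:MP *: cst n v :> polmod _ _ _.
Proof.
elim/mpoly_ring_ind: p => [a|p q IHp IHq|i p IH].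
- by rewrite shC dunkl_const mpolyCK.
- rewrite shD mcoeffD mpolyCD [RHS]scalerDl.
  exact: (etrans (scalerDl (cst n v : M) _ _) (congr2 +%R IHp IHq)).
rewrite shX; transitivity (ch (delta_mx i 0) *: (sh p *: (cst n v : M))).
  by rewrite scalerA.
rewrite IH [LHS]dunkl_h (dopZC roots) (dop_cst roots) scaler0.
by rewrite rmorphM /= mcoeffX mnm1_eq0 mul0r mpolyC0 scale0r.
Qed.

Lemma cst_inflation (b : sym_smash rho) (v : 'cV[C]_d) :
  cst n ((b *: (v : N)) : 'cV[C]_d) = phi b *: (cst n v : M).
Proof.
rewrite /cherednik_sym_smash scaler_suml [b *: _]/(inflation_scale _ _).
rewrite /inflation_scale cst_sum; apply: eq_bigr => w _.
rewrite cstZ; transitivity (sh (b w) *: (cst n (tau w *m v) : M)).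
  exact: esym (dunkl_sym_h _ _).
rewrite -[RHS]scalerA; apply: (congr1 (fun m : M => sh (b w) *: m)).
by rewrite [RHS]dunkl_W wact_cst.
Qed.

Lemma dunkl_ext (X : lmodType H) (f g : {linear M -> X}) :
  (forall v, f (cst n v) = g (cst n v)) -> f =1 g.
Proof.
move=> e m; elim/cst_ind: m => [v|m m' IH IH'|i m IH]; first exact: e.
  by rewrite !linearD IH IH'.
have -> : 'X_i *: m = chd (delta_mx 0 i) *: (m : M) by rewrite [RHS]dunkl_hd sym_hd_delta.
by rewrite !linearZ; apply: (congr1 (fun m : X => chd (delta_mx 0 i) *: m)).
Qed.

(** Both sides have the same universal property. *)
Lemma verma_dunkl : isomorphic_modules M V.
Proof.
have [F Fg] := @dunkl_lift_exists _ _ _ rho alpha alphav roots c c_inv d tau V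
  verma_gen verma_gen_h verma_gen_W.
have Fc v : F (cst n v) = gen v.
  rewrite [LHS]Fg [v in RHS]cV_sum_delta gen_sum; apply: eq_bigr => j _.
  exact: gen_const.
have [G Gg] := @induced_lift_exists _ _ phi N M (fun v => cst n (v : 'cV_d)) (@cstD _ _ _)
  cst_inflation.
exact: mutually_inverse (@dunkl_ext M) (@induced_ext _ _ phi N V) Fc Gg.
Qed.

End VermaModel.

(** * Submodules of the polynomial representation and its radical *)

(** x is a root of the product of the X - w x over w in W, which is monic with
    invariant coefficients; the other coefficients vanish under an evaluation
    that kills the orbit of x. *)
Lemma orbit_power (P : idomainType) (W : finGroupType) (act : W -> {rmorphism P -> P})
    (act1 : forall p, act 1%g p = p)
    (actM : forall u v p, act (u * v)%g p = act u (act v p))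
    (K : nzRingType) (ev : {rmorphism P -> K}) (x : P)
    (ev0 : forall w, ev (act w x) = 0) :
  exists a : 'I_#|W| -> P, [/\ forall w j, act w (a j) = a j, forall j, ev (a j) = 0 &
    x ^+ #|W| = \sum_j a j * x ^+ j].
Proof.
pose q : {poly P} := \prod_(w : W) ('X - (act w x)%:P).
have mq : q \is monic by apply: monic_prod => w _; apply: monicXsubC.
have sq : size q = #|W|.+1.
  by rewrite size_prod_XsubC /index_enum -enumT -cardE.
have qX : q.[x] = 0.
  by rewrite horner_prod (bigD1 1%g) //= hornerXsubC act1 subrr mul0r.
have qw w : map_poly (act w) q = q.
  rewrite rmorph_prod [RHS](reindex_inj (mulgI w)); apply: eq_bigr => u _ /=.
  by rewrite map_polyXsubC /= actM.
have q0 : map_poly ev q = 'X^#|W|.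
  rewrite rmorph_prod /= (eq_bigr (fun=> 'X)) => [|w _].
    by rewrite prodr_const.
  by rewrite map_polyXsubC /= ev0 subr0.
exists (fun j => - q`_j); split=> [w j|j|].
- by rewrite raddfN /= -[in RHS](qw w) coef_map.
- by rewrite raddfN -coef_map /= q0 coefXn ltn_eqF ?oppr0.
move: qX; rewrite horner_coef sq big_ord_recr /=.
have -> : q`_#|W| = 1 by have := monicP mq; rewrite /lead_coef sq.
rewrite mul1r addrC => /eqP; rewrite addr_eq0 => /eqP ->.
by rewrite -sumrN; apply: eq_bigr => j _; rewrite mulNr.
Qed.

Section RadicalSubmodule.
Variables (R : realType) (W : finGroupType) (n : nat).
Variable rho : mx_representation R[i] [set: W] n.
Variables (alpha : W -> 'cV[R[i]]_n) (alphav : W -> 'rV[R[i]]_n).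
Hypothesis roots : reflection_roots rho alpha alphav.
Variable c : W -> R[i].
Hypothesis c_inv : conjugation_invariant rho c.
Variables (d : nat) (tau : mx_representation R[i] [set: W] d).
Local Notation C := R[i].
Local Notation P := (mpoly.mpoly n C).
Local Notation V := (polmod C n d).
Local Notation cst := (@cst C n d).
Local Notation wa := (wact rho tau).
Local Notation D := (dop rho alphav c tau).

(** Submodules over the Cherednik algebra, in terms of the operators. *)
Record opsub (N : V -> Prop) : Prop := OpSub {
  opsub0 : N 0;
  opsubD : forall u v, N u -> N v -> N (u + v);
  opsubZ : forall p m, N m -> N (p *: m);
  opsubW : forall w m, N m -> N (wa w m);
  opsubH : forall y m, N m -> N (D y m) }.

Lemma opsubN N m : opsub N -> N m -> N (- m).
Proof. by move=> sN Nm; rewrite -scaleN1r; apply: opsubZ. Qed.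
Lemma opsubB N m m' : opsub N -> N m -> N m' -> N (m - m').
Proof. by move=> sN Nm Nm'; apply: opsubD => //; apply: opsubN. Qed.
Lemma opsub_sum N I (r : seq I) (Q : pred I) (F : I -> V) : opsub N ->
  (forall i, Q i -> N (F i)) -> N (\sum_(i <- r | Q i) F i).
Proof.
by move=> sN NF; elim/big_ind: _ => //; [apply: opsub0|apply: opsubD].
Qed.

Definition hd_invariant (p : P) := (forall w, pact rho w p = p) /\ p@_0%MM = 0.

(** The submodule C[h]^W_+ M. *)
Inductive inv_span : V -> Prop :=
| inv_span0 : inv_span 0
| inv_spanD p m m' : hd_invariant p -> inv_span m' -> inv_span (p *: m + m').

Lemma inv_span_opsub : opsub inv_span.
Proof.
split; first exact: inv_span0.
- move=> u v + Iv; elim=> [|p m m' ip _ IH]; first by rewrite add0r.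
  by rewrite -addrA; apply: inv_spanD.
- move=> q _ [|p m m' ip]; first by rewrite scaler0; apply: inv_span0.
  elim=> [|p' x x' ip' _ IH]; rewrite ?addr0.
    rewrite scalerA mulrC -scalerA -[_ *: _]addr0.
    by apply: inv_spanD => //; apply: inv_span0.
  rewrite addrCA scalerDr scalerA mulrC -scalerA; exact: inv_spanD.
- move=> w m; elim=> [|p x x' ip _ IH]; first by rewrite wact0; apply: inv_span0.
  by rewrite wactD wactZ (proj1 ip w); apply: inv_spanD.
- move=> y m; elim=> [|p x x' ip _ IH]; first by rewrite (dop0 roots); apply: inv_span0.
  by rewrite (dopD roots) (dop_fixed roots) ?(proj1 ip) //; [apply: inv_spanD|case: ip].
Qed.

Lemma inv_span_sub N : opsub N -> (forall p m, hd_invariant p -> N (p *: m)) ->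
  forall m, inv_span m -> N m.
Proof.
move=> sN Np m; elim=> [|p x x' ip _ IH]; first exact: opsub0.
by apply: opsubD => //; apply: Np.
Qed.

Lemma inv_spanZ p m : hd_invariant p -> inv_span (p *: m).
Proof. by move=> ip; rewrite -[_ *: _]addr0; apply: inv_spanD => //; apply: inv_span0. Qed.

Definition dops (ys : seq 'cV[C]_n) (m : V) : V := foldr D m ys.

Lemma dopsD ys m m' : dops ys (m + m') = dops ys m + dops ys m'.
Proof. by elim: ys => //= y ys ->; rewrite (dopD roots). Qed.
Lemma dopsZC ys a m : dops ys (a%:MP *: m) = a%:MP *: dops ys m.
Proof. by elim: ys => //= y ys ->; rewrite (dopZC roots). Qed.
Lemma dops0 ys : dops ys 0 = 0.
Proof. by elim: ys => //= y ys ->; rewrite (dop0 roots). Qed.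
Lemma dops_sum ys I (r : seq I) (Q : pred I) F :
  dops ys (\sum_(i <- r | Q i) F i) = \sum_(i <- r | Q i) dops ys (F i).
Proof. by apply: (big_morph (dops ys)) => [u v|]; rewrite ?dopsD ?dops0. Qed.
Lemma dops_rcons ys y m : dops (rcons ys y) m = dops ys (D y m).
Proof. by rewrite /dops foldr_rcons. Qed.
Lemma dops_wact ys w m :
  dops ys (wa w m) = wa w (dops [seq rho w^-1%g *m y | y <- ys] m).
Proof.
elim: ys => //= y ys ->; rewrite (wact_dop roots c_inv) mulmxA.
by rewrite -(rhoM rho) mulgV repr_mx1 mul1mx.
Qed.

Lemma ev0_wact w m : ev0 (wa w m) = tau w *m ev0 m.
Proof.
by apply: (@cst_inj C n); rewrite -vcomp0E vcomp_wact vcomp0E wact_cst.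
Qed.
Lemma ev0Z p (m : V) : ev0 (p *: m) = p@_0%MM *: ev0 m.
Proof.
apply/colP => j; rewrite !mxE coZ.
exact: (rmorphM (mpoly.mcoeff 0%MM)).
Qed.
Lemma ev0_0 : ev0 (0 : V) = 0.
Proof. by rewrite -(scale0r (0 : V)) ev0Z mcoeff0 scale0r. Qed.
Lemma ev0_sum I (r : seq I) (Q : pred I) (F : I -> V) :
  ev0 (\sum_(i <- r | Q i) F i) = \sum_(i <- r | Q i) ev0 (F i).
Proof. by apply: (big_morph (@ev0 C n d)) => [u v|]; rewrite ?ev0D ?ev0_0. Qed.

(** The radical of M, as the largest submodule of vectors without constant term. *)
Definition vrad (m : V) := forall ys, ev0 (dops ys m) = 0.

(** Closure under a variable holds because the commutator with a Dunkl operator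
    only involves group elements, which preserve the condition. *)
Lemma rad_opsub : opsub vrad.
Proof.
have radX i m : vrad m -> vrad ('X_i *: m).
  move=> Jm ys; elim/last_ind: ys m Jm => [m Jm|ys y IH m Jm].
    by rewrite /dops /= ev0X.
  rewrite dops_rcons (dopX roots) dopsD dops_sum ev0D ev0_sum IH; last first.
    by move=> zs; rewrite -dops_rcons; apply: Jm.
  rewrite add0r big1 // => s _; rewrite dopsZC ev0ZC dops_wact ev0_wact Jm.
  by rewrite mulmx0 scaler0.
split=> [ys|u v Ju Jv ys|p m|w m Jm ys|y m Jm ys].
- by rewrite dops0 ev0_0.
- by rewrite dopsD ev0D Ju Jv addr0.
- elim/mpoly_ring_ind: p m => [a m Jm ys|p q IHp IHq m Jm ys|i p IH m Jm].
  + by rewrite dopsZC ev0ZC Jm scaler0.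
  + by rewrite scalerDl dopsD ev0D IHp // IHq // addr0.
  + by rewrite -scalerA; apply/radX/IH.
- by rewrite dops_wact ev0_wact Jm mulmx0.
- by rewrite -dops_rcons Jm.
Qed.

Lemma rad_max N : opsub N -> (forall m, N m -> ev0 m = 0) -> forall m, N m -> vrad m.
Proof.
move=> sN N0 m Nm ys; apply: N0.
by elim: ys => //= y ys IH; apply: opsubH.
Qed.

Lemma inv_span_rad m : inv_span m -> vrad m.
Proof.
apply: rad_max => {m}; first exact: inv_span_opsub.
move=> m; elim=> [|p x x' ip _ IH]; first exact: ev0_0.
by rewrite ev0D IH ev0Z (proj2 ip) scale0r addr0.
Qed.

Definition ord_ge k (m : V) := forall j, (j < k)%N -> vcomp j m = 0.

Lemma ord_geD k m m' : ord_ge k m -> ord_ge k m' -> ord_ge k (m + m').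
Proof. by move=> o o' j lt; rewrite vcompD o ?o' ?addr0. Qed.
Lemma ord_ge0 k : ord_ge k 0.
Proof. by move=> j _; apply: vcomp0. Qed.
Lemma ord_geX k i m : ord_ge k m -> ord_ge k.+1 ('X_i *: m).
Proof. by move=> o [|j] lt; rewrite vcompX // o ?scaler0. Qed.
Lemma ord_ge_sum k I (r : seq I) (Q : pred I) (F : I -> V) :
  (forall i, Q i -> ord_ge k (F i)) -> ord_ge k (\sum_(i <- r | Q i) F i).
Proof.
by move=> oF; elim/big_ind: _ => //; [apply: ord_ge0|apply: ord_geD].
Qed.

Lemma cst_plusX m : exists f : 'I_n -> V, m = cst (ev0 m) + \sum_i 'X_i *: f i.
Proof.
elim/cst_ind: m => [v|m m' [f ef] [f' ef']|i m _].
- by exists (fun=> 0); rewrite ev0_cst big1 ?addr0 // => i _; rewrite scaler0.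
- exists (fun i => f i + f' i); rewrite {1}ef {1}ef' ev0D cstD addrACA; congr (_ + _).
  by rewrite -big_split; apply: eq_bigr => i _; rewrite scalerDr.
- exists (fun j => if j == i then m else 0).
  rewrite ev0X cst0 add0r (bigD1 i) //= eqxx big1 ?addr0 // => j /negPf ->.
  by rewrite scaler0.
Qed.

Definition vtail k (m : V) := m - \sum_(j < k) vcomp j m.
Lemma vtailX k i m : vtail k.+1 ('X_i *: m) = 'X_i *: vtail k m.
Proof.
rewrite /vtail scalerBr big_ord_recl vcompX add0r scaler_sumr; congr (_ - _).
by apply: eq_bigr => j _; rewrite vcompX.
Qed.
Lemma vtail_ord k m : ord_ge k (vtail k m).
Proof.
move=> j lt; rewrite /vtail -scaleN1r vcompD -mpolyC1 -mpolyCN vcompZC vcomp_sum.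
rewrite (bigD1 (Ordinal lt)) //= vcomp_vcomp eqxx big1 => [|l nl].
  by rewrite addr0 mpolyCN mpolyC1 scaleN1r subrr.
by rewrite vcomp_vcomp; case: eqP => // e; case/eqP: nl; apply: val_inj.
Qed.
Lemma vtail_id k m : ord_ge k m -> vtail k m = m.
Proof. by move=> o; rewrite /vtail big1 ?subr0 // => j _; apply: o. Qed.
Lemma vtailD k m m' : vtail k (m + m') = vtail k m + vtail k m'.
Proof.
rewrite /vtail addrACA -opprD -big_split; congr (_ - _).
by apply: eq_bigr => j _; rewrite vcompD.
Qed.
Lemma vtail0 k : vtail k 0 = 0.
Proof. by apply: vtail_id; apply: ord_ge0. Qed.

(** A monomial of degree at least k is divisible by one of degree exactly k. *)
Lemma ord_ge_monomials (N : V -> Prop) k : N 0 -> (forall u v, N u -> N v -> N (u + v)) ->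
  (forall mu m, mdeg mu = k -> N ('X_[mu] *: m)) -> forall m, ord_ge k m -> N m.
Proof.
move=> N0 ND; elim: k N N0 ND => [|k IH] N N0 ND NX m om.
  by have := NX 0%MM m mdeg0; rewrite mpolyX0 scale1r.
have [f ef] := cst_plusX m; move: ef; rewrite -vcomp0E om // add0r => ef.
have -> : m = \sum_i 'X_i *: vtail k (f i).
  rewrite -(vtail_id om) {1}ef (big_morph (vtail k.+1) (@vtailD _) (@vtail0 _)).
  by apply: eq_bigr => i _; rewrite vtailX.
elim/big_ind: _ => // i _.
apply: (IH (fun m => N ('X_i *: m))); first by rewrite scaler0.
- by move=> u v Nu Nv; rewrite scalerDr; apply: ND.
- move=> mu m' dmu; rewrite scalerA -mpolyXD; apply: NX.
  by rewrite mdegD mdeg1 dmu.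
- exact: vtail_ord.
Qed.

Lemma mpolyX_orbit_power i : exists a : 'I_#|W| -> P,
  (forall j, hd_invariant (a j)) /\ 'X_i ^+ #|W| = \sum_j a j * 'X_i ^+ j :> P.
Proof.
have X0 w : (pact rho w 'X_i)@_0%MM = 0 by rewrite pact_coef0 mcoeffX mnm1_eq0.
have [a [aW a0 eX]] := @orbit_power P W (fun w => pact rho w) (@pact1 _ _ _ rho)
  (@pactM _ _ _ rho) C (mpoly.mcoeff 0%MM) 'X_i X0.
by exists a; split=> // j; split=> [w|]; [apply: aW|apply: a0].
Qed.

(** A monomial of large degree is divisible by the |W|-th power of a variable,
    which lies in the ideal of invariants of positive degree: M modulo inv_span is
    finite dimensional. *)
Lemma ord_ge_inv_span m : ord_ge (n * #|W|).+1 m -> inv_span m.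
Proof.
have sI := inv_span_opsub.
apply: ord_ge_monomials; [exact: opsub0|exact: opsubD|move=> mu {}m dmu].
have [i le] : exists i, (#|W| <= mu i)%N.
  case: (pickP (fun i => (#|W| <= mu i)%N)) => [i le|small]; first by exists i.
  have : (mdeg mu <= n * #|W|)%N.
    rewrite mdegE; apply: leq_trans (_ : \sum_(i < n) #|W| <= _)%N.
      by apply: leq_sum => i _; apply: ltnW; rewrite ltnNge small.
    by rewrite sum_nat_const card_ord.
  by rewrite dmu ltnn.
have -> : 'X_[mu] = 'X_i ^+ #|W| * 'X_[mu - U_(i) *+ #|W|] :> P.
  rewrite mpolyXn -mpolyXD; congr 'X_[_]; apply/mnmP => j.
  rewrite mnmDE mnmBE mulmnE mnm1E; case: eqP => [<-|_].
    by rewrite mul1n subnKC.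
  by rewrite mul0n subn0.
have [a [ia ->]] := mpolyX_orbit_power i.
rewrite -scalerA scaler_suml; apply: opsub_sum => // j _.
by rewrite -scalerA; apply: inv_spanZ.
Qed.

Section Irreducible.
Hypothesis irr : mx_irreducible tau.

(** Over an algebraically closed field the group algebra maps onto all matrices
    (Burnside). *)
Lemma irr_transitive (v u : 'cV[C]_d) : v != 0 ->
  exists a : W -> C, u = \sum_w a w *: (tau w *m v).
Proof.
move=> v0; have /mx_abs_irrP[_ [a_ a_G]] := group_closure_closed_field irr.
have [j vj] : exists j, v j 0 != 0.
  apply/existsP; rewrite -negb_forall; apply: contra v0 => /forallP v0.
  by apply/eqP/colP => j; rewrite mxE; apply/eqP.
pose A : 'M[C]_d := u *m ((v j 0)^-1 *: delta_mx 0 j).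
exists (fun w => a_ w A).
transitivity ((\sum_(w in [set: W]) a_ w A *: tau w) *m v); last first.
  by rewrite mulmx_suml; apply: eq_big => [w|w _]; rewrite ?in_setT ?scalemxAl.
rewrite -a_G /A -mulmxA -scalemxAl -rowE.
have -> : (v j 0)^-1 *: row j v = 1%:M.
  by apply/matrixP => x y; rewrite !ord1 !mxE mulVf.
by rewrite mulmx1.
Qed.

(** Some Dunkl derivative of m has a nonzero constant term; irreducibility makes
    every constant the leading term of an element of N, and successive
    approximation ends because vectors of high order lie in N.  So the radical is
    the only maximal submodule above inv_span. *)
Lemma not_rad_full N m : opsub N -> (forall x, inv_span x -> N x) ->
  N m -> ~ vrad m -> forall x, N x.
Proof.
move=> sN IN Nm /existsNP[ys /eqP v0].
have Ny : N (dops ys m) by elim: ys {v0} => //= y ys; apply: opsubH.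
have surj u : exists2 x, N x & ev0 x = u.
  have [a eu] := irr_transitive u v0.
  exists (\sum_w (a w)%:MP *: wa w (dops ys m)).
    by apply: opsub_sum => // w _; apply: opsubZ => //; apply: opsubW.
  by rewrite ev0_sum eu; apply: eq_bigr => w _; rewrite ev0ZC ev0_wact.
have approx k x : exists2 y, N y & ord_ge k (x - y).
  elim: k x => [|k IH] x; first by exists 0; [apply: opsub0|].
  have [y Ny' ey] := surj (ev0 x).
  have [f ef] := cst_plusX (x - y).
  pose g i := projT1 (cid2 (IH (f i))).
  have gN i : N (g i) by rewrite /g; case: cid2.
  have go i : ord_ge k (f i - g i) by rewrite /g; case: cid2.
  exists (y + \sum_i 'X_i *: g i).
    by apply: opsubD => //; apply: opsub_sum => // i _; apply: opsubZ.
  rewrite opprD addrA ef.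
  have -> : ev0 (x - y) = 0.
    by rewrite ev0D -scaleN1r -mpolyC1 -mpolyCN ev0ZC ey scaleN1r subrr.
  rewrite cst0 add0r -sumrB; apply: ord_ge_sum => i _.
  by rewrite -scalerBr; apply/ord_geX/go.
move=> x; have [y Ny' o] := approx (n * #|W|).+1 x.
by rewrite -(subrK y x); apply: opsubD => //; apply/IN/ord_ge_inv_span.
Qed.

End Irreducible.

End RadicalSubmodule.

(** * Interpolation on free orbits and common denominators *)

Section OrbitInterpolation.
Variables (P : idomainType) (W : finGroupType) (act : W -> {rmorphism P -> P}).
Hypothesis act1 : forall p, act 1%g p = p.
Hypothesis actM : forall u v p, act (u * v)%g p = act u (act v p).
Variable f : P.
Hypothesis f_free : forall w, w != 1%g -> act w f != f.

Lemma act_free_inj : injective (fun w => act w f).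
Proof.
move=> u v e; apply/eqP; rewrite -(inj_eq (mulgI v^-1%g)) mulVg eq_sym.
apply: contraT; rewrite eq_sym => /f_free; rewrite actM e -actM mulVg act1.
by rewrite eqxx.
Qed.

(** The polynomial of degree |W| - 1 that vanishes at the conjugates of f other
    than f itself: its coefficients separate 1 from the rest of W. *)
Definition interp : {poly P} := \prod_(u | u != 1%g) ('X - (act u f)%:P).
Definition interp_disc : P := interp.[f].

Lemma size_interp : size interp = #|W|.
Proof.
rewrite /interp -big_filter size_prod_XsubC size_filter.
rewrite -sum1_count.
have -> : (\sum_(u : W | u != 1%g) 1 = #|W|.-1)%N.
  by rewrite -(cardC1 (1%g : W)) -sum1_card.
by rewrite prednK // (cardD1 (1%g : W)).
Qed.

Lemma size_map_interp w : (size (map_poly (act w) interp) <= #|W|)%N.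
Proof. by rewrite -size_interp; apply: size_poly. Qed.

Lemma interp_coefE (x : P) : interp.[x] = \sum_(i < #|W|) interp`_i * x ^+ i.
Proof. by rewrite horner_coef size_interp. Qed.

Lemma interp_disc_neq0 : interp_disc != 0.
Proof.
rewrite /interp_disc /interp horner_prod; apply/prodf_neq0 => u nu.
by rewrite hornerXsubC subr_eq0 eq_sym f_free.
Qed.

Lemma interp_root w : w != 1%g -> interp.[act w f] = 0.
Proof.
by move=> nw; rewrite /interp horner_prod (bigD1 w) //= hornerXsubC subrr mul0r.
Qed.

Lemma map_interp_root w : w != 1%g -> (map_poly (act w) interp).[f] = 0.
Proof.
move=> nw; rewrite /interp rmorph_prod horner_prod (bigD1 w^-1%g) /=; last first.
  by rewrite eq_invg1.
by rewrite map_polyXsubC /= -actM mulgV act1 hornerXsubC subrr mul0r.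
Qed.

End OrbitInterpolation.

Section FreeLinearForm.
Variables (R : realType) (W : finGroupType) (n : nat).
Variable rho : mx_representation R[i] [set: W] n.
Hypothesis faithful : mx_faithful rho.
Local Notation C := R[i].

(** For each w <> 1 the form (1, t, t^2, ...) is moved by w unless t is a root of a
    nonzero polynomial, so all but finitely many t work. *)
Lemma free_linear_form : exists x : 'rV[C]_n,
  forall w, w != 1%g -> pact rho w (sym_hd x) != sym_hd x.
Proof.
pose q w j : {poly C} := \sum_i (rho w - 1%:M) i j *: 'X^i.
have ex w : w != 1%g -> exists j, q w j != 0.
  move=> nw; apply/existsP; apply: contraT; rewrite negb_exists => /forallP q0.
  case/negP: nw; have rw1 : rho w - 1%:M = 0.
    apply/matrixP => i j; rewrite [RHS]mxE.
    have /eqP/polyP/(_ i) := negbNE (q0 j).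
    rewrite coef0 coef_sum (bigD1 i) //= coefZ coefXn eqxx mulr1 big1 ?addr0 // => l nl.
    by rewrite coefZ coefXn eq_sym -[(_ == _ :> nat)]/(l == i) (negPf nl) mulr0.
  have : w \in rker rho.
    by apply/rkerP; split; rewrite ?in_setT //; apply/eqP; rewrite -subr_eq0 rw1.
  by move/(subsetP faithful); rewrite inE.
pose r w := if [pick j | q w j != 0] is Some j then q w j else 1.
have r0 w : r w != 0 by rewrite /r; case: pickP => // _; apply: oner_neq0.
pose Q := \prod_w r w.
have Q0 : Q != 0 by apply/prodf_neq0.
have [t Qt] := closed_nonrootP Q Q0.
exists (\row_i t ^+ i) => w nw; rewrite pact_hd -subr_eq0 -linearB /= sym_hd_eq0.
apply: contra Qt => /eqP e; rewrite /root /Q horner_prod; apply/prodf_eq0.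
exists w^-1%g => //; rewrite /r; case: pickP => [j _|none]; last first.
  have [|j] := ex w^-1%g; first by rewrite eq_invg1.
  by rewrite none.
have {e} : (\row_i t ^+ i *m (rho w^-1%g - 1%:M)) 0 j = 0.
  by rewrite mulmxBr mulmx1 e mxE.
rewrite mxE /q horner_sum => e; apply/eqP; rewrite -[RHS]e; apply: eq_bigr => i _.
by rewrite hornerZ hornerXn mulrC !mxE.
Qed.

End FreeLinearForm.

Section Denominators.
Variables (R : realType) (W : finGroupType) (n : nat).
Variable rho : mx_representation R[i] [set: W] n.
Variables (alpha : W -> 'cV[R[i]]_n) (alphav : W -> 'rV[R[i]]_n).
Hypothesis roots : reflection_roots rho alpha alphav.
Local Notation C := R[i].
Local Notation P := (mpoly.mpoly n C).

(** The g i are the coefficients of interp.  The two identities are Lagrange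
    interpolation for the orbit of f, with the group acting on either factor. *)
Lemma interpolation (faithful : mx_faithful rho) :
  exists f : P, exists g : 'I_#|W| -> P, exists2 Dv : P, Dv != 0 &
  [/\ forall w, \sum_i g i * pact rho w (f ^+ i) = if w == 1%g then Dv else 0,
      forall w, \sum_i pact rho w (g i) * f ^+ i = if w == 1%g then Dv else 0 &
      injective (fun w => pact rho w f)].
Proof.
have [x xfree] := free_linear_form faithful.
pose act w : {rmorphism P -> P} := pact rho w.
have act1 := pact1 rho; have actM := pactM rho.
exists (sym_hd x), (fun i => (interp act (sym_hd x))`_i).
exists (interp_disc act (sym_hd x)); first exact: interp_disc_neq0.
split=> [w|w|]; last exact: (@act_free_inj _ _ act act1 actM _ xfree).
- rewrite (eq_bigr (fun i : 'I_#|W| => (interp act (sym_hd x))`_i * act w (sym_hd x) ^+ i)).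
    rewrite -(interp_coefE act (sym_hd x)); case: eqP => [->|/eqP nw].
      by rewrite /interp_disc; congr (_.[_]); apply: pact1.
    exact: interp_root.
  by move=> i _; rewrite rmorphXn.
- have := @map_interp_root _ _ act act1 actM (sym_hd x) w.
  rewrite (@horner_coef_wide _ #|W|) ?size_map_interp //.
  case: eqP => [-> _|_ /(_ isT) e].
    rewrite /interp_disc interp_coefE; apply: eq_bigr => i _.
    by congr (_ * _); apply: pact1.
  by rewrite -[RHS]e; apply: eq_bigr => i _; rewrite coef_map.
Qed.

(** The norm of the product of all the linear forms alphav s. *)
Lemma common_denominator : exists2 delta : P, delta != 0 &
  (forall w, pact rho w delta = delta) /\
  exists q : W -> P, forall s, s \in reflections rho -> delta = sym_hd (alphav s) * q s.
Proof.
pose ell : P := \prod_(s in reflections rho) sym_hd (alphav s).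
have ell0 : ell != 0.
  by apply/prodf_neq0 => s Ss; rewrite sym_hd_eq0 (alphav_neq0 roots).
exists (\prod_w pact rho w ell).
  by apply/prodf_neq0 => w _; rewrite pact_eq0.
split=> [w|].
  rewrite rmorph_prod [RHS](reindex_inj (mulgI w)); apply: eq_bigr => u _ /=.
  by rewrite pactM.
exists (fun s => (\prod_(t in reflections rho | t != s) sym_hd (alphav t)) *
  \prod_(w : W | w != 1%g) pact rho w ell) => s Ss.
rewrite (bigD1 1%g) //= pact1 mulrA; congr (_ * _).
by rewrite /ell (bigD1 s).
Qed.

End Denominators.

(** * Linear parts of Dunkl operators and commuting endomorphisms *)

(** The coefficient of s in delta D_y, where q s = delta / alphav s. *)
HB.lock Definition coefq (R : realType) (W : finGroupType) (n : nat)
    (rho : mx_representation R[i] [set: W] n) (alphav : W -> 'rV[R[i]]_n)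
    (c : W -> R[i]) (q : W -> mpoly.mpoly n R[i]) (y : 'cV[R[i]]_n) (s : W) :
    mpoly.mpoly n R[i] :=
  (kappa rho c s * (alphav s *m y) 0 0)%:MP * q s.

Lemma mulr_swap_middle (A : comPzRingType) (k a b q k' q' : A) :
  k * a * q * (k' * b * q') = k * b * q * (k' * a * q').
Proof. by ring. Qed.

Section Symbols.
Variables (R : realType) (W : finGroupType) (n : nat).
Variable rho : mx_representation R[i] [set: W] n.
Variables (alpha : W -> 'cV[R[i]]_n) (alphav : W -> 'rV[R[i]]_n).
Hypothesis roots : reflection_roots rho alpha alphav.
Variable c : W -> R[i].
Hypothesis c_inv : conjugation_invariant rho c.
Variables (d : nat) (tau : mx_representation R[i] [set: W] d).
Local Notation C := R[i].
Local Notation P := (mpoly.mpoly n C).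
Local Notation V := (polmod C n d).
Local Notation S := (reflections rho).
Local Notation wa := (wact rho tau).
Local Notation ta := (@tact R W n d tau).
Local Notation D := (dop rho alphav c tau).
Local Notation opsub := (opsub rho alphav c tau).

Lemma pol_scaleC (p q : P) (m : V) : p *: (q *: m) = q *: (p *: m).
Proof. by rewrite [LHS]scalerA [RHS]scalerA; apply: (congr1 (fun r => r *: m)); apply: mulrC. Qed.

Lemma wactN w (m : V) : wa w (- m) = - wa w m.
Proof. by apply/eqP; rewrite -addr_eq0 -wactD addNr wact0. Qed.

Record pol_linear (A : V -> V) : Prop := PolLinear {
  pol_linD : forall m m', A (m + m') = A m + A m';
  pol_linZ : forall p m, A (p *: m) = p *: A m }.

Lemma pol_lin0 A : pol_linear A -> A 0 = 0.
Proof. by move=> lA; rewrite -(scale0r 0) (pol_linZ lA) !scale0r. Qed.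
Lemma pol_linN A m : pol_linear A -> A (- m) = - A m.
Proof. by move=> lA; rewrite -scaleN1r (pol_linZ lA) scaleN1r. Qed.
Lemma pol_lin_sum A I (r : seq I) (Q : pred I) (F : I -> V) : pol_linear A ->
  A (\sum_(i <- r | Q i) F i) = \sum_(i <- r | Q i) A (F i).
Proof.
by move=> lA; apply: (big_morph A) => [u v|]; rewrite ?(pol_linD lA) ?(pol_lin0 lA).
Qed.
Lemma pol_lin_id : pol_linear id. Proof. by []. Qed.
Lemma pol_lin_add A B : pol_linear A -> pol_linear B -> pol_linear (fun m => A m + B m).
Proof.
move=> lA lB; split=> [m m'|p m]; first by rewrite (pol_linD lA) (pol_linD lB) addrACA.
by rewrite (pol_linZ lA) (pol_linZ lB) scalerDr.
Qed.
Lemma pol_lin_scale p A : pol_linear A -> pol_linear (fun m => p *: A m).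
Proof.
move=> lA; split=> [m m'|q m]; first by rewrite (pol_linD lA) scalerDr.
by rewrite (pol_linZ lA) pol_scaleC.
Qed.
Lemma pol_lin_bigsum (I : finType) (Q : pred I) (A : I -> V -> V) :
  (forall i, Q i -> pol_linear (A i)) -> pol_linear (fun m => \sum_(i | Q i) A i m).
Proof.
move=> lA; split=> [m m'|p m].
  by rewrite -big_split; apply: eq_bigr => i Qi; rewrite (pol_linD (lA i Qi)).
by rewrite scaler_sumr; apply: eq_bigr => i Qi; rewrite (pol_linZ (lA i Qi)).
Qed.
Lemma pol_lin_comp A B : pol_linear A -> pol_linear B -> pol_linear (fun m => A (B m)).
Proof.
move=> lA lB; split=> [m m'|p m]; first by rewrite (pol_linD lB) (pol_linD lA).
by rewrite (pol_linZ lB) (pol_linZ lA).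
Qed.
Lemma pol_lin_tact w : pol_linear (ta w).
Proof. by split=> [m m'|p m]; rewrite ?tactD ?tactZ. Qed.

Definition conj_op w (A : V -> V) m := wa w (A (wa w^-1%g m)).

Lemma pol_lin_conj w A : pol_linear A -> pol_linear (conj_op w A).
Proof.
move=> lA; split=> [m m'|p m]; rewrite /conj_op; first by rewrite wactD (pol_linD lA) wactD.
by rewrite wactZ (pol_linZ lA) wactZ pactKV.
Qed.

Lemma wact_conj w A m : wa w (A m) = conj_op w A (wa w m).
Proof. by rewrite /conj_op wactK. Qed.

Variables (f : P) (g : 'I_#|W| -> P) (Dv : P).
Hypothesis Dv0 : Dv != 0.
Hypothesis gf : forall w, \sum_i g i * pact rho w (f ^+ i) = if w == 1%g then Dv else 0.

(** Interpolation against f and the g i: it extracts, up to the factor Dv, the part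
    supported at 1 of a combination of group elements with C[h]-linear
    coefficients. *)
Definition pol_part (T : V -> V) m := \sum_i g i *: T (f ^+ i *: m).

Lemma pol_part_eq T T' m : (forall x, T x = T' x) -> pol_part T m = pol_part T' m.
Proof. by move=> e; apply: eq_bigr => i _; rewrite e. Qed.

Lemma pol_partD T T' m : pol_part (fun m => T m + T' m) m = pol_part T m + pol_part T' m.
Proof. by rewrite /pol_part -big_split; apply: eq_bigr => i _; rewrite scalerDr. Qed.

Lemma pol_part_twist A w m : pol_linear A ->
  pol_part (fun m => A (wa w m)) m = if w == 1%g then Dv *: A m else 0.
Proof.
move=> lA; rewrite /pol_part.
transitivity ((\sum_i g i * pact rho w (f ^+ i)) *: A (wa w m)).
  rewrite scaler_suml; apply: eq_bigr => i _.
  by rewrite wactZ (pol_linZ lA) scalerA.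
by rewrite gf; case: eqP => [->|_]; rewrite ?wact1 ?scale0r.
Qed.

Lemma pol_part_lin A m : pol_linear A -> pol_part A m = Dv *: A m.
Proof.
move=> lA; have := @pol_part_twist A 1%g m lA; rewrite eqxx => <-.
by apply: pol_part_eq => x; rewrite wact1.
Qed.

Lemma pol_part_sum (I : finType) (Q : pred I) (T : I -> V -> V) m :
  pol_part (fun m => \sum_(i | Q i) T i m) m = \sum_(i | Q i) pol_part (T i) m.
Proof.
rewrite /pol_part exchange_big; apply: eq_bigr => i _ /=.
by rewrite scaler_sumr.
Qed.

Variables (delta : P) (q : W -> P).
Hypothesis delta0 : delta != 0.
Hypothesis delta_inv : forall w, pact rho w delta = delta.
Hypothesis delta_q : forall s, s \in S -> delta = sym_hd (alphav s) * q s.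

Local Notation coefq := (coefq rho alphav c q).
(** The Dunkl operator times delta is the difference of the next two operators:
    one that is C[h]-linear, and a combination of reflections. *)
Definition linear_part y m := \sum_(s in S) coefq y s *: ta s m.
Definition group_part y m := \sum_(s in S) coefq y s *: wa s m.

Lemma pol_lin_linear_part y : pol_linear (linear_part y).
Proof. by apply: pol_lin_bigsum => s _; apply/pol_lin_scale/pol_lin_tact. Qed.

Lemma delta_dop y m : delta *: D y m = linear_part y m - group_part y m.
Proof.
rewrite dop.unlock scaler_sumr /linear_part /group_part -sumrB; apply: eq_bigr => s Ss.
rewrite -scalerBr coefq.unlock -[RHS]scalerA pol_scaleC; congr (_ *: _).
have -> : ta s m - wa s m = ta s (m - comap (pact rho s) m).
  by rewrite wact.unlock -[- comap _ _]scaleN1r tactD tactZ scaleN1r.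
rewrite -!tactZ; congr (tact _ _ _); apply: coP => j.
rewrite !coZ co_comap -[- comap _ _]scaleN1r coD coZ co_comap mulN1r.
rewrite (delta_q Ss) -(ddE roots Ss) mulrA; apply: (congr1 (fun r => r * _)).
exact: mulrC.
Qed.

Lemma group_part_conj w y m : wa w (group_part y (wa w^-1%g m)) =
  \sum_(s in S) pact rho w (coefq y s) *: wa (w * s * w^-1)%g m.
Proof.
rewrite /group_part wact_sum; apply: eq_bigr => s _.
by rewrite wactZ -!wactM.
Qed.

Lemma pol_partN T m : pol_part (fun m => - T m) m = - pol_part T m.
Proof. by rewrite /pol_part -sumrN; apply: eq_bigr => i _; rewrite scalerN. Qed.

Lemma pol_part_U A y m : pol_linear A -> pol_part (fun m => A (group_part y m)) m = 0.
Proof.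
move=> lA; rewrite (@pol_part_eq _ (fun m => \sum_(s in S) coefq y s *: A (wa s m))).
  rewrite pol_part_sum big1 // => s Ss.
  rewrite (@pol_part_twist (fun m => coefq y s *: A m)); last exact: pol_lin_scale.
  by case: eqP => // s1; move: Ss (reflections1 rho); rewrite s1 => ->.
by move=> x; rewrite /group_part (pol_lin_sum _ _ _ lA); apply: eq_bigr => s _; rewrite (pol_linZ lA).
Qed.

Lemma pol_part_UA A y m : pol_linear A -> pol_part (fun m => group_part y (A m)) m = 0.
Proof.
move=> lA; rewrite pol_part_sum big1 // => s Ss.
rewrite (@pol_part_eq _ (fun m => coefq y s *: conj_op s A (wa s m))); last first.
  by move=> x; rewrite -wact_conj.
rewrite (@pol_part_twist (fun m => coefq y s *: conj_op s A m)); last exact/pol_lin_scale/pol_lin_conj.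
by case: eqP => // s1; move: Ss (reflections1 rho); rewrite s1 => ->.
Qed.

(** The coefficient of 1 in the product of the reflection parts of y and z comes from
    pairs s, s^-1, and is symmetric in y and z since alphav s and alphav s^-1 are
    proportional. *)
Lemma coefq_sym y z s t : s \in S -> t = s^-1%g ->
  coefq y s * pact rho s (coefq z t) = coefq z s * pact rho s (coefq y t).
Proof.
move=> Ss ->; have [r er] := alphavV roots Ss.
have e x : pact rho s (coefq x s^-1%g) =
    (kappa rho c s^-1%g * r)%:MP * ((alphav s *m x) 0 0)%:MP * pact rho s (q s^-1%g).
  rewrite coefq.unlock rmorphM /= pactC; apply: (congr1 (fun p => p * _)).
  by rewrite er -scalemxAl mxE mulrA mpolyCM.
have e' x : coefq x s = (kappa rho c s)%:MP * ((alphav s *m x) 0 0)%:MP * q s.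
  by rewrite coefq.unlock mpolyCM.
rewrite e e' e e'; exact: mulr_swap_middle.
Qed.

Lemma group_partB y m m' : group_part y (m - m') = group_part y m - group_part y m'.
Proof.
rewrite /group_part -sumrB; apply: eq_bigr => s _.
by rewrite wactD wactN scalerBr.
Qed.

Lemma pol_part_UU y z m : pol_part (fun m => group_part y (group_part z m)) m =
  \sum_(s in S) \sum_(t in S)
    if t == s^-1%g then (coefq y s * pact rho s (coefq z t)) *: (Dv *: m) else 0.
Proof.
rewrite pol_part_sum; apply: eq_bigr => s Ss.
rewrite (@pol_part_eq _ (fun m => \sum_(t in S)
    (coefq y s * pact rho s (coefq z t)) *: wa (s * t)%g m)).
  rewrite pol_part_sum; apply: eq_bigr => t St.
  rewrite (@pol_part_twist (fun m => (coefq y s * pact rho s (coefq z t)) *: m));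
    last exact/pol_lin_scale/pol_lin_id.
  rewrite -eq_invg_mul eq_sym; case: eqP => // _; exact: pol_scaleC.
move=> x; rewrite {1}/group_part wact_sum scaler_sumr; apply: eq_bigr => t _.
by rewrite wactZ -wactM scalerA.
Qed.

(** Take the part supported at 1 in the commutation of the Dunkl operators: mixed
    terms are supported away from 1, and reflection terms are symmetric. *)
Lemma linear_part_comm y z m : linear_part y (linear_part z m) = linear_part z (linear_part y m).
Proof.
have lZ x := pol_lin_linear_part x.
have expand x x' m' : delta *: D x (delta *: D x' m') =
    linear_part x (linear_part x' m') + (- linear_part x (group_part x' m') + (- group_part x (linear_part x' m') + group_part x (group_part x' m'))).
  rewrite delta_dop delta_dop (pol_linD (lZ x)) (pol_linN _ (lZ x)) group_partB.
  by rewrite opprD opprK -!addrA.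
have part x x' : pol_part (fun m => delta *: D x (delta *: D x' m)) m =
    Dv *: linear_part x (linear_part x' m) + pol_part (fun m => group_part x (group_part x' m)) m.
  rewrite (pol_part_eq _ (expand x x')) !pol_partD !pol_partN.
  rewrite (pol_part_lin _ (pol_lin_comp (lZ x) (lZ x'))).
  by rewrite (pol_part_U _ _ (lZ x)) (pol_part_UA _ _ (lZ x')) oppr0 !add0r.
have sym : pol_part (fun m => delta *: D y (delta *: D z m)) m =
           pol_part (fun m => delta *: D z (delta *: D y m)) m.
  apply: pol_part_eq => x; rewrite !(dop_fixed roots) //.
  by rewrite (dopC roots c_inv).
move: sym; rewrite !part !pol_part_UU.
rewrite [X in _ + X = _](_ : _ = \sum_(s in S) \sum_(t in S)
    if t == s^-1%g then (coefq z s * pact rho s (coefq y t)) *: (Dv *: m) else 0).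
  move/addIr => e; apply: subr0_eq; apply: polmod_torsion Dv0.
  by rewrite scalerBr e subrr.
apply: eq_bigr => s Ss; apply: eq_bigr => t _; case: eqP => // e.
by rewrite (coefq_sym y z Ss e).
Qed.

(** Take the part supported at 1 in the equivariance of the Dunkl operators. *)
Lemma linear_part_conj w y m : conj_op w (linear_part y) m = linear_part (rho w *m y) m.
Proof.
have lZ x := pol_lin_linear_part x.
have e x : delta *: D (rho w *m y) x = conj_op w (linear_part y) x - wa w (group_part y (wa w^-1%g x)).
  rewrite -wactN -wactD.
  rewrite -delta_dop wactZ delta_inv (wact_dop roots c_inv) wactKV //.
have e' x : linear_part (rho w *m y) x - group_part (rho w *m y) x =
    conj_op w (linear_part y) x + - wa w (group_part y (wa w^-1%g x)) by rewrite -delta_dop e.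
have : pol_part (fun x => linear_part (rho w *m y) x + - group_part (rho w *m y) x) m =
       pol_part (fun x => conj_op w (linear_part y) x + - wa w (group_part y (wa w^-1%g x))) m.
  exact: pol_part_eq.
rewrite !pol_partD !pol_partN (pol_part_lin _ (lZ _)) (pol_part_lin _ (pol_lin_conj _ (lZ _))).
rewrite (pol_part_U _ _ pol_lin_id) (pol_part_eq _ (group_part_conj w y)) pol_part_sum.
rewrite [X in _ = _ - X]big1 => [|s Ss].
  rewrite !subr0 => ee; apply: subr0_eq; apply: polmod_torsion Dv0.
  by rewrite scalerBr -ee subrr.
rewrite (@pol_part_twist (fun m => pact rho w (coefq y s) *: m)); last exact/pol_lin_scale/pol_lin_id.
case: eqP => // ws1; move: (reflections1 rho); rewrite -ws1 reflectionsJ.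
by rewrite Ss.
Qed.

(** The bicommutant of the linear parts among the C[h]-linear maps.  It is
    commutative because the linear parts commute, and stable under W. *)
Record symbol (A : V -> V) : Prop := Symbol {
  symbol_lin : pol_linear A;
  symbol_comm : forall B, pol_linear B -> (forall y m, B (linear_part y m) = linear_part y (B m)) ->
    forall m, A (B m) = B (A m) }.

Lemma symbol_linear_part y : symbol (linear_part y).
Proof. by split=> [|B lB cB m]; [apply: pol_lin_linear_part|rewrite cB]. Qed.

Lemma symbol_commZ A y m : symbol A -> A (linear_part y m) = linear_part y (A m).
Proof.
by move=> [lA cA]; apply: cA; [apply: pol_lin_linear_part|move=> z x; apply: linear_part_comm].
Qed.

Lemma symbolC A B m : symbol A -> symbol B -> A (B m) = B (A m).
Proof.
move=> [lA cA] sB; apply: cA; first exact: symbol_lin.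
by move=> y x; apply: symbol_commZ.
Qed.

Lemma symbol_id : symbol id.
Proof. by split=> //; apply: pol_lin_id. Qed.

Lemma symbolD A B : symbol A -> symbol B -> symbol (fun m => A m + B m).
Proof.
move=> [lA cA] [lB cB]; split=> [|E lE cE m]; first exact: pol_lin_add.
by rewrite cA // cB // (pol_linD lE).
Qed.

Lemma symbolZ p A : symbol A -> symbol (fun m => p *: A m).
Proof.
move=> [lA cA]; split=> [|E lE cE m]; first exact: pol_lin_scale.
by rewrite cA // (pol_linZ lE).
Qed.

Lemma symbolM A B : symbol A -> symbol B -> symbol (fun m => A (B m)).
Proof.
move=> [lA cA] [lB cB]; split=> [|E lE cE m]; first exact: pol_lin_comp.
by rewrite cB // cA.
Qed.

Lemma symbol_sum (I : finType) (Q : pred I) (A : I -> V -> V) :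
  (forall i, Q i -> symbol (A i)) -> symbol (fun m => \sum_(i | Q i) A i m).
Proof.
move=> sA; split=> [|E lE cE m].
  by apply: pol_lin_bigsum => i Qi; apply: (symbol_lin (sA i Qi)).
rewrite (pol_lin_sum _ _ _ lE); apply: eq_bigr => i Qi.
exact: (symbol_comm (sA i Qi)).
Qed.

Lemma symbol_conj w A : symbol A -> symbol (conj_op w A).
Proof.
move=> [lA cA]; split=> [|B lB cB m]; first exact: pol_lin_conj.
have cB' : forall y x, conj_op w^-1%g B (linear_part y x) = linear_part y (conj_op w^-1%g B x).
  move=> y x; rewrite /conj_op invgK (wact_conj w) linear_part_conj cB wact_conj linear_part_conj mulmxA.
  by rewrite rhoVK mul1mx.
have := cA _ (pol_lin_conj w^-1%g lB) cB' (wa w^-1%g m).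
by rewrite /conj_op invgK wactKV => ->; rewrite wactKV.
Qed.

(** Endomorphisms over the Cherednik algebra, in terms of the operators. *)
Record opendo (phi : V -> V) : Prop := OpEndo {
  opendo_lin : pol_linear phi;
  opendoW : forall w m, phi (wa w m) = wa w (phi m);
  opendoH : forall y m, phi (D y m) = D y (phi m) }.

Definition W_inv (m : V) := forall w, wa w m = m.
Definition generates (v : V) := forall N, opsub N -> N v -> forall m, N m.

(** On W-invariant vectors the reflections in delta D_y can be replaced by
    conjugation of symbols; hence all vectors obtained from v have, up to a power
    of delta, the form A v with A a symbol. *)
Lemma symbol_reach v : W_inv v ->
  opsub (fun u => exists k A, symbol A /\ delta ^+ k *: u = A v).
Proof.
move=> iv; split.
- exists 0%N, (fun=> 0); split; last by rewrite scaler0.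
  split=> [|B lB _ m]; first by split=> [? ?|? ?]; rewrite ?addr0 ?scaler0.
  by rewrite (pol_lin0 lB).
- move=> u u' [k [A [sA e]]] [l [B [sB e']]].
  exists (k + l)%N, (fun m => delta ^+ l *: A m + delta ^+ k *: B m); split.
    by apply: symbolD; apply: symbolZ.
  by rewrite exprD scalerDr -!scalerA [in LHS]pol_scaleC e e'.
- move=> p u [k [A [sA e]]]; exists k, (fun m => p *: A m); split; first exact: symbolZ.
  by rewrite pol_scaleC e.
- move=> w u [k [A [sA e]]]; exists k, (conj_op w A); split; first exact: symbol_conj.
  rewrite -[v in RHS](iv w) -wact_conj -e wactZ rmorphXn /= delta_inv //.
- move=> y u [k [A [sA e]]].
  exists k.+1, (fun m => linear_part y (A m) + (-1) *: \sum_(s in S) coefq y s *: conj_op s A m).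
  split.
    apply: symbolD; first exact/symbolM/sA/symbol_linear_part.
    by apply/symbolZ/symbol_sum => s _; apply/symbolZ/symbol_conj.
  have fixk w : pact rho w (delta ^+ k) = delta ^+ k by rewrite rmorphXn /= delta_inv.
  rewrite exprS -scalerA -(dop_fixed roots _ _ _ _ fixk) e delta_dop scaleN1r; congr (_ - _).
  by apply: eq_bigr => s _; rewrite wact_conj iv.
Qed.

Definition avg (m : V) : V := (#|W|%:R^-1)%:MP *: \sum_w wa w m.

Lemma card_neq0 : (#|W|%:R : C) != 0.
Proof. by rewrite pnatr_eq0 -lt0n; apply/card_gt0P; exists 1%g. Qed.

Lemma avg_inv m : W_inv m -> avg m = m.
Proof.
move=> im; rewrite /avg (eq_bigr (fun=> m)) // sumr_const -[X in _ *: X]scaler_nat scalerA.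
by rewrite -(mpolyC_nat n C #|W|) -mpolyCM mulVf ?card_neq0 // mpolyC1 scale1r.
Qed.

Lemma inv_avg m : W_inv (avg m).
Proof.
move=> w; rewrite /avg wactZ pactC wact_sum; congr (_ *: _).
by rewrite [RHS](reindex_inj (mulgI w)); apply: eq_bigr => u _; rewrite wactM.
Qed.

Lemma avgD m m' : avg (m + m') = avg m + avg m'.
Proof. by rewrite /avg -scalerDr -big_split; congr (_ *: _); apply: eq_bigr => w _; rewrite wactD. Qed.

Lemma avgZ p m : (forall w, pact rho w p = p) -> avg (p *: m) = p *: avg m.
Proof.
move=> ip; rewrite /avg [RHS]pol_scaleC; congr (_ *: _); rewrite scaler_sumr.
by apply: eq_bigr => w _; rewrite wactZ ip.
Qed.

Lemma avg_opsub N m : opsub N -> N m -> N (avg m).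
Proof.
move=> sN Nm; apply: (opsubZ sN).
apply: (opsub_sum _ sN) => w _.
exact: (opsubW sN).
Qed.

Lemma opendo_avg phi m : opendo phi -> phi (avg m) = avg (phi m).
Proof.
move=> [lp pW _]; rewrite /avg (pol_linZ lp) (pol_lin_sum _ _ _ lp).
by congr (_ *: _); apply: eq_bigr => w _; rewrite pW.
Qed.

Lemma opendo_inv phi m : opendo phi -> W_inv m -> W_inv (phi m).
Proof. by move=> ep im w; rewrite -(opendoW ep) im. Qed.

Lemma opendo_eq phi psi v : opendo phi -> opendo psi -> generates v ->
  phi v = psi v -> forall m, phi m = psi m.
Proof.
move=> ep eq gv e; apply: gv => //; split.
- by rewrite (pol_lin0 (opendo_lin ep)) (pol_lin0 (opendo_lin eq)).
- move=> x y ex ey; rewrite (pol_linD (opendo_lin ep)) (pol_linD (opendo_lin eq)).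
  by rewrite ex ey.
- by move=> p x ex; rewrite (pol_linZ (opendo_lin ep)) (pol_linZ (opendo_lin eq)) ex.
- by move=> w x ex; rewrite (opendoW ep) (opendoW eq) ex.
- by move=> y x ex; rewrite (opendoH ep) (opendoH eq) ex.
Qed.

(** Averaging a symbol A with A v = delta^k u gives a symbol that commutes with W,
    hence with delta D_y.  Its values are divisible by delta^k: that is so at v,
    and the vectors where it is so form a submodule. *)
Lemma symbol_endo v u : W_inv v -> generates v -> W_inv u ->
  exists phi, [/\ opendo phi, phi v = u &
    exists k A, symbol A /\ forall m, delta ^+ k *: phi m = A m].
Proof.
move=> iv gv iu; have [k [A0 [sA0 eA0]]] := gv _ (symbol_reach iv) 
  (ex_intro _ 0%N (ex_intro _ id (conj symbol_id (scale1r v)))) u.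
have fixk w : pact rho w (delta ^+ k) = delta ^+ k by rewrite rmorphXn /= delta_inv.
pose A m := (#|W|%:R^-1)%:MP *: \sum_w conj_op w A0 m.
have sA : symbol A by apply/symbolZ/symbol_sum => w _; apply: symbol_conj.
have eA : A v = delta ^+ k *: u.
  rewrite /A (eq_bigr (fun w => wa w (delta ^+ k *: u))); last first.
    by move=> w _; rewrite eA0 wact_conj iv.
  by rewrite -/(avg _) avgZ // avg_inv.
have AW w m : A (wa w m) = wa w (A m).
  rewrite /A wactZ pactC wact_sum; congr (_ *: _).
  rewrite (reindex_inj (mulgI w)); apply: eq_bigr => x _.
  by rewrite /conj_op invMg !wactM wactK.
have lA := symbol_lin sA.
have AH y m : A (D y m) = D y (A m).
  apply: subr0_eq; apply: (polmod_torsion _ delta0); rewrite scalerBr -(pol_linZ lA).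
  rewrite !delta_dop (pol_linD lA) (pol_linN _ lA) symbol_commZ //.
  rewrite /group_part (pol_lin_sum _ _ _ lA) [X in _ + - X - _](eq_bigr (fun s => coefq y s *: wa s (A m))).
    by rewrite subrr.
  by move=> s _; rewrite (pol_linZ lA) AW.
have ex m : exists m', delta ^+ k *: m' = A m.
  apply: (gv (fun m => exists m', delta ^+ k *: m' = A m)); last by exists u; rewrite eA.
  split.
  - by exists 0; rewrite scaler0 (pol_lin0 lA).
  - by move=> x y [x' ex] [y' ey]; exists (x' + y'); rewrite scalerDr ex ey (pol_linD lA).
  - by move=> p x [x' ex]; exists (p *: x'); rewrite pol_scaleC ex (pol_linZ lA).
  - by move=> w x [x' ex]; exists (wa w x'); rewrite AW -ex wactZ fixk.
  - by move=> y x [x' ex]; exists (D y x'); rewrite AH -ex (dop_fixed roots _ _ _ _ fixk).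
pose phi m := projT1 (cid (ex m)).
have ephi m : delta ^+ k *: phi m = A m by rewrite /phi; case: cid.
have dk0 : delta ^+ k != 0 by apply: expf_neq0.
have can_dk (x y : V) : delta ^+ k *: x = delta ^+ k *: y -> x = y.
  by move=> e; apply: subr0_eq; apply: (polmod_torsion _ dk0); rewrite scalerBr e subrr.
exists phi; split; last by exists k, A.
- split; first split.
  + by move=> m m'; apply: can_dk; rewrite scalerDr !ephi (pol_linD lA).
  + by move=> p m; apply: can_dk; rewrite pol_scaleC !ephi (pol_linZ lA).
  + by move=> w m; apply: can_dk; rewrite ephi AW -ephi wactZ fixk.
  + by move=> y m; apply: can_dk; rewrite ephi AH -ephi (dop_fixed roots _ _ _ _ fixk).
- by apply: can_dk; rewrite ephi eA.
Qed.

(** An endomorphism is determined by its value at v, so it is a symbol divided by a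
    power of delta, and symbols commute. *)
Lemma opendo_comm v phi psi : W_inv v -> generates v -> opendo phi -> opendo psi ->
  forall m, phi (psi m) = psi (phi m).
Proof.
move=> iv gv ep eq m.
have [phi' [ep' e [k [A [sA eA]]]]] := symbol_endo iv gv (opendo_inv ep iv).
have [psi' [eq' e' [l [B [sB eB]]]]] := symbol_endo iv gv (opendo_inv eq iv).
have {}eA x : delta ^+ k *: phi x = A x by rewrite -eA (opendo_eq ep' ep gv e).
have {}eB x : delta ^+ l *: psi x = B x by rewrite -eB (opendo_eq eq' eq gv e').
apply: subr0_eq; apply: (polmod_torsion (p := delta ^+ k * delta ^+ l)).
  have e1 : (delta ^+ k * delta ^+ l) *: phi (psi m) = A (B m).
    by rewrite -scalerA -(pol_linZ (opendo_lin ep)) eB eA.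
  have e2 : (delta ^+ k * delta ^+ l) *: psi (phi m) = B (A m).
    by rewrite -scalerA pol_scaleC -(pol_linZ (opendo_lin eq)) eA eB.
  by rewrite scalerBr e1 e2 (symbolC m sA sB) subrr.
by rewrite mulf_neq0 ?expf_neq0.
Qed.

End Symbols.

(** * Homogeneous endomorphisms *)

Section Endomorphisms.
Variables (R : realType) (W : finGroupType) (n : nat).
Variable rho : mx_representation R[i] [set: W] n.
Variables (alpha : W -> 'cV[R[i]]_n) (alphav : W -> 'rV[R[i]]_n).
Hypothesis roots : reflection_roots rho alpha alphav.
Variable c : W -> R[i].
Hypothesis c_inv : conjugation_invariant rho c.
Variables (d : nat) (tau : mx_representation R[i] [set: W] d).
Hypothesis faithful : mx_faithful rho.
Hypothesis irr : mx_irreducible tau.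
Local Notation C := R[i].
Local Notation P := (mpoly.mpoly n C).
Local Notation V := (polmod C n d).
Local Notation cst := (@cst C n d).
Local Notation wa := (wact rho tau).
Local Notation D := (dop rho alphav c tau).
Local Notation opsub := (opsub rho alphav c tau).
Local Notation vrad := (vrad rho alphav c tau).
Local Notation opendo := (opendo rho alphav c tau).
Local Notation W_inv := (W_inv rho tau).
Local Notation avg := (avg rho tau).
Local Notation generates := (generates rho alphav c tau).
Local Notation inv_span := (@inv_span R W n rho d).
Local Notation J_opsub := (rad_opsub roots c_inv tau).

Lemma endo_exists v u : W_inv v -> generates v -> W_inv u ->
  exists phi, opendo phi /\ phi v = u.
Proof.
move=> iv gv iu.
have [f [g [Dv Dv0 [gf _ _]]]] := interpolation faithful.
have [delta delta0 [delta_inv [q delta_q]]] := common_denominator roots.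
have [phi [ep e _]] := symbol_endo roots c_inv Dv0 gf delta0 delta_inv delta_q iv gv iu.
by exists phi.
Qed.

Lemma endo_comm v phi psi : W_inv v -> generates v -> opendo phi -> opendo psi ->
  forall m, phi (psi m) = psi (phi m).
Proof.
have [f [g [Dv Dv0 [gf _ _]]]] := interpolation faithful.
have [delta delta0 [delta_inv [q delta_q]]] := common_denominator roots.
exact: (opendo_comm roots c_inv Dv0 gf delta0 delta_inv delta_q).
Qed.

(** The interpolation identity recovers Dv m from the averages of the g i m. *)
Lemma orbit_expansion (f : P) (g : 'I_#|W| -> P) (Dv : P) :
  (forall w, \sum_i pact rho w (g i) * f ^+ i = if w == 1%g then Dv else 0) ->
  forall m : V, Dv *: m = \sum_(i < #|W|) f ^+ i *: ((#|W|%:R)%:MP *: avg (g i *: m)).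
Proof.
move=> fg m; transitivity (\sum_w (\sum_i pact rho w (g i) * f ^+ i) *: wa w m).
  rewrite (bigD1 1%g) //= fg eqxx wact1 big1 ?addr0 // => w nw.
  by rewrite fg (negPf nw) scale0r.
under eq_bigr => w _ do rewrite scaler_suml.
rewrite exchange_big; apply: eq_bigr => i _ /=.
rewrite /avg [X in _ = _ *: X]scalerA -mpolyCM mulfV ?card_neq0 // mpolyC1 scale1r.
rewrite scaler_sumr; apply: eq_bigr => w _.
rewrite wactZ scalerA; apply: (congr1 (fun p => p *: _)); exact: mulrC.
Qed.

(** Applying W turns a relation into the vanishing of a polynomial of degree less
    than |W| at the |W| distinct conjugates of f. *)
Lemma orbit_independent (f : P) (u : 'I_#|W| -> V) : injective (fun w => pact rho w f) ->
  (forall i, W_inv (u i)) -> \sum_(i < #|W|) f ^+ i *: u i = 0 -> forall i, u i = 0.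
Proof.
move=> finj iu e i; apply: coP => j; rewrite co0.
have ew w : \sum_(i < #|W|) pact rho w f ^+ i *: u i = 0.
  transitivity (wa w (\sum_(i < #|W|) f ^+ i *: u i)); last by rewrite e wact0.
  rewrite wact_sum; apply: eq_bigr => l _; rewrite wactZ iu.
  by apply: (congr1 (fun p => p *: _)); rewrite rmorphXn.
pose Q := \poly_(l < #|W|) (if insub l is Some l' then co (u l') j else 0).
have Q0 : Q = 0.
  have [//|Qn0] := eqVneq Q 0; exfalso.
  have := @max_poly_roots _ Q [seq pact rho w f | w <- enum W] Qn0.
  rewrite map_inj_uniq // enum_uniq size_map -cardE => /(_ _ isT).
  have -> : all (root Q) [seq pact rho w f | w <- enum W].
    apply/allP => x /mapP[w _ ->]; rewrite /root horner_poly; apply/eqP.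
    rewrite -[RHS](co0 C n j) -(ew w) co_sum; apply: eq_bigr => l _.
    rewrite coZ valK mulrC //.
  by move/(_ isT); rewrite ltnNge size_poly.
have := congr1 (fun p : {poly P} => p`_i) Q0.
by rewrite coef_poly ltn_ord valK coef0.
Qed.

Lemma inv_exists : exists2 u : V, W_inv u & u <> 0.
Proof.
have [f [g [Dv Dv0 [_ fg _]]]] := interpolation faithful.
have d0 : (0 < d)%N by case/mx_irrP: irr.
pose m : V := cst (delta_mx (Ordinal d0) 0).
have m0 : Dv *: m <> 0.
  move=> /polmod_torsion /(_ Dv0) /(congr1 (@ev0 C n d)); rewrite ev0_cst ev0_0.
  move/colP => /(_ (Ordinal d0)); rewrite !mxE !eqxx => /eqP.
  by rewrite oner_eq0.
have [i ui] : exists i, avg (g i *: m) <> 0.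
  apply/existsNP => all0; apply: m0; rewrite (orbit_expansion fg) big1 // => i _.
  by rewrite all0 !scaler0.
by exists (avg (g i *: m)) => //; apply: inv_avg.
Qed.

Lemma mpoly_plusX (p : P) : exists q : 'I_n -> P, p = (p@_0%MM)%:MP + \sum_i 'X_i * q i.
Proof.
elim/mpoly_ring_ind: p => [a|p p' [q eq] [q' eq']|i p _].
- by exists (fun=> 0); rewrite mpolyCK big1 ?addr0 // => i _; rewrite mulr0.
- exists (fun i => q i + q' i); rewrite mcoeffD mpolyCD.
  rewrite [LHS](congr2 +%R eq eq') addrACA; apply: (congr1 (fun z => _ + z)).
  by rewrite -big_split; apply: eq_bigr => i _; rewrite mulrDr.
- exists (fun j => if j == i then p else 0).
  rewrite rmorphM /= mcoeffX mnm1_eq0 mul0r mpolyC0 add0r (bigD1 i) //= eqxx big1 ?addr0 //.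
  by move=> j /negPf ->; rewrite mulr0.
Qed.

Lemma ord_geZ k p (m : V) : ord_ge k m -> ord_ge k (p *: m).
Proof.
elim/mpoly_ring_ind: p m => [a m o j lt|p p' IH IH' m o|i p IH m o].
- by rewrite vcompZC o ?scaler0.
- by rewrite scalerDl; apply: ord_geD; [apply: IH|apply: IH'].
- rewrite -scalerA => j lt; apply: (ord_geX i (IH m o)); exact: leqW.
Qed.

Lemma ord_geZ0 k p (m : V) : p@_0%MM = 0 -> ord_ge k m -> ord_ge k.+1 (p *: m).
Proof.
move=> p0 o; have [q eq] := mpoly_plusX p; rewrite eq p0 mpolyC0 add0r scaler_suml.
by apply: ord_ge_sum => i _; rewrite -scalerA; apply/ord_geX/ord_geZ.
Qed.

Lemma polmod_eq0 (m : V) : (forall k, vcomp k m = 0) -> m = 0.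
Proof.
move=> m0; have [N /(_ N (leqnn _))[-> _]] := vcomp_bound m.
by apply: big1 => k _; apply: m0.
Qed.

(** An invariant of inv_span is a combination of invariant vectors with
    coefficients of positive degree, so an invariant vector of least order lies
    outside. *)
Lemma inv_not_span : exists2 u : V, W_inv u & ~ inv_span u.
Proof.
have [u iu u0] := inv_exists.
pose Q k := `[< exists2 u : V, W_inv u & vcomp k u <> 0 >].
have exQ : exists k, Q k.
  have [k uk] : exists k, vcomp k u <> 0.
    by apply/existsNP => all0; apply: u0; apply: polmod_eq0.
  by exists k; apply/asboolP; exists u.
case: (ex_minnP exQ) => k /asboolP[x ix xk] kmin.
have ordk y : W_inv y -> ord_ge k y.
  move=> iy j lt; apply/eqP; apply: contraLR lt => /eqP yj; rewrite -leqNgt.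
  by apply: kmin; apply/asboolP; exists y.
exists x => // Ix; apply: xk.
rewrite -(avg_inv ix).
have : ord_ge k.+1 (avg x).
  elim: Ix => [|p m m' [pW p0] _ IH].
    by rewrite /avg big1 ?scaler0 => [|w _]; [apply: ord_ge0|rewrite wact0].
  rewrite avgD; apply: ord_geD => //; rewrite avgZ //.
  by apply: ord_geZ0 => //; apply/ordk/inv_avg.
by apply.
Qed.

Definition homogeneous k (m : V) := vcomp k m = m.

Lemma homog_vcomp k m : homogeneous k (vcomp k m).
Proof. by rewrite /homogeneous vcomp_vcomp eqxx. Qed.

Lemma homog_vcompE k l m : homogeneous k m -> vcomp l m = if l == k then m else 0.
Proof. by move=> hm; rewrite -hm vcomp_vcomp hm. Qed.

(** The submodule generated by v is graded; some Dunkl derivative of v has a nonzero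
    constant term, which is then itself in the submodule and generates M. *)
Lemma homog_generates k v : homogeneous k v -> ~ vrad v -> generates v.
Proof.
move=> hv nJv N sN Nv.
pose G m := forall N, opsub N -> N v -> N m.
have sG : opsub G.
  split.
  - by move=> N' sN' _; apply: opsub0 sN'.
  - by move=> x y Gx Gy N' sN' Nv'; apply: (opsubD sN'); [apply: Gx|apply: Gy].
  - by move=> p x Gx N' sN' Nv'; apply: (opsubZ sN'); apply: Gx.
  - by move=> w x Gx N' sN' Nv'; apply: (opsubW sN'); apply: Gx.
  - by move=> y x Gx N' sN' Nv'; apply: (opsubH sN'); apply: Gx.
have gG m : G m -> forall j, G (vcomp j m).
  move=> Gm; apply: (Gm (fun m => forall j, G (vcomp j m))); last first.
    by move=> j; rewrite (homog_vcompE _ hv); case: eqP => // _; [move=> ? _|apply: (opsub0 sG)].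
  split.
  - by move=> j; rewrite vcomp0; apply: (opsub0 sG).
  - by move=> x y Gx Gy j; rewrite vcompD; apply: (opsubD sG).
  - move=> p; elim/mpoly_ring_ind: p => [a|p p' IH IH'|i p IH] x Gx j.
    + by rewrite vcompZC; apply: (opsubZ sG).
    + by rewrite scalerDl vcompD; apply: (opsubD sG); [apply: IH|apply: IH'].
    + rewrite -scalerA vcompX; case: j => [|j]; first exact: (opsub0 sG).
      by apply: (opsubZ sG); apply: IH.
  - by move=> w x Gx j; rewrite vcomp_wact; apply: (opsubW sG).
  - by move=> y x Gx j; rewrite (vcomp_dop roots); apply: (opsubH sG).
suff allG m : G m by move=> m; apply: allG.
have /existsNP[ys /eqP v0] := nJv.
have Gy : G (dops rho alphav c tau ys v).
  by elim: ys {v0} => [|y ys IH] /=; [move=> ? _|apply: (opsubH sG)].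
elim/cst_ind: m => [u|m m' Gm Gm'|i m Gm].
- have [a ->] := irr_transitive irr u v0.
  rewrite cst_sum; apply: (opsub_sum _ sG) => w _; rewrite cstZ -(wact_cst rho).
  apply: (opsubZ sG); apply: (opsubW sG). rewrite -vcomp0E; exact: gG.
- exact: (opsubD sG).
- exact: (opsubZ sG).
Qed.

Lemma rad_sum_vcomp m : (forall k, vrad (vcomp k m)) -> vrad m.
Proof.
move=> Jm; have [N /(_ N (leqnn _))[-> _]] := vcomp_bound m.
by apply: (opsub_sum _ J_opsub).
Qed.

(* steps on endomorphisms *)

(** The image is a submodule without constant terms. *)
Lemma opendo_ev0 phi : opendo phi -> (forall u, ev0 (phi (cst u)) = 0) ->
  forall m, vrad (phi m).
Proof.
move=> [lp pW pH] p0.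
have ev m : ev0 (phi m) = 0.
  elim/cst_ind: m => [u|m m' e e'|i m e] //.
    by rewrite (pol_linD lp) ev0D e e' addr0.
  by rewrite (pol_linZ lp) ev0X.
have sN : opsub (fun y => exists x, y = phi x).
  split.
  - by exists 0; rewrite (pol_lin0 lp).
  - by move=> _ _ [x ->] [y ->]; exists (x + y); rewrite (pol_linD lp).
  - by move=> p _ [x ->]; exists (p *: x); rewrite (pol_linZ lp).
  - by move=> w _ [x ->]; exists (wa w x); rewrite pW.
  - by move=> y _ [x ->]; exists (D y x); rewrite pH.
move=> m; apply: (rad_max sN); last by exists m.
by move=> _ [x ->].
Qed.

Lemma opendoB phi a : opendo phi -> opendo (fun m => phi m + a%:MP *: m).
Proof.
move=> [lp pW pH]; split.
- by apply: pol_lin_add => //; apply/pol_lin_scale/pol_lin_id.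
- by move=> w m; rewrite pW wactD wactZ pactC.
- by move=> y m; rewrite pH (dopD roots) (dopZC roots).
Qed.

(** On constant terms phi induces an endomorphism of the irreducible
    representation tau, that is, a scalar. *)
Lemma opendo_schur phi : opendo phi -> exists a, forall m, vrad (phi m + a%:MP *: m).
Proof.
move=> ep; have [lp pW pH] := ep.
pose A : 'M[C]_d := \matrix_(i, j) ev0 (phi (cst (delta_mx j 0))) i 0.
have eA u : ev0 (phi (cst u)) = A *m u.
  have -> : cst u = \sum_j (u j 0)%:MP *: cst (delta_mx j 0).
    rewrite [LHS]polmod_basis; apply: eq_bigr => j _.
    by rewrite co_cst.
  rewrite (pol_lin_sum _ _ _ lp) ev0_sum; apply/colP => i; rewrite summxE mxE.
  by apply: eq_bigr => j _; rewrite (pol_linZ lp) ev0ZC !mxE mulrC.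
have cA : centgmx tau A.
  apply/centgmxP => w _; apply/matrixP => i j.
  have e : A *m (tau w *m (delta_mx j 0 : 'cV[C]_d)) = tau w *m (A *m delta_mx j 0).
    by rewrite -!eA -(ev0_wact rho) -pW wact_cst.
  have := congr1 (fun M : 'cV_d => M i 0) e.
  by rewrite !mulmxA -!colE !mxE.
have /is_scalar_mxP[a ea] := mx_abs_irr_cent_scalar (group_closure_closed_field irr) cA.
exists (- a); apply: (opendo_ev0 (opendoB (- a) ep)) => u.
by rewrite ev0D ev0ZC eA ea ev0_cst mul_scalar_mx scaleNr subrr.
Qed.

(** The endomorphisms that act by 0 on the simple head. *)
Definition rad_endo phi := opendo phi /\ forall m, vrad (phi m).

Inductive rad_span : V -> Prop :=
| rad_span0 : rad_span 0
| rad_spanD phi x y : rad_endo phi -> rad_span y -> rad_span (phi x + y).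

Lemma rad_span_opsub : opsub rad_span.
Proof.
split; first exact: rad_span0.
- move=> x y + Sy; elim=> [|phi z z' ep _ IH]; first by rewrite add0r.
  by rewrite -addrA; apply: rad_spanD.
- move=> p x; elim=> [|phi z z' ep _ IH]; first by rewrite scaler0; apply: rad_span0.
  by rewrite scalerDr -(pol_linZ (opendo_lin (proj1 ep))); apply: rad_spanD.
- move=> w x; elim=> [|phi z z' ep _ IH]; first by rewrite wact0; apply: rad_span0.
  by rewrite wactD -(opendoW (proj1 ep)); apply: rad_spanD.
- move=> y x; elim=> [|phi z z' ep _ IH]; first by rewrite (dop0 roots); apply: rad_span0.
  by rewrite (dopD roots) -(opendoH (proj1 ep)); apply: rad_spanD.
Qed.

Lemma inv_span_rad_span m : inv_span m -> rad_span m.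
Proof.
elim=> [|p x x' [pW p0] _ IH]; first exact: rad_span0.
apply: rad_spanD IH; split; last first.
  by move=> y; apply: (inv_span_rad roots c tau); apply: inv_spanZ.
split; first exact/pol_lin_scale/pol_lin_id.
- by move=> w y; rewrite wactZ pW.
- by move=> y z; rewrite (dop_fixed roots).
Qed.

(** The component of degree k of phi, defined on the basis of constant vectors. *)
Definition endo_comp phi k (m : V) : V :=
  \sum_j co m j *: vcomp k (phi (cst (delta_mx j 0))).

Lemma endo_comp_lin phi k : pol_linear (endo_comp phi k).
Proof.
split=> [m m'|p m]; rewrite /endo_comp.
  by rewrite -big_split; apply: eq_bigr => j _; rewrite coD scalerDl.
by rewrite scaler_sumr; apply: eq_bigr => j _; rewrite coZ scalerA.
Qed.

Lemma endo_comp_vcomp phi k l m : opendo phi ->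
  endo_comp phi k (vcomp l m) = vcomp (k + l) (phi (vcomp l m)).
Proof.
move=> ep; have lp := opendo_lin ep; have lc := endo_comp_lin phi k.
elim/cst_ind: m l => [u|m m' IH IH'|i m IH] l.
- rewrite vcomp_cst; case: eqP => [->|_]; last by rewrite (pol_lin0 lc) (pol_lin0 lp) vcomp0.
  rewrite addn0 {2}[cst u]polmod_basis (pol_lin_sum _ _ _ lp) vcomp_sum.
  by apply: eq_bigr => j _; rewrite co_cst (pol_linZ lp) vcompZC.
- by rewrite !vcompD (pol_linD lc) (pol_linD lp) vcompD IH IH'.
- rewrite vcompX; case: l => [|l]; first by rewrite (pol_lin0 lc) (pol_lin0 lp) vcomp0.
  by rewrite (pol_linZ lc) (pol_linZ lp) addnS vcompX IH.
Qed.

Lemma pol_lin_vcomp_ext (F G : V -> V) : (forall m m', F (m + m') = F m + F m') ->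
  (forall m m', G (m + m') = G m + G m') ->
  (forall l m, F (vcomp l m) = G (vcomp l m)) -> forall m, F m = G m.
Proof.
move=> FD GD e m; have [N /(_ N (leqnn _))[-> _]] := vcomp_bound m.
have F0 : F 0 = 0 by apply: (addrI (F 0)); rewrite -FD !addr0.
have G0 : G 0 = 0 by apply: (addrI (G 0)); rewrite -GD !addr0.
elim/big_rec: _ => [|k x _ ex]; first by rewrite F0 G0.
by rewrite FD GD ex e.
Qed.

(** Dunkl operators lower degrees by 1 and W preserves them, so each homogeneous
    component of an endomorphism is again an endomorphism. *)
Lemma endo_comp_opendo phi k : opendo phi -> opendo (endo_comp phi k).
Proof.
move=> ep; have [lp pW pH] := ep; have lc := endo_comp_lin phi k.
split=> // [w|y].
  apply: pol_lin_vcomp_ext => [m m'|m m'|l m].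
  - by rewrite wactD (pol_linD lc).
  - by rewrite (pol_linD lc) wactD.
  - by rewrite -vcomp_wact !endo_comp_vcomp // vcomp_wact pW vcomp_wact.
apply: pol_lin_vcomp_ext => [m m'|m m'|l m].
- by rewrite (dopD roots) (pol_linD lc).
- by rewrite (pol_linD lc) (dopD roots).
case: l => [|l].
  rewrite {1}vcomp0E (dop_cst roots) (pol_lin0 lc) endo_comp_vcomp // addn0.
  have e : D y (phi (vcomp 0 m)) = 0.
    by rewrite -pH vcomp0E (dop_cst roots) (pol_lin0 lp).
  case: k {lc} => [|k]; first by rewrite vcomp0E (dop_cst roots).
  by rewrite -(vcomp_dop roots) e vcomp0.
rewrite -(vcomp_dop roots) !endo_comp_vcomp // addnS -(vcomp_dop roots).
by rewrite -pH -(vcomp_dop roots).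
Qed.

(** Endomorphisms are C[h]-linear and the coordinates of the images of constants
    have nonnegative degree, so no degree decreases. *)
Lemma opendo_ord phi l m j : opendo phi -> (j < l)%N -> vcomp j (phi (vcomp l m)) = 0.
Proof.
move=> ep; have lp := opendo_lin ep.
elim/cst_ind: m l j => [u|m m' IH IH'|i m IH] l j lt.
- rewrite vcomp_cst; case: eqP lt => [->|] //.
  by rewrite (pol_lin0 lp) vcomp0.
- by rewrite vcompD (pol_linD lp) vcompD IH // IH' // addr0.
- case: l lt => // l lt; rewrite vcompX (pol_linZ lp) vcompX.
  by case: j lt => // j lt; rewrite IH ?scaler0.
Qed.

Lemma vcomp_opendo phi k m : opendo phi ->
  vcomp k (phi m) = \sum_(l < k.+1) endo_comp phi (k - l) (vcomp l m).
Proof.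
move=> ep; have lp := opendo_lin ep.
apply: (pol_lin_vcomp_ext (F := fun m => vcomp k (phi m))
  (G := fun m => \sum_(l < k.+1) endo_comp phi (k - l) (vcomp l m))) => {m}.
- by move=> m m'; rewrite (pol_linD lp) vcompD.
- move=> m m'; rewrite -big_split; apply: eq_bigr => l _.
  by rewrite vcompD (pol_linD (endo_comp_lin _ _)).
move=> j m; have [le|lt] := leqP j k; last first.
  rewrite opendo_ord // big1 // => l _; rewrite vcomp_vcomp.
  case: eqP => [e|_]; last by rewrite (pol_lin0 (endo_comp_lin _ _)).
  by move: (ltn_ord l); rewrite e ltnS leqNgt lt.
rewrite (bigD1 (Ordinal (leq_ltn_trans le (ltnSn k)))) //= vcomp_vcomp eqxx.
rewrite endo_comp_vcomp // subnK // big1 ?addr0 // => l nl.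
rewrite vcomp_vcomp; case: eqP => [e|_]; last by rewrite (pol_lin0 (endo_comp_lin _ _)).
by case/eqP: nl; apply: val_inj.
Qed.

Lemma rad_endo_comp0 phi m : rad_endo phi -> endo_comp phi 0 m = 0.
Proof.
move=> [ep Jp]; rewrite /endo_comp big1 // => j _.
by rewrite vcomp0E (Jp _ [::]) cst0 scaler0.
Qed.

(** An endomorphism with image in the radical has no component of degree 0. *)
Lemma rad_endo_ord phi k m : rad_endo phi -> ord_ge k m -> ord_ge k.+1 (phi m).
Proof.
move=> rp o j lt; rewrite (vcomp_opendo _ _ (proj1 rp)) big1 // => l _.
have [ltl|le] := ltnP l k.
  by rewrite o // (pol_lin0 (endo_comp_lin _ _)).
have -> : (j - l = 0)%N by apply/eqP; rewrite subn_eq0; apply: leq_trans le; rewrite -ltnS.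
exact: rad_endo_comp0.
Qed.

End Endomorphisms.

(** * Independence over the endomorphism ring *)

Section EndoIndependence.
Variables (R : realType) (W : finGroupType) (n : nat).
Variable rho : mx_representation R[i] [set: W] n.
Variables (alpha : W -> 'cV[R[i]]_n) (alphav : W -> 'rV[R[i]]_n).
Hypothesis roots : reflection_roots rho alpha alphav.
Variable c : W -> R[i].
Hypothesis c_inv : conjugation_invariant rho c.
Variables (d : nat) (tau : mx_representation R[i] [set: W] d).
Hypothesis faithful : mx_faithful rho.
Hypothesis irr : mx_irreducible tau.
Local Notation C := R[i].
Local Notation V := (polmod C n d).
Local Notation wa := (wact rho tau).
Local Notation D := (dop rho alphav c tau).
Local Notation opsub := (opsub rho alphav c tau).
Local Notation vrad := (vrad rho alphav c tau).
Local Notation opendo := (opendo rho alphav c tau).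
Local Notation W_inv := (W_inv rho tau).
Local Notation avg := (avg rho tau).
Local Notation generates := (generates rho alphav c tau).
Local Notation inv_span := (@inv_span R W n rho d).
Local Notation J_opsub := (rad_opsub roots c_inv tau).
Local Notation rad_span := (rad_span rho alphav c tau).
Local Notation rad_endo := (rad_endo rho alphav c tau).

Hypothesis avg_rad_all : forall (N T : V -> Prop) u, opsub N -> (forall x, inv_span x -> N x) ->
  ~ N u -> opsub T -> T u -> (forall x, T x -> N (avg x)) -> forall m, vrad (avg m).
Hypothesis avg_span_all : (forall m, vrad (avg m)) -> forall m, inv_span (avg m).

(** An invariant vector outside inv_span exists, so averaging does not map M into
    the radical; the radical is graded, which allows v to be homogeneous. *)
Lemma spherical_vector : exists k v,
  [/\ homogeneous k v, W_inv v & ~ vrad v].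
Proof.
have [u iu nIu] := inv_not_span faithful irr.
have /existsNP[m Jm] : ~ forall m, vrad (avg m).
  by move=> /avg_span_all /(_ u); rewrite avg_inv.
have [k nJ] : exists k, ~ vrad (vcomp k (avg m)).
  by apply/existsNP => Jk; apply: Jm; apply: (rad_sum_vcomp roots c_inv Jk).
exists k, (vcomp k (avg m)); split=> //; first exact: homog_vcomp.
by move=> w; rewrite -vcomp_wact inv_avg.
Qed.

Section WithVector.
Variables (k0 : nat) (v : V).
Hypothesis hv : homogeneous k0 v.
Hypothesis iv : W_inv v.
Hypothesis nJv : ~ vrad v.

Let gv : generates v := homog_generates roots irr hv nJv.

Lemma radZN a m : vrad (a%:MP *: m) -> a != 0 -> vrad m.
Proof.
move=> Jm a0; have := opsubZ J_opsub (a^-1)%:MP Jm.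
by rewrite scalerA -mpolyCM mulVf // mpolyC1 scale1r.
Qed.

(** Otherwise averaging would map M into the radical: the invariants of the radical
    are the phi v with phi in E, and such a phi has image in the radical by
    Schur's lemma, so averaging maps the radical into rad_span. *)
Lemma rad_in_span m : vrad m -> rad_span m.
Proof.
move=> Jm; apply: contrapT => nSm.
have sS := rad_span_opsub roots c tau.
have all : forall m, vrad (avg m).
  apply: (avg_rad_all sS (inv_span_rad_span roots c tau) nSm J_opsub Jm).
  move=> x Jx; have [phi [ep e]] := endo_exists roots c_inv faithful iv gv (inv_avg rho tau x).
  rewrite -e; have [a Ja] := opendo_schur roots irr ep.
  have a0 : a = 0.
    apply/eqP; apply: contraT => a0; case: nJv; apply: (radZN _ a0).
    have -> : a%:MP *: v = (phi v + a%:MP *: v) - phi v by rewrite addrAC subrr add0r.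
    apply: (opsubB J_opsub (Ja v)); rewrite e.
    exact: (avg_opsub J_opsub).
  rewrite -[phi v]addr0; apply: rad_spanD; last exact: rad_span0.
  split=> // y; have := Ja y; by rewrite a0 mpolyC0 scale0r addr0.
by apply: nJv; rewrite -(avg_inv iv).
Qed.

(** The operators by which the elements of the Cherednik algebra act. *)
Inductive oper : (V -> V) -> Prop :=
| oper_id : oper id
| operD h h' : oper h -> oper h' -> oper (fun m => h m + h' m)
| operZ p h : oper h -> oper (fun m => p *: h m)
| operW w h : oper h -> oper (fun m => wa w (h m))
| operH y h : oper h -> oper (fun m => D y (h m)).

Lemma oper_D h m m' : oper h -> h (m + m') = h m + h m'.
Proof.
elim=> [|h1 h2 _ IH1 _ IH2|p h' _ IH|w h' _ IH|y h' _ IH] //.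
- by rewrite IH1 IH2 addrACA.
- by rewrite IH scalerDr.
- by rewrite IH wactD.
- by rewrite IH (dopD roots).
Qed.

Lemma oper_ZC h a m : oper h -> h (a%:MP *: m) = a%:MP *: h m.
Proof.
elim=> [|h1 h2 _ IH1 _ IH2|p h' _ IH|w h' _ IH|y h' _ IH] //.
- by rewrite IH1 IH2 scalerDr.
- by rewrite IH pol_scaleC.
- by rewrite IH wactZ pactC.
- by rewrite IH (dopZC roots).
Qed.

Lemma oper0 h : oper h -> h 0 = 0.
Proof. by move=> oh; have := oper_ZC 0 0 oh; rewrite mpolyC0 !scale0r. Qed.

Lemma oper_sum h I (r : seq I) (Q : pred I) (F : I -> V) : oper h ->
  h (\sum_(i <- r | Q i) F i) = \sum_(i <- r | Q i) h (F i).
Proof.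
by move=> oh; apply: (big_morph h) => [x y|]; rewrite ?oper_D ?oper0.
Qed.

Lemma opendo_oper phi h m : opendo phi -> oper h -> phi (h m) = h (phi m).
Proof.
move=> [lp pW pH]; elim=> [|h1 h2 _ IH1 _ IH2|p h' _ IH|w h' _ IH|y h' _ IH] //.
- by rewrite (pol_linD lp) IH1 IH2.
- by rewrite (pol_linZ lp) IH.
- by rewrite pW IH.
- by rewrite pH IH.
Qed.

(** If m were outside the radical, m would generate M modulo inv_span, and the
    invariant vector v would lie in the radical. *)
Lemma avg_oper_rad m : (forall h, oper h -> vrad (avg (h m))) -> vrad m.
Proof.
move=> Jh; apply: contrapT => nJm.
have sI := inv_span_opsub roots c tau.
pose N x := exists h z, [/\ oper h, inv_span z & x = h m + z].
have sN : opsub N.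
  split.
  - exists (fun x => 0 *: id x), 0; split; rewrite ?scale0r ?addr0 //.
      exact/operZ/oper_id.
    exact: inv_span0.
  - move=> _ _ [h [z [oh Iz ->]]] [h' [z' [oh' Iz' ->]]].
    exists (fun x => h x + h' x), (z + z'); split; first exact: operD.
      exact: (opsubD sI).
    by rewrite addrACA.
  - move=> p _ [h [z [oh Iz ->]]]; exists (fun x => p *: h x), (p *: z).
    by split; [apply: operZ|apply: (opsubZ sI)|rewrite scalerDr].
  - move=> w _ [h [z [oh Iz ->]]]; exists (fun x => wa w (h x)), (wa w z).
    by split; [apply: operW|apply: (opsubW sI)|rewrite wactD].
  - move=> y _ [h [z [oh Iz ->]]]; exists (fun x => D y (h x)), (D y z).
    by split; [apply: operH|apply: (opsubH sI)|rewrite (dopD roots)].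
have IN x : inv_span x -> N x.
  move=> Ix; exists (fun x => 0 *: id x), x; split=> //; first exact/operZ/oper_id.
  by rewrite scale0r add0r.
have Nm : N m.
  by exists id, 0; split; [apply: oper_id|apply: inv_span0|rewrite addr0].
have [h [z [oh Iz ev]]] := not_rad_full roots irr sN IN Nm nJm v.
apply: nJv; rewrite -(avg_inv iv) ev avgD; apply: (opsubD J_opsub); first exact: Jh.
by apply: (inv_span_rad roots c tau); apply: (avg_opsub sI).
Qed.

Section Independence.
Variables (I : finType) (b : I -> V) (Q : pred I).
Hypothesis b_indep : forall a : I -> C,
  vrad (\sum_(i | Q i) (a i)%:MP *: b i) -> forall i, Q i -> a i = 0.

(** For an operator h, let beta_l be the endomorphism that sends v to the average of
    h (b_l).  The relation becomes sum beta_l (phi_l v) = 0.  Each beta_l is a scalar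
    up to an endomorphism that strictly raises orders, so in the least degree k
    of the vectors phi_l v only these scalars matter.  With a_l a coefficient of
    phi_l v in degree k, the average of h (sum a_l b_l) then lies in the radical for
    every h, and hence so does sum a_l b_l. *)
Lemma endo_independent (phi : I -> V -> V) : (forall i, Q i -> opendo (phi i)) ->
  \sum_(i | Q i) phi i (b i) = 0 -> forall i, Q i -> forall m, phi i m = 0.
Proof.
move=> ep e0.
suff v0 i : Q i -> phi i v = 0.
  move=> i Qi; apply: (opendo_eq (psi := fun=> 0) (ep i Qi) _ gv); last exact: v0.
  split; first by split=> *; rewrite ?addr0 ?scaler0.
    by move=> w m; rewrite wact0.
  by move=> y m; rewrite (dop0 roots).
pose nz k := `[< exists2 i, Q i & vcomp k (phi i v) <> 0 >].
move=> Qi; apply: contrapT => vi0.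
have exk : exists k, nz k.
  have [k vk] : exists k, vcomp k (phi i v) <> 0.
    by apply/existsNP => all0; apply: vi0; apply: polmod_eq0.
  by exists k; apply/asboolP; exists i.
case: (ex_minnP exk) => k /asboolP[j Qj vj] kmin.
(* k is the least degree in which some phi_l v is nonzero *)
have ordk l : Q l -> ord_ge k (phi l v).
  move=> Ql t lt; apply/eqP; apply: contraLR lt => /eqP yt; rewrite -leqNgt.
  by apply: kmin; apply/asboolP; exists l.
have [t [mu cj]] : exists t mu, (co (vcomp k (phi j v)) t)@_mu != 0.
  apply: contrapT => none; apply: vj; apply: coP => t; rewrite co0.
  apply/mpolyP => mu; rewrite mcoeff0; apply/eqP; apply: contrapT => /negP ne.
  by apply: none; exists t, mu.
pose a l := (co (vcomp k (phi l v)) t)@_mu.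
have Ja : vrad (\sum_(l | Q l) (a l)%:MP *: b l).
  apply: avg_oper_rad => h oh.
  have exbeta l : exists beta z, [/\ opendo beta, beta v = avg (h (b l)) &
      forall m, vrad (beta m + z%:MP *: m)].
    have [beta [eb ebv]] := endo_exists roots c_inv faithful iv gv (inv_avg rho tau (h (b l))).
    have [z Jz] := opendo_schur roots irr eb.
    by exists beta, z.
  pose beta l := projT1 (cid (exbeta l)).
  have exz l : exists z, [/\ opendo (beta l), beta l v = avg (h (b l)) &
      forall m, vrad (beta l m + z%:MP *: m)] by rewrite /beta; case: cid.
  pose z l := projT1 (cid (exz l)).
  have zP l : [/\ opendo (beta l), beta l v = avg (h (b l)) &
      forall m, vrad (beta l m + (z l)%:MP *: m)] by rewrite /z; case: cid.
  have sum0 : \sum_(l | Q l) beta l (phi l v) = 0.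
    transitivity (avg (h (\sum_(l | Q l) phi l (b l)))); last first.
      by rewrite e0 (oper0 oh) /avg big1 ?scaler0 // => w _; rewrite wact0.
    rewrite (oper_sum _ _ _ oh) (big_morph avg (avgD rho tau) (_ : avg 0 = 0)); last first.
      by rewrite /avg big1 ?scaler0 // => w _; rewrite wact0.
    apply: eq_bigr => l Ql; have [eb ebv _] := zP l.
    rewrite (endo_comm roots c_inv faithful iv gv eb (ep l Ql)) ebv.
    by rewrite (opendo_avg _ (ep l Ql)) (opendo_oper _ (ep l Ql) oh).
  (* sum of beta_l (phi_l v), read in degree k: there beta_l acts as the scalar - z l *)
  have az : \sum_(l | Q l) a l * z l = 0.
    have vc : \sum_(l | Q l) (z l)%:MP *: vcomp k (phi l v) = 0.
      transitivity (vcomp k (\sum_(l | Q l) (beta l (phi l v) + (z l)%:MP *: phi l v))).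
        by rewrite big_split /= sum0 add0r vcomp_sum; apply: eq_bigr => l _; rewrite vcompZC.
      rewrite vcomp_sum big1 // => l Ql; have [eb _ Jz] := zP l.
      have rb : rad_endo (fun m => beta l m + (z l)%:MP *: m).
        by split=> //; apply: (opendoB roots).
      exact: (rad_endo_ord rb (ordk l Ql) (ltnSn k)).
    have := congr1 (fun x => (co x t)@_mu) vc.
    rewrite co_sum (raddf_sum (mpoly.mcoeff mu)) co0 mcoeff0 => e.
    rewrite -[RHS]e; apply: eq_bigr => l _.
    by rewrite coZ /= mcoeffCM mulrC.
  have -> : avg (h (\sum_(l | Q l) (a l)%:MP *: b l)) =
            \sum_(l | Q l) (a l)%:MP *: (beta l v + (z l)%:MP *: v).
    rewrite (oper_sum _ _ _ oh) (big_morph avg (avgD rho tau) (_ : avg 0 = 0)); last first.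
      by rewrite /avg big1 ?scaler0 // => w _; rewrite wact0.
    transitivity (\sum_(l | Q l) ((a l)%:MP *: beta l v + (a l * z l)%:MP *: v)).
      rewrite big_split -scaler_suml -(raddf_sum (@mpolyC n C)) az /= mpolyC0 scale0r addr0.
      apply: eq_bigr => l _; rewrite (oper_ZC _ _ oh) avgZ; last by move=> w; rewrite pactC.
      by have [_ -> _] := zP l.
    apply: eq_bigr => l _; rewrite scalerDr; congr (_ + _).
    by rewrite scalerA mpolyCM.
  apply: (opsub_sum _ J_opsub) => l _; apply: (opsubZ J_opsub).
  by have [_ _ Jz] := zP l.
by move/eqP: cj; apply; apply: (b_indep Ja).
Qed.

End Independence.
End WithVector.
End EndoIndependence.

(** * A basis over the endomorphism ring *)

Section EndoBasis.
Variables (R : realType) (W : finGroupType) (n : nat).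
Variable rho : mx_representation R[i] [set: W] n.
Variables (alpha : W -> 'cV[R[i]]_n) (alphav : W -> 'rV[R[i]]_n).
Hypothesis roots : reflection_roots rho alpha alphav.
Variable c : W -> R[i].
Hypothesis c_inv : conjugation_invariant rho c.
Variables (d : nat) (tau : mx_representation R[i] [set: W] d).
Hypothesis faithful : mx_faithful rho.
Hypothesis irr : mx_irreducible tau.
Local Notation C := R[i].
Local Notation V := (polmod C n d).
Local Notation cst := (@cst C n d).
Local Notation opsub := (opsub rho alphav c tau).
Local Notation vrad := (vrad rho alphav c tau).
Local Notation opendo := (opendo rho alphav c tau).
Local Notation W_inv := (W_inv rho tau).
Local Notation avg := (avg rho tau).
Local Notation inv_span := (@inv_span R W n rho d).
Local Notation J_opsub := (rad_opsub roots c_inv tau).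

Hypothesis avg_rad_all : forall (N T : V -> Prop) u, opsub N -> (forall x, inv_span x -> N x) ->
  ~ N u -> opsub T -> T u -> (forall x, T x -> N (avg x)) -> forall m, vrad (avg m).
Hypothesis avg_span_all : (forall m, vrad (avg m)) -> forall m, inv_span (avg m).

Lemma homog_monomial mu k (m : V) : homogeneous k m ->
  homogeneous (mdeg mu + k) ('X_[mu] *: m).
Proof.
have homXn i e l (x : V) : homogeneous l x -> homogeneous (e + l) ('X_i ^+ e *: x).
  move=> hx; elim: e => [|e IH]; first by rewrite expr0 scale1r.
  by rewrite exprS -scalerA /homogeneous addSn vcompX IH.
rewrite mpolyXE_id mdegE; elim/big_rec2: _ k m => [|i p e _ IH] k m hm.
  by rewrite scale1r.
by rewrite -scalerA -addnA; apply/homXn/IH.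
Qed.

Lemma homog_ord k (m : V) : homogeneous k m -> ord_ge k m.
Proof. by move=> hm j lt; rewrite (homog_vcompE _ hm) ltn_eqF. Qed.

Local Notation K := (n * #|W|).+1.
Local Notation T := ('X_{1..n < K} * 'I_d)%type.
(** Finitely many homogeneous vectors that span M modulo inv_span. *)
Definition monomial_vector (t : T) : V :=
  'X_[bmnm t.1] *: cst (delta_mx t.2 0).
Local Notation xv := monomial_vector.

Lemma homog_monomial_vector (t : T) : homogeneous (mdeg t.1) (xv t).
Proof.
rewrite -[mdeg _]addn0; apply: homog_monomial.
by rewrite /homogeneous vcomp_cst.
Qed.

Lemma monomial_vector_span m : exists a : T -> C,
  inv_span (m - \sum_t (a t)%:MP *: xv t).
Proof.
have sI := inv_span_opsub roots c tau.
pose N m := exists a : T -> C, inv_span (m - \sum_t (a t)%:MP *: xv t).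
have ND x y : N x -> N y -> N (x + y).
  move=> [a Ia] [b Ib]; exists (fun t => a t + b t).
  have -> : \sum_t (a t + b t)%:MP *: xv t = \sum_t (a t)%:MP *: xv t + \sum_t (b t)%:MP *: xv t.
    by rewrite -big_split; apply: eq_bigr => t _; rewrite mpolyCD scalerDl.
  by rewrite opprD addrACA; apply: (opsubD sI).
have NI x : inv_span x -> N x.
  by move=> Ix; exists (fun=> 0); rewrite big1 ?subr0 // => t _; rewrite mpolyC0 scale0r.
have N0 : N 0 by apply: NI; apply: inv_span0.
change (N m); rewrite [m]polmod_basis; elim/big_ind: _ => // j _.
rewrite [co m j]mpolyE scaler_suml; elim/big_ind: _ => // mu _.
rewrite -mul_mpolyC -scalerA; have [lt|le] := ltnP (mdeg mu) K.
  pose t0 : T := (BMultinom lt, j).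
  exists (fun t => if t == t0 then (co m j)@_mu else 0).
  rewrite (bigD1 t0) //= eqxx big1 ?addr0 ?subrr => [|t /negPf ->].
    exact: inv_span0.
  by rewrite mpolyC0 scale0r.
apply/NI/(opsubZ sI)/(ord_ge_inv_span roots c tau) => i lt.
have := @homog_monomial mu 0 (cst (delta_mx j 0)); rewrite addn0 => /(_ _)/homog_ord; apply.
  by rewrite /homogeneous vcomp_cst.
exact: leq_trans lt le.
Qed.

(** A largest subfamily that is independent modulo the radical. *)
Lemma basis_mod_rad : exists B : {set T},
  (forall a : T -> C, vrad (\sum_(t in B) (a t)%:MP *: xv t) -> forall t, t \in B -> a t = 0) /\
  (forall m, exists a : T -> C, vrad (m - \sum_(t in B) (a t)%:MP *: xv t)).
Proof.
pose indep (B : {set T}) := `[< forall a : T -> C,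
  vrad (\sum_(t in B) (a t)%:MP *: xv t) -> forall t, t \in B -> a t = 0 >].
have i0 : indep set0 by apply/asboolP => a _ t; rewrite in_set0.
case: (arg_maxnP (fun B : {set T} => #|B|) i0) => B iB maxB.
exists B; split; first exact/asboolP.
pose N m := exists a : T -> C, vrad (m - \sum_(t in B) (a t)%:MP *: xv t).
have ND x y : N x -> N y -> N (x + y).
  move=> [a Ia] [b Ib]; exists (fun t => a t + b t).
  have -> : \sum_(t in B) (a t + b t)%:MP *: xv t =
      \sum_(t in B) (a t)%:MP *: xv t + \sum_(t in B) (b t)%:MP *: xv t.
    by rewrite -big_split; apply: eq_bigr => t _; rewrite mpolyCD scalerDl.
  by rewrite opprD addrACA; apply: (opsubD J_opsub).
have NZ z x : N x -> N (z%:MP *: x).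
  move=> [a Ja]; exists (fun t => z * a t).
  have -> : \sum_(t in B) (z * a t)%:MP *: xv t = z%:MP *: \sum_(t in B) (a t)%:MP *: xv t.
    by rewrite scaler_sumr; apply: eq_bigr => t _; rewrite mpolyCM -scalerA.
  by rewrite -scalerBr; apply: (opsubZ J_opsub).
have NJ x : vrad x -> N x.
  by move=> Ix; exists (fun=> 0); rewrite big1 ?subr0 // => t _; rewrite mpolyC0 scale0r.
have Nx t : N (xv t).
  have [tB|tB] := boolP (t \in B).
    exists (fun t' => if t' == t then 1 else 0).
    rewrite (bigD1 t) //= eqxx mpolyC1 scale1r big1 ?addr0 ?subrr => [|t' /andP[_ /negPf ->]].
      exact: (opsub0 J_opsub).
    by rewrite mpolyC0 scale0r.
  have : ~~ indep (t |: B).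
    by apply/negP => /maxB; rewrite /= cardsU1 tB add1n => /(leq_ltn_trans)/(_ (ltnSn _)); rewrite ltnn.
  move/asboolPn/existsNP => [a /not_implyP[Ja /existsNP[t' /not_implyP[t'B at']]]].
  move: Ja; rewrite big_setU1 //= => Ja.
  have at0 : a t != 0.
    apply: contra_not_neq at' => at0; move: Ja; rewrite at0 mpolyC0 scale0r add0r.
    move/asboolP: iB => iB /iB; case/setU1P: t'B => [->|t'B]; first by rewrite at0.
    by apply.
  have -> : xv t = (a t)^-1%:MP *: ((a t)%:MP *: xv t).
    by rewrite [RHS]scalerA -mpolyCM mulVf // mpolyC1 scale1r.
  apply: NZ; exists (fun t => - a t).
  rewrite -sumrN; move: Ja; congr (vrad (_ + _)); apply: eq_bigr => i _.
  by rewrite mpolyCN scaleNr opprK.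
move=> m; have [a Ia] := monomial_vector_span m.
rewrite -(subrK (\sum_t (a t)%:MP *: xv t) m); apply: (ND (m - _)).
  exact/NJ/(inv_span_rad roots c tau).
elim/big_ind: _ => //; last by move=> t _; apply: NZ.
by apply: NJ; apply: (opsub0 J_opsub).
Qed.

Lemma opendo_add phi psi : opendo phi -> opendo psi -> opendo (fun m => phi m + psi m).
Proof.
move=> [lp pW pH] [lq qW qH]; split; first exact: pol_lin_add.
  by move=> w m; rewrite pW qW wactD.
by move=> y m; rewrite pH qH (dopD roots).
Qed.

Lemma opendo_mul phi psi : opendo phi -> opendo psi -> opendo (fun m => phi (psi m)).
Proof.
move=> [lp pW pH] [lq qW qH]; split; first exact: pol_lin_comp.
  by move=> w m; rewrite qW pW.
by move=> y m; rewrite qH pH.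
Qed.

Lemma opendo0 : opendo (fun=> 0).
Proof.
split; first by split=> *; rewrite ?addr0 ?scaler0.
  by move=> w m; rewrite wact0.
by move=> y m; rewrite (dop0 roots).
Qed.

Lemma opendo_scale a : opendo (fun m => a%:MP *: m).
Proof.
split; first exact/pol_lin_scale/pol_lin_id.
  by move=> w m; rewrite wactZ pactC.
by move=> y m; rewrite (dopZC roots).
Qed.

(** Induction on the degree k of a homogeneous vector: modulo the C-span of the
    basis it lies in the radical, hence is a sum of values psi x of endomorphisms
    psi with image in the radical.  As these strictly raise orders, the component
    of degree k of psi x only involves components of x of degree less than k. *)
Lemma endo_span (k0 : nat) (v : V) (hv : homogeneous k0 v) (iv : W_inv v) (nJv : ~ vrad v)
    (B : {set T}) : (forall m, exists a : T -> C, vrad (m - \sum_(t in B) (a t)%:MP *: xv t)) ->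
  forall m, exists phi : T -> V -> V, (forall t, opendo (phi t)) /\
    m = \sum_(t in B) phi t (xv t).
Proof.
move=> span.
pose N m := exists phi : T -> V -> V, (forall t, opendo (phi t)) /\
    m = \sum_(t in B) phi t (xv t).
have ND x y : N x -> N y -> N (x + y).
  move=> [phi [ep ->]] [psi [eq ->]]; exists (fun t m => phi t m + psi t m).
  by split=> [t|]; [apply: opendo_add|rewrite big_split].
have NE psi x : opendo psi -> N x -> N (psi x).
  move=> eq [phi [ep ->]]; exists (fun t m => psi (phi t m)).
  by split=> [t|]; [apply: opendo_mul|rewrite (pol_lin_sum _ _ _ (opendo_lin eq))].
have N0 : N 0.
  by exists (fun _ _ => 0); split=> [t|]; [apply: opendo0|rewrite big1].
have Nh k : forall m, N (vcomp k m).
  elim/ltn_ind: k => k IH m.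
  have [a Ja] := span (vcomp k m).
  have -> : vcomp k m = \sum_(t in B) (if mdeg (t : T).1 == k then (a t)%:MP *: xv t else 0) +
      vcomp k (vcomp k m - \sum_(t in B) (a t)%:MP *: xv t).
    rewrite -scaleN1r -mpolyC1 -mpolyCN vcompD vcompZC vcomp_vcomp eqxx vcomp_sum.
    rewrite mpolyCN mpolyC1 scaleN1r addrCA.
    rewrite [X in _ = _ + (X - _)](eq_bigr (fun t => vcomp k ((a t)%:MP *: xv t))).
      by rewrite subrr addr0.
    move=> t _; rewrite vcompZC (homog_vcompE _ (homog_monomial_vector t)) eq_sym.
    by case: eqP => // _; rewrite scaler0.
  apply: (ND).
    exists (fun t m => if mdeg (t : T).1 == k then (a t)%:MP *: m else 0); split=> // t.
    by case: eqP => _; [apply: opendo_scale|apply: opendo0].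
  have := rad_in_span roots c_inv faithful irr avg_rad_all hv iv nJv Ja.
  elim=> [|psi x y rp _ Ny]; first by rewrite vcomp0.
  rewrite vcompD; apply: (ND) => //.
  rewrite (vcomp_opendo _ _ (proj1 rp)); elim/big_ind: _ => // l _.
  (* for l = k the component of degree 0 of psi occurs, which is 0 *)
  have [lt|le] := ltnP l k.
    apply: (NE (endo_comp psi (k - l)) _ _ (IH l lt x)); exact: (endo_comp_opendo roots _ (proj1 rp)).
  have -> : (k - l = 0)%N by apply/eqP; rewrite subn_eq0.
  by rewrite (rad_endo_comp0 _ rp).
move=> m; have [k /(_ k (leqnn _))[-> _]] := vcomp_bound m.
by change (N (\sum_(j < k) vcomp j m)); elim/big_ind: _.
Qed.

Lemma endo_basis : exists r (b : 'I_r -> V),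
  (forall m, exists phi : 'I_r -> V -> V, (forall i, opendo (phi i)) /\
     m = \sum_i phi i (b i)) /\
  (forall phi : 'I_r -> V -> V, (forall i, opendo (phi i)) -> \sum_i phi i (b i) = 0 ->
     forall i m, phi i m = 0).
Proof.
have [k [v [hv iv nJv]]] := spherical_vector roots c_inv faithful irr avg_span_all.
have [B [ind span]] := basis_mod_rad.
exists #|B|, (fun i => xv (enum_val i)); split=> [m|phi ep e i].
  have [phi [ep ->]] := endo_span hv iv nJv span m.
  exists (fun i => phi (enum_val i)); split=> //.
  by rewrite (big_enum_val (fun t => phi t (xv t))).
apply: (endo_independent roots c_inv faithful irr hv iv nJv _ (fun i _ => ep i) e) => //.
move=> a Ja {}i _.
pose a' t := \sum_(i | enum_val i == t) a i.
have a'E l : a' (enum_val l) = a l.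
  by rewrite /a' (big_pred1 l) // => x; rewrite /= (inj_eq enum_val_inj).
rewrite -a'E; apply: ind (enum_valP i).
rewrite (big_enum_val (fun t => (a' t)%:MP *: xv t)).
by move: Ja; congr vrad; apply: eq_bigr => l _; rewrite a'E.
Qed.

End EndoBasis.

(** * The rank *)

Section McCoy.
Variable (E : pzRingType).
Hypothesis EC : forall x y : E, x * y = y * x.
Hypothesis E1 : (1 : E) != 0.

(** A copy of E on which the hypotheses supply the structure of a nontrivial
    commutative ring. *)
Definition com_copy : Type := E.
HB.instance Definition _ := GRing.PzRing.on com_copy.
HB.instance Definition _ := GRing.PzRing_hasCommutativeMul.Build com_copy EC.
HB.instance Definition _ := GRing.PzSemiRing_isNonZero.Build com_copy E1.

(** If A were injective on columns, then, since the row l of A is zero, a monic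
    polynomial that kills A would have zero constant term and could be divided by
    X.  Starting from the Cayley-Hamilton theorem, this descends to 1 = 0. *)
Lemma square_zero_row (n : nat) (A : 'M[com_copy]_n.+1) (l : 'I_n.+1) :
  (forall j, A l j = 0) -> exists2 z : 'cV_n.+1, z != 0 & A *m z = 0.
Proof.
move=> Al; apply: contrapT => none.
have inj (z : 'cV_n.+1) : A *m z = 0 -> z = 0.
  by move=> Az; apply/eqP; apply: contraT => z0; case: none; exists z.
suff mon (p : {poly com_copy}) : p \is monic -> horner_mx A p = 0 -> False.
  by apply: (mon (char_poly A)); [apply: char_poly_monic|apply: Cayley_Hamilton].
elim/poly_ind: p => [|q a IH]; first by rewrite monicE lead_coef0 eq_sym oner_eq0.
move=> mp hp; have := mp; rewrite monicE.
have [q0|q0] := eqVneq q 0.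
  rewrite q0 mul0r add0r lead_coefC => /eqP a1.
  move: hp; rewrite q0 mul0r add0r horner_mx_C a1 => /matrixP /(_ l l) /eqP.
  by rewrite !mxE eqxx oner_eq0.
have hpE : A *m horner_mx A q + a%:M = 0.
  by rewrite -hp [q * _]mulrC rmorphD rmorphM /= horner_mx_X horner_mx_C.
have a0 : a = 0.
  have := congr1 (fun B : 'M_n.+1 => B l l) hpE; rewrite !mxE eqxx mulr1n => <-.
  by rewrite big1 ?add0r // => j _; rewrite Al mul0r.
move: hpE; rewrite a0 raddf0 addr0 => hq _.
apply: IH; last first.
  apply/matrixP => i j; rewrite mxE.
  have -> : horner_mx A q i j = (horner_mx A q *m delta_mx j 0) i (0 : 'I_1).
    by rewrite -colE mxE.
  rewrite (inj (horner_mx A q *m delta_mx j 0)) ?mxE // mulmxA.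
  by rewrite [A *m _]hq mul0mx.
by move: mp; rewrite a0 addr0 monicMr // monicX.
Qed.

(** Complete A to a square matrix by zero rows. *)
Lemma mccoy m n (A : 'I_m -> 'I_n -> E) : (m < n)%N ->
  exists2 z : 'I_n -> E, exists j, z j <> 0 & forall i, \sum_j A i j * z j = 0.
Proof.
case: n A => // n A lt.
pose B : 'M[com_copy]_n.+1 := \matrix_(i, j) if insub (val i) is Some i' then A i' j else 0.
have [z z0 Bz] : exists2 z : 'cV_n.+1, z != 0 & B *m z = 0.
  by apply: (@square_zero_row _ _ ord_max) => j; rewrite mxE insubF //= ltnNge -ltnS lt.
exists (fun j => z j 0 : E).
  apply/existsNP => all0; case/eqP: z0; apply/colP => j; rewrite mxE.
  exact: all0.
move=> i; transitivity ((B *m z) (widen_ord (ltnW lt) i) 0); last by rewrite Bz mxE.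
rewrite mxE; apply: eq_bigr => j _; rewrite mxE insubT //= => lt'.
by congr (A _ _ * _); apply: val_inj.
Qed.

End McCoy.

Section DunklFree.
Variables (R : realType) (W : finGroupType) (n : nat).
Variable rho : mx_representation R[i] [set: W] n.
Variables (alpha : W -> 'cV[R[i]]_n) (alphav : W -> 'rV[R[i]]_n).
Hypothesis roots : reflection_roots rho alpha alphav.
Variable c : W -> R[i].
Hypothesis c_inv : conjugation_invariant rho c.
Variables (d : nat) (tau : mx_representation R[i] [set: W] d).
Hypothesis faithful : mx_faithful rho.
Hypothesis irr : mx_irreducible tau.
Local Notation C := R[i].
Local Notation V := (polmod C n d).
Local Notation opsub := (opsub rho alphav c tau).
Local Notation vrad := (vrad rho alphav c tau).
Local Notation opendo := (opendo rho alphav c tau).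
Local Notation W_inv := (W_inv rho tau).
Local Notation avg := (avg rho tau).
Local Notation inv_span := (@inv_span R W n rho d).
Local Notation J_opsub := (rad_opsub roots c_inv tau).

Hypothesis avg_rad_all : forall (N T : V -> Prop) u, opsub N -> (forall x, inv_span x -> N x) ->
  ~ N u -> opsub T -> T u -> (forall x, T x -> N (avg x)) -> forall m, vrad (avg m).
Hypothesis avg_span_all : (forall m, vrad (avg m)) -> forall m, inv_span (avg m).

Local Notation H := (cherednik rho alpha alphav c).
Local Notation M := (dunkl roots c_inv tau).
Local Notation E := (endo M).

Lemma opendo_linear (phi : V -> V) : opendo phi -> linear (phi : M -> M).
Proof.
move=> [lp pW pH]; apply: equivariant_linear.
- exact: (pol_linD lp).
- by move=> a m; rewrite (pol_linZ lp) [RHS]dunkl_const.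
- by move=> i m; rewrite (pol_linZ lp) [RHS]dunkl_hd sym_hd_delta.
- by move=> i m; rewrite pH [RHS]dunkl_h.
- by move=> w m; rewrite pW [RHS]dunkl_W.
Qed.

Lemma endo_opendo (f : E) : opendo (f : V -> V).
Proof.
have fZ (a : H) (m : M) : f (a *: m) = a *: f m.
  have f0 : f 0 = 0 by apply: (addrI (f 0)); rewrite -endo_additive !addr0.
  have := endo_linear f a m 0; rewrite addr0 => ->; by rewrite f0 addr0.
split; first split.
- by move=> m m'; exact: (endo_additive f (m : M) m').
- elim/mpoly_ring_ind => [a|p q IHp IHq|i p IH] m.
  + have e (x : V) := @dunkl_const R W n rho alpha alphav roots c c_inv d tau a (x : M).
    by rewrite -[X in f X]e fZ [LHS]e.
  + rewrite [X in f X]scalerDl [RHS]scalerDl -IHp -IHq.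
    exact: (endo_additive f (p *: m : M) (q *: m : M)).
  + have e (x : V) := @dunkl_hd R W n rho alpha alphav roots c c_inv d tau (delta_mx 0 i) (x : M).
    by rewrite -!scalerA -IH -sym_hd_delta -[X in f X]e fZ [LHS]e.
- move=> w m; have e (x : V) := @dunkl_W R W n rho alpha alphav roots c c_inv d tau w (x : M).
  by rewrite -[X in f X]e fZ [LHS]e.
- move=> y m; have e (x : V) := @dunkl_h R W n rho alpha alphav roots c c_inv d tau y (x : M).
  by rewrite -[X in f X]e fZ [LHS]e.
Qed.

Definition opendo_endo phi (ep : opendo phi) : E := Endo (opendo_linear ep).

Lemma endo_dunkl_comm (x y : E) : x * y = y * x.
Proof.
have [k [v [hv iv nJv]]] := spherical_vector roots c_inv faithful irr avg_span_all.
apply: endoP => m.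
exact: (endo_comm roots c_inv faithful iv (homog_generates roots irr hv nJv)
  (endo_opendo x) (endo_opendo y) m).
Qed.

Lemma endo_dunkl_neq0 : (1 : E) != 0.
Proof.
have [k [v [hv iv nJv]]] := spherical_vector roots c_inv faithful irr avg_span_all.
apply/eqP => /(congr1 (fun f : E => f v)) /= v0; apply: nJv; rewrite [v]v0.
exact: (opsub0 J_opsub).
Qed.

Lemma endo_sumE (I : Type) (r : seq I) (Q : pred I) (F : I -> E) m :
  (\sum_(i <- r | Q i) F i) m = \sum_(i <- r | Q i) F i m.
Proof. by apply: (big_morph (fun f : E => f m)). Qed.

(** A basis of r elements and the independent family f^i v with i < |W| are each
    expressed through the other, up to the nonzero factor Dv in one direction;
    mccoy excludes that one is longer than the other. *)
Lemma dunkl_free : free_of_rank (endo_module M : lmodType (endo M)) #|W|.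
Proof.
have [r [b [span ind]]] := endo_basis roots c_inv faithful irr avg_rad_all avg_span_all.
have [k [v [hv iv nJv]]] := spherical_vector roots c_inv faithful irr avg_span_all.
have gv := homog_generates roots irr hv nJv.
have [f [g [Dv Dv0 [gf fg finj]]]] := interpolation faithful.
have spanE m : exists a : 'I_r -> E, m = \sum_i a i (b i).
  have [phi [ep ->]] := span m.
  by exists (fun i => opendo_endo (ep i)).
have indE (a : 'I_r -> E) : \sum_i a i (b i) = 0 -> forall i, a i = 0.
  move=> e i; apply: endoP => m.
  exact: (ind (fun i => a i) (fun i => endo_opendo (a i)) e).
(* Dv (b j) is the combination of the f^i v with coefficients a i j *)
have le1 : (r <= #|W|)%N.
  rewrite leqNgt; apply/negP => lt.
  have exa j i : exists a : E, a v = #|W|%:R%:MP *: avg (g i *: b j).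
    have iu : W_inv (#|W|%:R%:MP *: avg (g i *: b j)).
      by move=> w; rewrite wactZ pactC (inv_avg rho tau).
    have [phi [ep e]] := endo_exists roots c_inv faithful iv gv iu.
    by exists (opendo_endo ep).
  pose a i j := projT1 (cid (exa j i)).
  have aE i j : a i j v = #|W|%:R%:MP *: avg (g i *: b j) by rewrite /a; case: cid.
  have [z [j zj] Az] := mccoy endo_dunkl_comm endo_dunkl_neq0 a lt.
  apply: zj; apply: indE; apply: polmod_torsion Dv0.
  rewrite scaler_sumr.
  transitivity (\sum_(i < #|W|) f ^+ i *: (\sum_j a i j * z j) v); last first.
    by rewrite big1 // => i _; rewrite Az scaler0.
  transitivity (\sum_j \sum_(i < #|W|) f ^+ i *: a i j (z j v)).
    apply: eq_bigr => l _; have lz := opendo_lin (endo_opendo (z l)).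
    rewrite -(pol_linZ lz) (orbit_expansion tau fg) (pol_lin_sum _ _ _ lz).
    apply: eq_bigr => i _; rewrite (pol_linZ lz) -aE; congr (_ *: _).
    exact: (congr1 (fun h : E => h v) (endo_dunkl_comm (z l) (a i l))).
  rewrite exchange_big; apply: eq_bigr => i _ /=.
  by rewrite endo_sumE scaler_sumr.
(* f^i v is the combination of the b j with coefficients a j i *)
have le2 : (#|W| <= r)%N.
  rewrite leqNgt; apply/negP => lt.
  pose a j i := projT1 (cid (spanE (f ^+ (i : 'I_#|W|) *: v))) j.
  have aE i : f ^+ (i : 'I_#|W|) *: v = \sum_j a j i (b j) by rewrite /a; case: cid.
  have [z [i zi] Az] := mccoy endo_dunkl_comm endo_dunkl_neq0 a lt.
  have zv0 : z i v = 0.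
    apply: (orbit_independent (u := fun i => z i v) finj) => [l w|].
      exact: etrans (esym (opendoW (endo_opendo (z l)) w v)) (congr1 (z l) (iv w)).
    transitivity (\sum_(l < #|W|) \sum_j z l (a j l (b j))).
      apply: eq_bigr => l _; have lz := opendo_lin (endo_opendo (z l)).
      by rewrite -(pol_linZ lz) aE (pol_lin_sum _ _ _ lz).
    rewrite exchange_big; apply: big1 => j _ /=.
    transitivity ((\sum_l a j l * z l) (b j)); last by rewrite Az.
    rewrite endo_sumE; apply: eq_bigr => l _.
    exact: (congr1 (fun h : E => h (b j)) (endo_dunkl_comm (z l) (a j l))).
  apply: zi; apply: endoP => m.
  exact: (opendo_eq (endo_opendo (z i)) (endo_opendo 0) gv zv0).
have er : r = #|W| by apply/eqP; rewrite eqn_leq le1.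
rewrite -er; exists b => m; have [a e] := spanE m.
exists [ffun i => a i]; split.
  by rewrite [LHS]e; apply: eq_bigr => i _; rewrite ffunE.
move=> a' e'; apply/ffunP => i; rewrite ffunE; apply: subr0_eq.
apply: (indE (fun i => a i - a' i)).
transitivity (\sum_i a i (b i) - \sum_i a' i *: (b i : endo_module M)).
  by rewrite -sumrB; apply: eq_bigr.
by rewrite -e' -e subrr.
Qed.

End DunklFree.

(** * Invariants of positive degree *)

HB.lock Definition hact (R : realType) (W : finGroupType) (n : nat)
    (rho : mx_representation R[i] [set: W] n) (w : W) (p : mpoly.mpoly n R[i]) :
    mpoly.mpoly n R[i] := sym_h_act rho w p.

Section SymH.
Variables (R : realType) (W : finGroupType) (n : nat).
Variable rho : mx_representation R[i] [set: W] n.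
Local Notation C := R[i].
Local Notation P := (mpoly.mpoly n C).
Local Notation hact := (hact rho).

Lemma hactD w (p q : P) : hact w (p + q) = hact w p + hact w q.
Proof. by rewrite hact.unlock [LHS]raddfD. Qed.
Lemma hactC w (a : C) : hact w a%:MP = a%:MP :> P.
Proof. by rewrite hact.unlock; apply: comp_mpolyC. Qed.
Lemma hactX w i (p : P) : hact w ('X_i * p) = sym_h (rho w *m delta_mx i 0) * hact w p.
Proof. by rewrite hact.unlock [LHS]rmorphM /= sym_h_actX. Qed.

Lemma sym_h_linear a (x y : 'cV[C]_n) : sym_h (a *: x + y) = a%:MP * sym_h x + sym_h y :> P.
Proof.
rewrite /sym_h mulr_sumr -big_split; apply: eq_bigr => i _ /=.
by rewrite !mxE scalerDl mul_mpolyC scalerA.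
Qed.

Lemma sym_h_delta i : sym_h (delta_mx i 0 : 'cV[C]_n) = 'X_i :> P.
Proof.
rewrite /sym_h (bigD1 i) //= mxE !eqxx scale1r big1 ?addr0 // => j /negPf nj.
by rewrite mxE nj scale0r.
Qed.

Lemma sym_h_eq0 (x : 'cV[C]_n) : sym_h x = 0 :> P -> x = 0.
Proof.
move=> e; apply/colP => i; rewrite mxE -[RHS](mcoeff0 C U_(i)%MM) -e /sym_h.
rewrite (raddf_sum (mpoly.mcoeff U_(i)%MM)) (bigD1 i) //=.
rewrite (mcoeffZ (x i 0)) mcoeffX eqxx mulr1 big1 ?addr0 // => j nj.
rewrite (mcoeffZ (x j 0)) mcoeffX mulrC; case: eqP => [/mnmP /(_ i)|_]; last by rewrite mul0r.
by rewrite !mnm1E eqxx (negPf nj).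
Qed.

End SymH.

Section AbstractRelations.
Variables (R : realType) (W : finGroupType) (n : nat).
Variable rho : mx_representation R[i] [set: W] n.
Local Notation C := R[i].
Local Notation P := (mpoly.mpoly n C).
Local Notation hact := (hact rho).
Variables (alpha : W -> 'cV[R[i]]_n) (alphav : W -> 'rV[R[i]]_n).
Hypothesis roots : reflection_roots rho alpha alphav.
Variable c : W -> R[i].
Local Notation S := (reflections rho).
Local Notation refl_form := (refl_form rho c).
Variables (A : pzRingType) (ck : C -> A) (ch : 'cV[C]_n -> A) (x : 'rV[C]_n) (xA : A)
  (cW : W -> A) (sh : P -> A).
Hypothesis shD : forall p q, sh (p + q) = sh p + sh q.
Hypothesis shM : forall p q, sh (p * q) = sh p * sh q.
Hypothesis shC : forall a, sh a%:MP = ck a.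
Hypothesis sh_sym_h : forall y, sh (sym_h y) = ch y.
Hypothesis ck_central : forall a u, ck a * u = u * ck a.
Hypothesis cW_ch : forall w y, cW w * ch y = ch (rho w *m y) * cW w.
Hypothesis ch_xA : forall y, ch y * xA = xA * ch y + \sum_(s in S) ck (refl_form s x y) * cW s.

Let sh0 : sh 0 = 0.
Proof. by apply: (addrI (sh 0)); rewrite -shD !addr0. Qed.
Let shX i p : sh ('X_i * p) = ch (delta_mx i 0) * sh p.
Proof. by rewrite shM -sym_h_delta sh_sym_h. Qed.

Lemma abs_cW_sh w q : cW w * sh q = sh (hact w q) * cW w.
Proof.
elim/mpoly_ring_ind: q => [a|p q IHp IHq|i p IH].
- by rewrite hactC shC ck_central.
- by rewrite shD mulrDr IHp IHq hactD shD mulrDl.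
- by rewrite shX mulrA cW_ch -mulrA IH hactX shM sh_sym_h mulrA.
Qed.

(** The commutator of q in Sym(h) with a linear form x is a combination of
    reflections s, whose coefficients are the divided differences of q along v s. *)
Lemma abs_sh_chd (v : W -> 'cV[C]_n) q :
  (forall s, s \in S -> 1%:M - rho s = v s *m alphav s) ->
  exists T : W -> P,
    (forall s, s \in S -> sym_h (v s) * T s =
       (kappa rho c s * (x *m coroot rho alphav s) 0 0)%:MP * (q - hact s q)) /\
    sh q * xA = xA * sh q + \sum_(s in S) sh (T s) * cW s.
Proof.
move=> vE; pose g s := kappa rho c s * (x *m coroot rho alphav s) 0 0.
elim/mpoly_ring_ind: q => [a|p q [T [eT IHp]] [T' [eT' IHq]]|i q [T [eT IH]]].
- exists (fun=> 0); split=> [s _|]; first by rewrite hactC subrr !mulr0.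
  rewrite shC ck_central big1 ?addr0 // => s _.
  by rewrite sh0 mul0r.
- exists (fun s => T s + T' s); split=> [s Ss|].
    by rewrite hactD mulrDr eT // eT' // -mulrDr addrACA -opprD.
  rewrite shD mulrDl IHp IHq mulrDr addrACA; congr (_ + _).
  by rewrite -big_split; apply: eq_bigr => s _; rewrite shD mulrDl.
have form s : s \in S -> refl_form s x (delta_mx i 0) = g s * (alphav s *m (delta_mx i 0 : 'cV[C]_n)) 0 0.
  move=> Ss; rewrite /refl_form /g (corootE roots Ss) !mulmxA -(mulmxA (x *m coroot _ _ _)).
  by rewrite -mulrA; congr (_ * _); rewrite [LHS]mxE big_ord1.
exists (fun s => (refl_form s x (delta_mx i 0))%:MP * hact s q + 'X_i * T s); split.
  move=> s Ss; rewrite hactX.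
  have -> : sym_h (rho s *m delta_mx i 0) =
      'X_i - ((alphav s *m (delta_mx i 0 : 'cV[C]_n)) 0 0)%:MP * sym_h (v s) :> P.
    have -> : rho s *m (delta_mx i 0 : 'cV[C]_n) = - (alphav s *m (delta_mx i 0 : 'cV[C]_n)) 0 0 *: v s + delta_mx i 0.
      have /(congr1 (mulmxr (delta_mx i (0 : 'I_1)))) := vE s Ss; rewrite /= mulmxBl mul1mx.
      move/(canRL (subrK _)) => e0.
      have -> : rho s *m delta_mx i (0 : 'I_1) = delta_mx i 0 - v s *m alphav s *m delta_mx i 0.
        by rewrite -(vE s Ss) mulmxBl mul1mx opprB addrC subrK.
      by rewrite -mulmxA [X in v s *m X]mx11_scalar mul_mx_scalar addrC scaleNr.
    by rewrite sym_h_linear sym_h_delta mpolyCN mulNr addrC.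
  rewrite (form s Ss) mulrDr mulrCA [sym_h _ * (_ * _)]mulrCA (eT s Ss) -/(g s) mpolyCM.
  ring.
rewrite shX -mulrA IH mulrDr mulrA ch_xA mulrDl -mulrA -shX -addrA; congr (_ + _).
rewrite mulr_suml mulr_sumr -big_split; apply: eq_bigr => s _.
by rewrite shD mulrDl shX shM shC -!mulrA abs_cW_sh.
Qed.

Lemma reflection_factor : exists v : W -> 'cV[C]_n,
  forall s, s \in S -> 1%:M - rho s = v s *m alphav s /\ v s != 0.
Proof.
have ex s : exists v : 'cV[C]_n, s \in S -> 1%:M - rho s = v *m alphav s /\ v != 0.
  have [Ss|] := boolP (s \in S); last by exists 0.
  have [t et] := alphavV roots Ss.
  exists (t *: coroot rho alphav s^-1%g) => _.
  have e : 1%:M - rho s = (t *: coroot rho alphav s^-1%g) *m alphav s.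
    rewrite -scalemxAl scalemxAr -et -(corootE roots) ?invgK // reflectionsV //.
  split=> //; apply: contraTneq Ss => v0; rewrite inE -opprB e v0 mul0mx oppr0.
  by rewrite mxrank0.
by exists (fun s => projT1 (cid (ex s))) => s Ss; case: cid => v; apply.
Qed.

(** The divided differences of an invariant vanish. *)
Lemma abs_sh_inv_comm q : (forall w, hact w q = q) -> sh q * xA = xA * sh q.
Proof.
move=> qW; have [v vE] := reflection_factor.
have [T [eT ->]] := abs_sh_chd q (fun s Ss => proj1 (vE s Ss)).
rewrite big1 ?addr0 // => s Ss.
have -> : T s = 0; last by rewrite sh0 mul0r.
have /eqP := eT s Ss; rewrite qW subrr mulr0 mulf_eq0 => /orP[/eqP/sym_h_eq0 v0|/eqP //].
by have [_] := vE s Ss; rewrite v0 eqxx.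
Qed.

End AbstractRelations.

Section InvariantAction.
Variables (R : realType) (W : finGroupType) (n : nat).
Variable rho : mx_representation R[i] [set: W] n.
Local Notation C := R[i].
Local Notation hact := (hact rho).
Variables (alpha : W -> 'cV[R[i]]_n) (alphav : W -> 'rV[R[i]]_n).
Hypothesis roots : reflection_roots rho alpha alphav.
Variable c : W -> R[i].
Local Notation H := (cherednik rho alpha alphav c).
Local Notation ck := (cherednik_const rho alpha alphav c).
Local Notation ch := (cherednik_h rho alpha alphav c).
Local Notation chd := (cherednik_hd rho alpha alphav c).
Local Notation cW := (cherednik_W rho alpha alphav c).
Local Notation shd := (cherednik_sym_hd rho alpha alphav c).
Local Notation sh := (cherednik_sym_h rho alpha alphav c).

Lemma shM p q : sh (p * q) = sh p * sh q.
Proof.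
have kz a i : ck a * ch (delta_mx i 0) = ch (delta_mx i 0) * ck a by apply: ck_central.
have zz i j : ch (delta_mx i 0) * ch (delta_mx j 0) = ch (delta_mx j 0) * ch (delta_mx i 0).
  exact: ch_comm.
by rewrite !shE; exact: (comm_evalM (@ckD _ _ _ rho alpha alphav c)
  (@ckM _ _ _ rho alpha alphav c) kz zz).
Qed.

Lemma sh_sym_h y : sh (sym_h y) = ch y.
Proof.
rewrite chE /sym_h.
rewrite (big_morph sh (@shD _ _ _ rho alpha alphav c) (_ : sh 0 = 0)); last by rewrite -mpolyC0 shC ck0.
apply: eq_bigr => i _; rewrite -mul_mpolyC shM shC; congr (_ * _).
by rewrite -['X_i]mulr1 shX -mpolyC1 shC ck1 mulr1.
Qed.

Lemma sh_inv_comm q x : (forall w, hact w q = q) -> sh q * chd x = chd x * sh q.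
Proof.
apply: (abs_sh_inv_comm roots (c := c) (ck := ck) (ch := ch) (x := x) (cW := cW)).
- exact: shD.
- exact: shM.
- exact: shC.
- exact: sh_sym_h.
- exact: ck_central.
- exact: cW_ch.
- by move=> y; apply: (ch_chd roots).
Qed.

Hypothesis c_inv : conjugation_invariant rho c.
Variables (d : nat) (tau : mx_representation R[i] [set: W] d).
Local Notation M := (dunkl roots c_inv tau).
Local Notation V := (polmod C n d).
Local Notation opsub := (opsub rho alphav c tau).
Local Notation inv_span := (@inv_span R W n rho d).

(** An invariant of positive degree in Sym(h) commutes with C[h] and kills the
    constants. *)
Lemma sh_inv_kill q (m : M) : invariant_sym_h rho q -> sh q *: m = 0.
Proof.
move=> [qW q0].
have qW' w : hact w q = q by rewrite hact.unlock.
elim/cst_ind: m => [v|m m' IH IH'|i m IH].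
- by rewrite [LHS]dunkl_sym_h q0 mpolyC0 scale0r.
- transitivity (sh q *: (m : M) + sh q *: (m' : M)); first exact: (scalerDr (sh q)).
  by rewrite [X in X + _]IH [X in _ + X]IH' addr0.
have e : 'X_i *: m = chd (delta_mx 0 i) *: (m : M) by rewrite [RHS]dunkl_hd sym_hd_delta.
rewrite e; transitivity ((sh q * chd (delta_mx 0 i)) *: (m : M)); first exact: scalerA.
rewrite sh_inv_comm //; transitivity (chd (delta_mx 0 i) *: (sh q *: (m : M))).
  exact: esym (scalerA _ _ _).
by rewrite IH; apply: (scaler0 M).
Qed.

Lemma dunkl_sym_hd p (m : M) : shd p *: m = p *: (m : V) :> V.
Proof.
elim/mpoly_ring_ind: p => [a|p q IHp IHq|i p IH].
- by rewrite shdC [LHS]dunkl_const.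
- rewrite shdD [RHS]scalerDl -IHp -IHq; exact: (scalerDl m).
- rewrite shdX -[LHS]scalerA [LHS]dunkl_hd sym_hd_delta [X in _ *: X]IH.
  by rewrite scalerA.
Qed.

Lemma invariant_sym_hdE p : invariant_sym_hd rho p <-> hd_invariant rho p.
Proof.
rewrite /invariant_sym_hd /hd_invariant; split=> -[pW p0]; split=> // w;
  by move: (pW w); rewrite pact.unlock.
Qed.

Lemma opsub_scale (N : V -> Prop) (a : H) (m : M) : opsub N -> N m -> N (a *: m).
Proof.
move=> sN; elim/cherednik_ind: a m => [a b IHa IHb m Nm||k a IH m Nm|i a IH m Nm|i a IH m Nm|w a IH m Nm].
- by rewrite scalerDl; apply: (opsubD sN); [apply: IHa|apply: IHb].
- by move=> m; rewrite scale1r.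
- by rewrite -scalerA [X in N X]dunkl_const; apply/(opsubZ sN)/IH.
- by rewrite -scalerA [X in N X]dunkl_h; apply/(opsubH sN)/IH.
- by rewrite -scalerA [X in N X]dunkl_hd; apply/(opsubZ sN)/IH.
- by rewrite -scalerA [X in N X]dunkl_W; apply/(opsubW sN)/IH.
Qed.

Lemma submodule_opsub (N : M -> Prop) : submodule N -> opsub N.
Proof.
move=> [N0 NZ].
have NA a m : N m -> N (a *: m) by move=> Nm; rewrite -[_ *: _]addr0; apply: NZ.
split=> //.
- by move=> u v Nu Nv; have := NZ 1 u v Nu Nv; rewrite scale1r.
- by move=> p m Nm; rewrite -dunkl_sym_hd; apply: NA.
- by move=> w m Nm; have := NA (cW w) m Nm; rewrite [X in N X -> _]dunkl_W.
- by move=> y m Nm; have := NA (ch y) m Nm; rewrite [X in N X -> _]dunkl_h.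
Qed.

(** The ideal that defines the restricted algebra acts through C[h]^W_+ alone, as
    C[h^*]^W_+ kills M. *)
Lemma ideal_inv_span (a : H) (m : M) :
  two_sided_ideal (@restricted_rel _ _ _ rho alpha alphav c) a -> inv_span (a *: m).
Proof.
have sI := inv_span_opsub roots c tau.
elim=> [|x s y z rs _ IH]; first by rewrite scale0r; apply: inv_span0.
rewrite scalerDl -!scalerA; apply: (opsubD sI) => //; apply: opsub_scale => //.
case: rs => [p /invariant_sym_hdE ip|q iq].
  by rewrite [X in inv_span X]dunkl_sym_hd; apply: inv_spanZ.
by rewrite sh_inv_kill //; apply: inv_span0.
Qed.

End InvariantAction.

(** * Baby Verma modules and simple heads *)

Lemma rproj_eq (A : pzRingType) (S : A -> Prop) (x y : A) :
  rproj S x = rproj S y -> two_sided_ideal S (x - y).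
Proof.
move=> e; apply/asboolP; rewrite -[asbool _]/(x - y \in ideal_pred S).
by rewrite Quotient.idealrBE; apply/eqP.
Qed.

Lemma scale_shift (A : pzRingType) (M : lmodType A) (a b : A) (m : M) :
  b *: m - m = (b - a) *: m + (a *: m - m).
Proof. by rewrite scalerBl addrA subrK. Qed.

Lemma lproj_gen0 (A : pzRingType) (M : lmodType A) (S : M -> Prop) x : S x -> lproj S x = 0.
Proof. by move=> Sx; apply/lproj_eq0/submod_spanS. Qed.

(** B is isomorphic to X / K.  Stated for abstract modules, so that towers of
    concrete quotients are handled one step at a time. *)
Definition is_quotient (A : pzRingType) (X B : lmodType A) (K : X -> Prop) :=
  exists p : {linear X -> B},
    (forall b, exists x, b = p x) /\ (forall x, p x = 0 <-> K x).

Section QuotientModels.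
Variables (A : pzRingType) (X : lmodType A).

(** Pulled back along the isomorphism, the submodule generated by I Y is the least
    one that contains I X, which is K. *)
Lemma isomorphic_quotient (Y : lmodType A) (I : A -> Prop) (S : Y -> Prop) (K : X -> Prop) :
  isomorphic_modules X Y -> (forall y, S y <-> exists2 a, I a & exists y', y = a *: y') ->
  submodule K -> (forall a x, I a -> K (a *: x)) ->
  (forall N, submodule N -> (forall a x, I a -> N (a *: x)) -> forall x, K x -> N x) ->
  is_quotient (lquot S) K.
Proof.
move=> [F [G [FK GK]]] SE sK IK Kmin; exists (lproj S \o F : {linear X -> _}); split=> [b|x] /=.
  by have [y ->] := lproj_surj b; exists (G y); rewrite /= GK.
split=> [/lproj_eq0 e|].
  rewrite -(FK x); apply: (submod_span_sub (N := fun y => K (G y)) _ _ e).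
    split; first by rewrite linear0; case: sK.
    by move=> a u v Ku Kv; rewrite linearP; apply: (proj2 sK).
  by move=> _ /SE[a Ia [y ->]]; rewrite linearZ; apply: IK.
apply: (Kmin (fun x => lproj S (F x) = 0)) => [|a y Ia].
  by split=> [|a u v u0 v0]; rewrite ?linear0 // !linearP /= u0 v0 scaler0 addr0.
by apply: lproj_gen0; apply/SE; exists a => //; exists (F y); rewrite linearZ.
Qed.

Variables (B : lmodType A) (K J : X -> Prop).
Hypothesis K_quot : is_quotient B K.

Lemma quotient_act1 (a : A) :
  (forall b : B, a *: b = b) <-> forall x, K (a *: x - x).
Proof.
have [p [ps p0]] := K_quot; split=> [a1 x|Ka b].
  apply/p0; transitivity (a *: p x - p x); first by rewrite linearB linearZ.
  by rewrite a1 subrr.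
by have [x ->] := ps b; apply: subr0_eq; rewrite -linearZ -linearB; apply/p0.
Qed.

Hypothesis J_sub : submodule J.
Hypothesis J_K : forall x, K x -> J x.
Hypothesis J_proper : exists x, ~ J x.
Hypothesis J_top : forall N : X -> Prop, submodule N -> (forall x, K x -> N x) ->
  forall x, N x -> ~ J x -> forall x', N x'.

(** J_top says that the image of J is the largest proper submodule of B, hence its
    only maximal submodule. *)
Lemma radical_image (p : {linear X -> B}) : (forall b, exists x, b = p x) ->
  (forall x, p x = 0 <-> K x) -> forall m, radical (p m) <-> J m.
Proof.
move=> p_surj p0 m.
pose N0 b := exists2 x, b = p x & J x.
have N0J x : N0 (p x) -> J x.
  move=> [y e Jy]; rewrite -[x]addr0 -(subrr y) addrCA -[y]scale1r.
  by apply: (proj2 J_sub); rewrite ?scale1r //; apply/J_K/p0; rewrite linearB /= e subrr.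
have pull N : submodule N -> submodule (fun x => N (p x)) /\ (forall x, K x -> N (p x)).
  move=> [N00 NZ]; split; last by move=> x /p0 ->.
  by split=> [|a u v Nu Nv]; rewrite ?linear0 // linearP; apply: NZ.
have sN0 : submodule N0.
  split; first by exists 0; [rewrite linear0|case: J_sub].
  move=> a _ _ [x -> Jx] [y -> Jy]; exists (a *: x + y); first by rewrite linearP.
  by apply: (proj2 J_sub).
have dich N : submodule N -> (forall b, N b -> N0 b) \/ (forall b, N b).
  move=> sN; have [kN pN] := pull N sN.
  have [[x Nx nJx]|none] := pselect (exists2 x, N (p x) & ~ J x).
    by right=> b; have [y ->] := p_surj b; apply: (J_top kN pN Nx nJx).
  left=> b Nb; have [x eb] := p_surj b; exists x => //; apply: contrapT => nJ.
  by apply: none; exists x => //; rewrite -eb.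
split=> [rad|Jm].
  apply: (N0J m); apply: rad; split=> //.
    by have [x nJx] := J_proper; exists (p x) => /N0J.
  move=> N' sN' _; exact: dich.
move=> N [sN [b nNb] max].
have [sub|allN] := dich N sN; last by case: nNb; apply: allN.
have [sub'|all] := max _ sN0 sub; first by apply: sub'; exists m.
have [x nJx] := J_proper; case: nJx; exact: N0J.
Qed.

Lemma radical_span (b : B) : submod_span (@radical A B) b -> radical b.
Proof.
apply: submod_span_sub => //; split=> [N [[N0 _] _ _] //|a u v ru rv N mN].
by have [[_ NZ] _ _] := mN; apply: NZ; [apply: ru|apply: rv].
Qed.

Lemma head_quotient : is_quotient (module_head B) J.
Proof.
have [p [ps p0]] := K_quot; have rP := radical_image ps p0.
exists (lproj (@radical A B) \o p : {linear X -> _}); split=> [h|x] /=.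
  by have [b ->] := lproj_surj h; have [x ->] := ps b; exists x.
split=> [/lproj_eq0 /radical_span /rP //|/rP rad].
exact: lproj_gen0.
Qed.

End QuotientModels.

Section HeadModel.
Variables (R : realType) (W : finGroupType) (n : nat).
Variable rho : mx_representation R[i] [set: W] n.
Variables (alpha : W -> 'cV[R[i]]_n) (alphav : W -> 'rV[R[i]]_n).
Hypothesis roots : reflection_roots rho alpha alphav.
Variable c : W -> R[i].
Hypothesis c_inv : conjugation_invariant rho c.
Local Notation C := R[i].
Local Notation H := (cherednik rho alpha alphav c).
Variable lambda : Irr R W.
Local Notation tau := (irr_repr lambda).
Local Notation d := (irr_degree lambda).
Local Notation M := (dunkl roots c_inv tau).
Local Notation V := (polmod C n d).
Local Notation vrad := (vrad rho alphav c tau).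
Local Notation opsub := (opsub rho alphav c tau).
Local Notation inv_span := (@inv_span R W n rho d).

Lemma opsub_submodule (N : V -> Prop) : opsub N -> submodule (N : M -> Prop).
Proof.
move=> sN; split; first exact: (opsub0 sN).
by move=> a u v Nu Nv; apply: (opsubD sN) => //; apply: opsub_scale.
Qed.

Lemma lambda_irr : mx_irreducible tau. Proof. exact: socle_irr. Qed.

Lemma baby_verma_quotient : is_quotient (baby_verma rho alpha alphav c lambda) (inv_span : M -> Prop).
Proof.
have sI := inv_span_opsub roots c tau.
apply: (isomorphic_quotient (I := fun a => exists2 p, invariant_sym_hd rho p &
  a = cherednik_sym_hd rho alpha alphav c p) (verma_dunkl roots c_inv tau)).
- move=> y; split=> [[p v ip]|[_ [p ip ->] [v ->]]]; last exact: baby_relM.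
  by exists (cherednik_sym_hd rho alpha alphav c p); [exists p|exists v].
- exact: opsub_submodule.
- move=> _ x [p ip ->]; rewrite [X in inv_span X]dunkl_sym_hd.
  by apply/inv_spanZ/invariant_sym_hdE.
- move=> N sN NI x Ix; apply: (inv_span_sub (submodule_opsub sN) _ Ix) => p m ip.
  have := NI _ m (ex_intro2 _ _ p (proj2 (invariant_sym_hdE rho p) ip) erefl).
  by rewrite [X in N X -> _]dunkl_sym_hd.
Qed.

Lemma cst_not_rad : exists m, ~ vrad m.
Proof.
have d0 : (0 < d)%N by case/mx_irrP: lambda_irr.
exists (cst n (delta_mx (Ordinal d0) 0)) => /(_ [::]).
rewrite ev0_cst => /colP /(_ (Ordinal d0)); rewrite !mxE !eqxx => /eqP.
by rewrite oner_eq0.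
Qed.

Lemma simple_head_quotient : is_quotient (simple_head rho alpha alphav c lambda) (vrad : M -> Prop).
Proof.
apply: (head_quotient baby_verma_quotient).
- exact: (opsub_submodule (rad_opsub roots c_inv tau)).
- by move=> x; apply: (inv_span_rad roots c tau).
- exact: cst_not_rad.
- move=> N sN NK x Nx nJ.
  exact: (not_rad_full roots lambda_irr (submodule_opsub sN) NK Nx nJ).
Qed.

(** Two lifts of e differ by an element of the defining ideal, which maps M into
    inv_span, hence into the radical: one lift decides. *)
Lemma in_blockE e (a : H) : restricted_proj a = e ->
  (in_block lambda e <-> forall m : M, vrad (a *: m - m)).
Proof.
move=> ea; have act1 b := quotient_act1 simple_head_quotient b.
split=> [be|J b h eb].
  by apply/act1 => h; apply: be.
have {}J : forall m : M, vrad (b *: m - m); last exact: (proj2 (act1 b) J h).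
have sJ := rad_opsub roots c_inv tau; move=> m.
rewrite (scale_shift a b (m : M)).
apply: (opsubD sJ); last exact: J.
apply: (inv_span_rad roots c tau); apply: ideal_inv_span.
have e' : restricted_proj b = restricted_proj a by rewrite eb ea.
exact: (rproj_eq e').
Qed.

End HeadModel.

(** * Irreducible constituents of lowest-degree vectors *)

Section RegularCharacter.
Variables (R : realType) (W : finGroupType).
Local Notation C := R[i].

Lemma regular_trace (w : W) :
  \tr (regular_repr C [set: W] w) = (w == 1%g)%:R * #|W|%:R.
Proof.
have [->|w1] := eqVneq w 1%g.
  by rewrite repr_mx1 mxtrace1 mul1r -cardsT.
rewrite mul0r; apply: big1 => i _; rewrite 2!mxE /=.
rewrite -(inj_eq enum_val_inj) gring_indexK ?in_setT //.
by rewrite eq_mulVg1 mulKg (negbTE w1).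
Qed.

(** The decomposition of the character of the regular representation. *)
Lemma regular_decomposition (w : W) :
  \sum_(mu : Irr R W) \sum_r (irr_degree mu)%:R * irr_repr mu w r r =
  (w == 1%g)%:R * #|W|%:R.
Proof.
have C'G : pgroup.pgroup (negn [pchar C]) [set: W].
  by apply/pgroup.pgroupP => p _; rewrite inE /= pchar_num.
have sp : group_splitting_field C [set: W]%G.
  by move=> d tau irr; apply: group_closure_closed_field irr.
rewrite -regular_trace (mxtrace_regular_pchar (Irr R W) C'G sp) ?in_setT //.
by apply: eq_bigr => mu _; rewrite -mulr_sumr mulr_natl.
Qed.

End RegularCharacter.

Section Column.
Variables (R : realType) (W : finGroupType) (n : nat).
Variable rho : mx_representation R[i] [set: W] n.
Local Notation C := R[i].
Variables (A : pzRingType) (ck : C -> A) (ch : 'cV[C]_n -> A) (cW : W -> A).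
Hypothesis ckD : {morph ck : a b / a + b}.
Hypothesis ckM : {morph ck : a b / a * b}.
Hypothesis ck1 : ck 1 = 1.
Hypothesis ck_central : forall a h, ck a * h = h * ck a.
Hypothesis cW1 : cW 1%g = 1.
Hypothesis cWM : forall u v, cW (u * v)%g = cW u * cW v.
Hypothesis cW_ch : forall w y, cW w * ch y = ch (rho w *m y) * cW w.
Variables (X : lmodType A) (t : X).

Let ck0 : ck 0 = 0.
Proof. by apply: (addrI (ck 0)); rewrite -ckD !addr0. Qed.

(** For fixed r the vectors column mu r j span a copy of mu, or 0, in the W-module
    generated by t: they are the images of t under matrix units of mu, up to a
    factor. *)
Definition column (mu : Irr R W) r j : X :=
  \sum_w (ck (irr_repr mu w^-1%g r j) * cW w) *: t.

Arguments column : clear implicits.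

Lemma ck_sum (I : Type) (r : seq I) (Q : pred I) (F : I -> C) :
  ck (\sum_(i <- r | Q i) F i) = \sum_(i <- r | Q i) ck (F i).
Proof. exact: (big_morph ck ckD ck0). Qed.

Lemma column_W mu r j g :
  cW g *: column mu r j = \sum_l ck (irr_repr mu g l j) *: column mu r l.
Proof.
rewrite scaler_sumr (reindex_inj (mulgI g^-1%g)) /=.
transitivity (\sum_w \sum_l
    (ck (irr_repr mu g l j) * (ck (irr_repr mu w^-1%g r l) * cW w)) *: t).
  apply: eq_bigr => w _; rewrite -scaler_suml scalerA; congr (_ *: t).
  rewrite mulrA -ck_central -mulrA -cWM mulKVg.
  rewrite invMg invgK repr_mxM ?in_setT // mxE ck_sum mulr_suml.
  by apply: eq_bigr => l _; rewrite ckM ck_central mulrA.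
rewrite exchange_big; apply: eq_bigr => l _ /=.
by rewrite scaler_sumr; apply: eq_bigr => w _; rewrite scalerA.
Qed.

Lemma column_h mu r j i : (forall y, ch y *: t = 0) -> ch (delta_mx i 0) *: column mu r j = 0.
Proof.
move=> t0; rewrite scaler_sumr big1 // => w _; rewrite scalerA.
have e : ch (delta_mx i 0) * cW w = cW w * ch (rho w^-1%g *m delta_mx i 0).
  by rewrite cW_ch mulmxA rhoV mul1mx.
by rewrite mulrA -ck_central -mulrA e mulrA -scalerA t0 scaler0.
Qed.

(** The columns with j = r, weighted by the degrees, add up to |W| t, by the
    decomposition of the regular character. *)
Lemma column_neq0 : t <> 0 -> exists mu r j, column mu r j <> 0.
Proof.
move=> t0; apply: contrapT => none.
have col0 mu r j : column mu r j = 0 by apply: contrapT => ne; apply: none; exists mu, r, j.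
apply: t0; have card0 : (#|W|%:R : C) != 0.
  by rewrite pnatr_eq0 -lt0n; apply/card_gt0P; exists 1%g.
have e : ck #|W|%:R *: t = 0.
  transitivity (\sum_(mu : Irr R W) \sum_r ck (irr_degree mu)%:R *: column mu r r); last first.
    by rewrite big1 // => mu _; rewrite big1 // => r _; rewrite col0 scaler0.
  transitivity (\sum_w (ck ((w == 1%g)%:R * #|W|%:R) * cW w) *: t).
    rewrite (bigD1 1%g) //= eqxx mul1r cW1 mulr1 big1 ?addr0 // => w /negPf ->.
    by rewrite mul0r ck0 mul0r scale0r.
  rewrite (reindex_inj invg_inj) /=.
  transitivity (\sum_w \sum_(mu : Irr R W) \sum_r
      (ck (irr_degree mu)%:R * (ck (irr_repr mu w r r) * cW w^-1%g)) *: t).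
    apply: eq_bigr => w _; rewrite (inv_eq invgK) invg1 -regular_decomposition ck_sum.
    rewrite mulr_suml scaler_suml; apply: eq_bigr => mu _.
    rewrite ck_sum mulr_suml scaler_suml; apply: eq_bigr => r _.
    by rewrite ckM mulrA.
  rewrite exchange_big; apply: eq_bigr => mu _ /=.
  rewrite exchange_big; apply: eq_bigr => r _ /=.
  rewrite scaler_sumr (reindex_inj invg_inj) /=.
  by apply: eq_bigr => w _; rewrite scalerA invgK.
rewrite -[t]scale1r -ck1 -(mulVf card0) ckM -scalerA e.
by rewrite scaler0.
Qed.

End Column.
Arguments column {R W A} ck cW {X} t mu r j.

Section ColumnMap.
Variables (R : realType) (W : finGroupType) (n : nat).
Variable rho : mx_representation R[i] [set: W] n.
Variables (alpha : W -> 'cV[R[i]]_n) (alphav : W -> 'rV[R[i]]_n).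
Hypothesis roots : reflection_roots rho alpha alphav.
Variable c : W -> R[i].
Hypothesis c_inv : conjugation_invariant rho c.
Local Notation H := (cherednik rho alpha alphav c).
Local Notation ck := (cherednik_const rho alpha alphav c).
Local Notation ch := (cherednik_h rho alpha alphav c).
Local Notation cW := (cherednik_W rho alpha alphav c).
Local Notation shd := (cherednik_sym_hd rho alpha alphav c).
Local Notation Mod mu := (dunkl roots c_inv (irr_repr mu)).
Local Notation Rad mu := (vrad rho alphav c (irr_repr mu)).

Section Module.
Variables (X : lmodType H) (t : X).

Lemma column_map : t <> 0 -> (forall y, ch y *: t = 0) ->
  exists (mu : Irr R W) (psi : {linear Mod mu -> X}),
    (exists m, psi m <> 0) /\ (forall m, exists h, psi m = h *: t).
Proof.
move=> t0 th; have [mu [r [j cj]]] := column_neq0 (@ckD _ _ _ rho alpha alphav c) (@ckM _ _ _ rho alpha alphav c)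
    (ck1 rho alpha alphav c) (cW1 rho alpha alphav c) t0.
have hh i l : ch (delta_mx i 0) *: column ck cW t mu r l = 0.
  exact: (column_h (@ck_central _ _ _ rho alpha alphav c) (@cW_ch _ _ _ rho alpha alphav c)).
have hW w l : cW w *: column ck cW t mu r l =
    \sum_k ck (irr_repr mu w k l) *: column ck cW t mu r k.
  exact: (column_W (@ckD _ _ _ rho alpha alphav c) (@ckM _ _ _ rho alpha alphav c)
    (@ck_central _ _ _ rho alpha alphav c) (@cWM _ _ _ rho alpha alphav c)).
have [psi psiE] := @dunkl_lift_exists _ _ _ rho alpha alphav roots c c_inv _ (irr_repr mu) X
  (column ck cW t mu r) hh hW.
exists mu, psi; split.
  exists (cst n (delta_mx j 0)); rewrite psiE (bigD1 j) //= mxE !eqxx ck1 scale1r.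
  rewrite big1 ?addr0 // => l nl; by rewrite mxE (negPf nl) ck0 scale0r.
move=> m; elim/cst_ind: m => [v|m m' [h IH] [h' IH']|i m [h IH]].
- exists (\sum_l ck (v l 0) * \sum_w ck (irr_repr mu w^-1%g r l) * cW w).
  rewrite psiE scaler_suml; apply: eq_bigr => l _.
  by rewrite -scalerA scaler_suml.
- exists (h + h'); rewrite scalerDl -IH -IH'; exact: (linearD psi m m').
- exists (cherednik_hd rho alpha alphav c (delta_mx 0 i) * h).
  rewrite -scalerA -IH -linearZ; apply: (congr1 psi).
  by rewrite [RHS]dunkl_hd sym_hd_delta.
Qed.

Lemma map_kernel (mu : Irr R W) (psi : {linear Mod mu -> X}) :
  (forall p x, hd_invariant rho p -> shd p *: (x : X) = 0) -> (exists m, psi m <> 0) ->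
  forall m, psi m = 0 -> Rad mu m.
Proof.
move=> X0 [m0 nm0] m pm; apply: contrapT => nJ; apply: nm0.
have sK : submodule (fun m => psi m = 0).
  split; first exact: linear0.
  by move=> a u v pu pv; rewrite linearP pu pv scaler0 addr0.
have sN := submodule_opsub sK.
apply: (not_rad_full roots (lambda_irr mu) sN _ pm nJ) => x Ix.
apply: (inv_span_sub (N := fun m => psi m = 0) sN _ Ix) => p y ip.
rewrite -[LHS](_ : psi (shd p *: (y : Mod mu)) = _).
  by rewrite linearZ; exact: X0.
by apply: (congr1 psi); apply: dunkl_sym_hd.
Qed.

End Module.

Variables (lambda : Irr R W) (e : restricted rho alpha alphav c).
Hypothesis only : forall mu, in_block mu e -> mu = lambda.

(** A nonzero column of t spans a copy of some mu that h kills, hence gives a nonzero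
    map from Delta(mu), with kernel inside the radical.  As a acts by 1 on its
    image, a acts by 1 on L(mu), which puts mu into the block. *)
Lemma block_embedding (X : lmodType H) (t : X) (a : H) : restricted_proj a = e ->
  (forall p (x : X), hd_invariant rho p -> shd p *: x = 0) ->
  (forall x : X, a *: x = x) -> t <> 0 -> (forall y, ch y *: t = 0) ->
  exists psi : {linear Mod lambda -> X},
    [/\ exists m, psi m <> 0, forall m, psi m = 0 -> Rad lambda m &
        forall m, exists h, psi m = h *: t].
Proof.
move=> ea X0 a1 t0 th; have [mu [psi [nz im]]] := column_map t0 th.
have ker := map_kernel X0 nz.
have em : mu = lambda.
  apply: only; apply/(in_blockE roots c_inv mu ea) => m; apply: ker.
  transitivity (a *: psi m - psi m); first by rewrite linearB linearZ.
  by rewrite a1 subrr.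
by case: _ / em in psi nz im ker *; exists psi.
Qed.

End ColumnMap.

(** * The singleton block *)

Lemma lproj_submodule (A : pzRingType) (M : lmodType A) (N : M -> Prop) m :
  submodule N -> (lproj N m = 0 <-> N m).
Proof.
move=> sN; split=> [/lproj_eq0|Nm]; last exact: lproj_gen0.
exact: submod_span_sub.
Qed.

Lemma scale_commutator (A : pzRingType) (M : lmodType A) (a b : A) (u v m m' : M) :
  b *: u + v - a *: (b *: m + m') =
  b *: (u - a *: m) + ((v - a *: m') + (b *: (a *: m) - a *: (b *: m))).
Proof.
rewrite scalerBr scalerDr [RHS]addrCA [X in _ = _ + X]addrA subrK [RHS]addrC.
by rewrite [RHS]addrACA -opprD.
Qed.

Lemma scale_idempotent (A : pzRingType) (M : lmodType A) (a : A) (m m' : M) :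
  a *: m - m = a *: (m - a *: m') + ((a *: (a *: m') - a *: m') - (m - a *: m')).
Proof.
by rewrite scalerBr opprB !subrKA.
Qed.

Section AbstractSubquotient.
Variables (A : pzRingType) (M : lmodType A).

(** The a x with x in M form, together with K, a submodule that is not contained in
    J, hence all of M; on the image of an idempotent the idempotent is the
    identity. *)
Lemma idempotent_identity (a : A) (K J : M -> Prop) :
  submodule K -> submodule J -> (forall x, K x -> J x) -> (exists x, ~ J x) ->
  (forall N, submodule N -> (forall x, K x -> N x) ->
     forall x, N x -> ~ J x -> forall y, N y) ->
  (forall x, K (a *: (a *: x) - a *: x)) ->
  (forall b x, K (b *: (a *: x) - a *: (b *: x))) ->
  (forall x, J (a *: x - x)) -> forall x, K (a *: x - x).
Proof.
move=> sK sJ KJ [x0 nJx0] top idem comm aJ.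
have subD (N : M -> Prop) x y : submodule N -> N x -> N y -> N (x + y).
  by move=> sN Nx Ny; rewrite -[x]scale1r; apply: (proj2 sN).
have subZ (N : M -> Prop) b x : submodule N -> N x -> N (b *: x).
  by move=> sN Nx; rewrite -[_ *: _]addr0; apply: (proj2 sN) => //; case: sN.
have subB (N : M -> Prop) x y : submodule N -> N x -> N y -> N (x - y).
  by move=> sN Nx Ny; apply: (subD) => //; rewrite -scaleN1r; apply: (subZ).
pose N x := exists y, K (x - a *: y).
have sN : submodule N.
  split; first by exists 0; rewrite scaler0 subr0; case: sK.
  move=> b u v [x Kx] [y Ky]; exists (b *: x + y); rewrite scale_commutator.
  by apply: (proj2 sK) => //; apply: (subD).
have KN x : K x -> N x by move=> Kx; exists 0; rewrite scaler0 subr0.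
have Nx0 : N (a *: x0) by exists x0; rewrite subrr; case: sK.
have nJa : ~ J (a *: x0).
  move=> Ja; apply: nJx0; rewrite -[x0](subKr (a *: x0)).
  exact: (subB).
move=> x; have [y Ky] := top N sN KN _ Nx0 nJa x.
rewrite (scale_idempotent a x y); apply: (subD) => //; first exact: (subZ).
exact: (subB).
Qed.

Lemma lquot_annihilated (N : M -> Prop) (b : A) : submodule N -> (forall x, N (b *: x)) ->
  forall q : lquot N, b *: q = 0.
Proof.
by move=> sN Nb q; have [x ->] := lproj_surj q; rewrite -linearZ; apply: lproj_gen0.
Qed.

Lemma lquot_fixed (N : M -> Prop) (a : A) : submodule N -> (forall x, N (a *: x - x)) ->
  forall q : lquot N, a *: q = q.
Proof.
move=> sN Na q; have [x ->] := lproj_surj q; apply: subr0_eq.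
by rewrite -linearZ -linearB; apply: lproj_gen0.
Qed.

(** The submodule generated by u modulo N is isomorphic to M / J. *)
Definition cyclic_subquotient (N J : M -> Prop) (u : M) := exists psi : {linear M -> lquot N},
  [/\ forall x, psi x = 0 <-> J x, forall x, exists h, psi x = h *: lproj N u &
      exists x, psi x = lproj N u].

(** By maximality every nonzero submodule of M / N contains the class of u.  If
    psi were nonzero on J, then u, hence the whole image of psi, would come from J,
    and M = J.  If the image of psi is nonzero, it contains u. *)
Lemma cyclic_subquotient_of (N J : M -> Prop) (u : M) (h0 : A) (psi : {linear M -> lquot N}) :
  submodule N -> submodule J -> (exists x, ~ J x) ->
  (forall K, submodule K -> (forall x, N x -> K x) -> forall x, K x -> ~ N x -> K u) ->
  (exists x, psi x <> 0) -> (forall x, psi x = 0 -> J x) ->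
  (forall x, exists h, psi x = h *: lproj N (h0 *: u)) -> cyclic_subquotient N J u.
Proof.
move=> sN sJ [x0 nJx0] max [x1 nx1] ker im.
have q0 x : lproj N x = 0 <-> N x := lproj_submodule x sN.
have im' x : exists h, psi x = h *: lproj N u.
  by have [h ->] := im x; exists (h * h0); rewrite linearZ scalerA.
have pull (K : M -> Prop) : submodule K -> (exists2 x, K x & psi x <> 0) ->
    exists2 x, K x & psi x = lproj N u.
  move=> sK [x Kx nx].
  pose N' y := exists2 z, K z & psi z = lproj N y.
  have sN' : submodule N'.
    split; first by exists 0; [case: sK|rewrite !linear0].
    move=> b y y' [z Kz ez] [z' Kz' ez']; exists (b *: z + z'); first exact: (proj2 sK).
    by rewrite !linearP ez ez'.
  have NN' y : N y -> N' y.
    by move=> Ny; exists 0; [case: sK|rewrite linear0; apply: esym; apply/q0].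
  have [y ey] := lproj_surj (psi x).
  apply: (max N' sN' NN' y); first by exists x.
  by move=> Ny; apply: nx; rewrite ey; apply/q0.
exists psi; split=> //; last first.
  have [x _ ex] : exists2 x, True & psi x = lproj N u.
    by apply: (pull (fun=> True)); [split|exists x1].
  by exists x.
move=> x; split; first exact: ker.
move=> Jx; apply: contrapT => nx; apply: nJx0.
have [y Jy ey] : exists2 y, J y & psi y = lproj N u by apply: pull => //; exists x.
have [h eh] := im' x0; rewrite -[x0](subrK (h *: y)) addrC.
apply: (proj2 sJ) => //; apply: ker; apply: subr0_eq.
by rewrite subr0 linearB linearZ /= ey eh subrr.
Qed.

Lemma cyclic_subquotient_kill (N J : M -> Prop) u (b : A) : submodule N ->
  cyclic_subquotient N J u -> (forall h, N (b *: (h *: u))) -> forall x, J (b *: x).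
Proof.
move=> sN [psi [ker im _]] Nb x; apply/ker; rewrite linearZ /=; have [h ->] := im x.
by rewrite -!linearZ; apply: lproj_gen0.
Qed.

Lemma cyclic_subquotient_reach (N J : M -> Prop) u (b : A) : submodule N ->
  cyclic_subquotient N J u -> (forall x, J (b *: x)) -> N (b *: u).
Proof.
move=> sN [psi [ker _ [x ex]]] Jb; apply/(lproj_submodule _ sN).
by rewrite linearZ /= -ex -linearZ; apply/ker.
Qed.

End AbstractSubquotient.

Section MaximalAvoiding.
Variables (R : realType) (W : finGroupType) (n : nat).
Variable rho : mx_representation R[i] [set: W] n.
Variables (alpha : W -> 'cV[R[i]]_n) (alphav : W -> 'rV[R[i]]_n).
Hypothesis roots : reflection_roots rho alpha alphav.
Variable c : W -> R[i].
Variables (d : nat) (tau : mx_representation R[i] [set: W] d).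
Local Notation C := R[i].
Local Notation V := (polmod C n d).
Local Notation opsub := (opsub rho alphav c tau).
Local Notation dops := (dops rho alphav c tau).
Local Notation D := (dop rho alphav c tau).

(** Zorn's lemma.  The empty set is admitted among the candidates, so that the
    empty chain has a bound. *)
Lemma opsub_maximal (N : V -> Prop) u : opsub N -> ~ N u ->
  exists N' : V -> Prop, [/\ opsub N', forall x, N x -> N' x, ~ N' u &
    forall K : V -> Prop, opsub K -> (forall x, N' x -> K x) ->
      forall x, K x -> ~ N' x -> K u].
Proof.
move=> sN nNu.
pose Q (A : classical_sets.set V) := (forall x, ~ A x) \/ [/\ opsub A, forall x, N x -> A x & ~ A u].
have chain (F : classical_sets.set (classical_sets.set V)) : (forall A, F A -> Q A) ->
    (forall A B, F A -> F B -> (forall x, A x -> B x) \/ (forall x, B x -> A x)) ->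
    Q (fun x => exists2 A, F A & A x).
  move=> FQ tot.
  have [[A FA [a Aa]]|none] := pselect (exists2 A, F A & exists a, A a); last first.
    by left=> x [A FA Ax]; apply: none; exists A => //; exists x.
  have ne B b : F B -> B b -> [/\ opsub B, forall x, N x -> B x & ~ B u].
    by move=> FB Bb; case: (FQ B FB) => // /(_ b).
  right; split.
  - split.
    + by exists A => //; have [sA _ _] := ne A a FA Aa; apply: (opsub0 sA).
    + move=> x y [B FB Bx] [B' FB' B'y].
      have [sB _ _] := ne B x FB Bx; have [sB' _ _] := ne B' y FB' B'y.
      have [sub|sub] := tot B B' FB FB'.
        by exists B' => //; apply: (opsubD sB') => //; apply: sub.
      by exists B => //; apply: (opsubD sB) => //; apply: sub.
    + move=> p x [B FB Bx]; exists B => //.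
      by have [sB _ _] := ne B x FB Bx; apply: (opsubZ sB).
    + move=> w x [B FB Bx]; exists B => //.
      by have [sB _ _] := ne B x FB Bx; apply: (opsubW sB).
    + move=> y x [B FB Bx]; exists B => //.
      by have [sB _ _] := ne B x FB Bx; apply: (opsubH sB).
  - by move=> x Nx; exists A => //; have [_ NA _] := ne A a FA Aa; apply: NA.
  - by move=> [B FB Bu]; have [_ _] := ne B u FB Bu.
have [N' [QN' max]] : exists A, Q A /\ forall B, classical_sets.proper A B -> ~ Q B.
  by apply: classical_sets.Zorn_bigcup => F FQ tot; apply: chain.
have QN : Q N by right.
case: QN' => [empty|[sN' NN' nN'u]].
  case: (max N) => //; split; first by move=> x /empty.
  by move=> /(_ 0 (opsub0 sN)) /empty.
exists N'; split=> // K sK N'K x Kx nN'x; apply: contrapT => nKu.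
apply: (max K); first by split=> // /(_ x Kx).
by right; split=> // y /NN' /N'K.
Qed.

Lemma dops_nil (m : V) : exists k, forall ys, (k <= size ys)%N -> dops ys m = 0.
Proof.
have [k /(_ k (leqnn _))[e _]] := vcomp_bound m.
exists k => ys le; rewrite e (dops_sum roots) big1 // => -[j lt] _ /=.
have {le} : (j < size ys)%N by apply: leq_trans le.
elim/last_ind: ys j m {lt k e} => // ys y IH [|j] m; rewrite size_rcons dops_rcons.
  by rewrite vcomp0E (dop_cst roots) (dops0 roots).
by rewrite -(vcomp_dop roots) ltnS => /IH.
Qed.

Lemma opsub_lowest (N : V -> Prop) u : opsub N -> ~ N u ->
  exists ys, ~ N (dops ys u) /\ forall y, N (D y (dops ys u)).
Proof.
move=> sN nNu.
pose Q k := `[< exists2 ys, size ys = k & ~ N (dops ys u) >]%B.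
have exQ : exists k, Q k by exists 0%N; apply/asboolP; exists [::].
have [k0 k0P] := dops_nil u.
have ubQ k : Q k -> (k <= k0)%N.
  move=> /asboolP[ys <- nN]; rewrite leqNgt; apply/negP => /ltnW /k0P e.
  by apply: nN; rewrite e; apply: (opsub0 sN).
case: (ex_maxnP exQ ubQ) => k /asboolP[ys sz nN] max; exists ys; split=> // y.
apply: contrapT => nD; have : Q k.+1 by apply/asboolP; exists (y :: ys); rewrite //= sz.
by move/max; rewrite ltnn.
Qed.

End MaximalAvoiding.

Section Star.
Variables (R : realType) (W : finGroupType) (n : nat).
Variable rho : mx_representation R[i] [set: W] n.
Variables (alpha : W -> 'cV[R[i]]_n) (alphav : W -> 'rV[R[i]]_n).
Hypothesis roots : reflection_roots rho alpha alphav.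
Variable c : W -> R[i].
Hypothesis c_inv : conjugation_invariant rho c.
Local Notation C := R[i].
Local Notation H := (cherednik rho alpha alphav c).
Local Notation ck := (cherednik_const rho alpha alphav c).
Local Notation ch := (cherednik_h rho alpha alphav c).
Local Notation cW := (cherednik_W rho alpha alphav c).
Local Notation shd := (cherednik_sym_hd rho alpha alphav c).
Variable lambda : Irr R W.
Local Notation tau := (irr_repr lambda).
Local Notation d := (irr_degree lambda).
Local Notation M := (dunkl roots c_inv tau).
Local Notation V := (polmod C n d).
Local Notation vrad := (vrad rho alphav c tau).
Local Notation opsub := (opsub rho alphav c tau).
Local Notation inv_span := (@inv_span R W n rho d).
Local Notation avg := (avg rho tau).
Variable e : restricted rho alpha alphav c.
Hypothesis e_idem : central_idempotent e.
Hypothesis e_lambda : in_block lambda e.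
Hypothesis only : forall mu, in_block mu e -> mu = lambda.

Lemma restricted_inv_span (a b : H) (m : M) : restricted_proj a = restricted_proj b ->
  inv_span (a *: m - b *: m).
Proof.
move=> /rproj_eq/(ideal_inv_span (m : M)) I.
by move: I; rewrite [X in inv_span X](scalerBl a b (m : M)).
Qed.

(** The lift acts by 1 on the simple head M / J, and modulo inv_span it is a central
    idempotent. *)
Lemma block_lift : exists2 a : H, restricted_proj a = e & forall m : M, inv_span (a *: m - m).
Proof.
have [a ea] : exists a : H, restricted_proj a = e.
  by exists (generic_quotient.repr e); exact: (reprK e).
exists a => //.
apply: (idempotent_identity (J := vrad : M -> Prop)).
- exact: (opsub_submodule roots c_inv (inv_span_opsub roots c tau)).
- exact: (opsub_submodule roots c_inv (rad_opsub roots c_inv tau)).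
- exact: (inv_span_rad roots c tau).
- exact: cst_not_rad.
- move=> N sN NK x Nx nJ.
  exact: (not_rad_full roots (lambda_irr lambda) (submodule_opsub sN) NK Nx nJ).
- move=> m; rewrite scalerA; apply: restricted_inv_span.
  transitivity (restricted_proj a * restricted_proj a); first exact: (rmorphM (@rproj _ _)).
  by rewrite ea; case: e_idem.
- move=> b m; rewrite !scalerA; apply: restricted_inv_span.
  transitivity (restricted_proj b * restricted_proj a); first exact: (rmorphM (@rproj _ _)).
  transitivity (restricted_proj a * restricted_proj b); last exact: esym (rmorphM (@rproj _ _) _ _).
  by rewrite ea; case: e_idem.
- exact: (proj1 (in_blockE roots c_inv lambda ea) e_lambda).
Qed.

Lemma dops_scale ys u : exists h : H, dops rho alphav c tau ys u = h *: (u : M).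
Proof.
elim: ys => [|y ys [h IH]] /=; first by exists 1; rewrite scale1r.
exists (ch y * h); rewrite IH -[RHS]scalerA; exact: esym (dunkl_h _ _).
Qed.

(** Every vector outside N0 generates, modulo a suitable larger submodule, a copy
    of L(lambda): a singleton block has no other constituents. *)
Lemma star (N0 : V -> Prop) u : opsub N0 -> (forall x, inv_span x -> N0 x) -> ~ N0 u ->
  exists N : V -> Prop, [/\ opsub N, forall x, N0 x -> N x, ~ N u &
    cyclic_subquotient (N : M -> Prop) vrad u].
Proof.
move=> sN0 IN0 nN0u.
have [N [sN N0N nNu max]] := opsub_maximal sN0 nN0u.
have [ys [nNt Nt]] := opsub_lowest roots sN nNu.
have [h0 eh0] := dops_scale ys u.
have sM : submodule (N : M -> Prop) := opsub_submodule roots c_inv sN.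
have [a ea aI] := block_lift.
have X0 p (x : lquot (N : M -> Prop)) : hd_invariant rho p -> shd p *: x = 0.
  move=> ip; apply: (lquot_annihilated sM) => m.
  by rewrite [X in N X]dunkl_sym_hd; apply/N0N/IN0/inv_spanZ.
have a1 : forall x : lquot (N : M -> Prop), a *: x = x.
  by apply: (lquot_fixed sM) => m; apply/N0N/IN0/aI.
have t0 : lproj (N : M -> Prop) (h0 *: (u : M)) <> 0.
  by move/(lproj_submodule _ sM); rewrite -eh0.
have th y : ch y *: lproj (N : M -> Prop) (h0 *: (u : M)) = 0.
  rewrite -linearZ; apply: lproj_gen0; rewrite -eh0 [X in N X]dunkl_h; exact: Nt.
have [psi [nz ker im]] := block_embedding roots c_inv only ea X0 a1 t0 th.
exists N; split=> //; apply: (cyclic_subquotient_of sM _ _ _ nz ker im).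
- exact: (opsub_submodule roots c_inv (rad_opsub roots c_inv tau)).
- exact: cst_not_rad.
- by move=> K sK; apply: max; apply: submodule_opsub sK.
Qed.

Definition cavg : H := ck #|W|%:R^-1 * \sum_w cW w.

Lemma dunkl_avg (m : M) : cavg *: m = avg m :> V.
Proof.
rewrite /cavg -[LHS]scalerA [LHS]dunkl_const; congr (_ *: _).
by rewrite [LHS]scaler_suml; apply: eq_bigr => w _; apply: dunkl_W.
Qed.

(** If averaging kills a nonzero subquotient of M / inv_span, it kills the copy of
    L(lambda) that occurs in it. *)
Lemma avg_rad_all (N T : V -> Prop) u : opsub N -> (forall x, inv_span x -> N x) ->
  ~ N u -> opsub T -> T u -> (forall x, T x -> N (avg x)) -> forall m, vrad (avg m).
Proof.
move=> sN IN nNu sT Tu TN m; have [N' [sN' NN' _ sub]] := star sN IN nNu.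
rewrite -dunkl_avg; apply: (cyclic_subquotient_kill (opsub_submodule roots c_inv sN') sub) => h.
by rewrite [X in N' X]dunkl_avg; apply/NN'/TN/(opsub_scale _ sT).
Qed.

(** If averaging kills L(lambda), it kills M / inv_span: a vector of the form avg m
    outside inv_span would give a copy of L(lambda) that contains it. *)
Lemma avg_span_all : (forall m, vrad (avg m)) -> forall m, inv_span (avg m).
Proof.
move=> J m; apply: contrapT => nI.
have [N [sN _ nNu sub]] := star (inv_span_opsub roots c tau) (fun x Ix => Ix) nI.
apply: nNu; have avgE : cavg *: (avg m : M) = avg m.
  by rewrite [LHS]dunkl_avg; apply: avg_inv (inv_avg rho tau m).
rewrite -avgE; apply: (cyclic_subquotient_reach (opsub_submodule roots c_inv sN) sub) => x.
by rewrite [X in vrad X]dunkl_avg.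
Qed.

End Star.

Section Transport.
Variables (A : pzRingType) (X Y : lmodType A) (F : {linear X -> Y}) (G : {linear Y -> X}).
Hypothesis FK : cancel F G.

Fact endo_transport_linear (f : endo X) : linear (fun y => F (f (G y))).
Proof. by move=> a u v; rewrite linearP endo_linear linearP. Qed.
Definition endo_transport (f : endo X) : endo Y := Endo (endo_transport_linear f).

Lemma endo_transportE f x : endo_transport f (F x) = F (f x).
Proof. by rewrite /= FK. Qed.

End Transport.

(** Conjugation by an isomorphism carries a basis to a basis. *)
Lemma free_transport (A : pzRingType) (X Y : lmodType A) r : isomorphic_modules X Y ->
  free_of_rank (endo_module X : lmodType (endo X)) r ->
  free_of_rank (endo_module Y : lmodType (endo Y)) r.
Proof.
move=> [F [G [FK GK]]] [b bP]; exists (fun i => F (b i)) => y.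
have [a [ea ua]] := bP (G y).
exists [ffun i => endo_transport F G (a i)]; split.
  transitivity (F (\sum_i a i (b i))); first by rewrite -[LHS]GK [G y]ea.
  rewrite linear_sum; apply: eq_bigr => i _; rewrite ffunE.
  exact: esym (endo_transportE FK _ _).
move=> a' ea'; apply/ffunP => i; rewrite ffunE.
have eG : (G y : endo_module X) =
    \sum_j [ffun j => endo_transport G F (a' j)] j *: (b j : endo_module X).
  transitivity (G (\sum_j a' j (F (b j)))); first by rewrite [y in LHS]ea'.
  by rewrite linear_sum; apply: eq_bigr => j _; rewrite ffunE.
rewrite (ua _ eG) ffunE; apply: endoP => z /=.
by rewrite !GK.
Qed.

Theorem corollary4p5 (R : realType) (W : finGroupType) (n : nat)
    (rho : mx_representation R[i] [set: W] n)
    (reflection_group : complex_reflection_group rho)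
    (alpha : W -> 'cV[R[i]]_n) (alphav : W -> 'rV[R[i]]_n)
    (roots : reflection_roots rho alpha alphav)
    (c : W -> R[i]) (c_inv : conjugation_invariant rho c)
    (Omega : {set Irr R W}) (lambda : Irr R W)
    (block : Omega \in CM_partition rho alpha alphav c)
    (singleton : Omega = [set lambda]) :
  let Delta := verma rho alpha alphav c lambda in
  free_of_rank (endo_module Delta : lmodType (endo Delta)) #|W|.
Proof.
move=> Delta.
have [e [e_block e_lambda only]] : exists e : restricted rho alpha alphav c,
    [/\ block_idempotent e, in_block lambda e & forall mu, in_block mu e -> mu = lambda].
  move: block; rewrite singleton => /imsetP[x _ ex].
  have same mu : (mu \in [set lambda]) = `[< same_block rho alpha alphav c x mu >]%B.
    by rewrite ex !inE.
  have /asboolP[e [e_block xe le]] := etrans (esym (same lambda)) (set11 lambda).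
  exists e; split=> // mu me.
  by apply/set1P; rewrite same; apply/asboolP; exists e.
have [e_idem _ _] := e_block.
apply: (free_transport (verma_dunkl roots c_inv (irr_repr lambda))).
apply: (dunkl_free roots c_inv (proj1 reflection_group) (lambda_irr lambda)).
  exact: (avg_rad_all roots c_inv e_idem e_lambda only).
exact: (avg_span_all roots c_inv e_idem e_lambda only).
Qed.
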